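(* Let $\ell\in\frac12\mathbb{N}$, $\nu>0$, and let $P^{(\nu)}_n$ ($n\in\mathbb{N}$) be the monic matrix-valued orthogonal polynomials with respect to the matrix-valued Gegenbauer weight $W^{(\nu)}$ on $(-1,1)$, with squared norms $H^{(\nu)}_n$, as defined in the context. Then for all $n\in\mathbb{N}$: (i) $H^{(\nu)}_n$ is the diagonal matrix with entries, for $k\in\{0,\dots,2\ell\}$, $$\bigl(H^{(\nu)}_n\bigr)_{k,k}=\sqrt{\pi}\,\frac{\Gamma(\nu+\frac12)}{\Gamma(\nu+1)}\,\frac{\nu(2\ell+\nu+n)}{\nu+n}\,\frac{n!\,(\ell+\frac12+\nu)_n(2\ell+\nu)_n(\ell+\nu)_n}{(2\ell+\nu+1)_n(\nu+k)_n(2\ell+2\nu+n)_n(2\ell+\nu-k)_n}\,\frac{k!\,(2\ell-k)!\,(n+\nu+1)_{2\ell}}{(2\ell)!\,(n+\nu+1)_k(n+\nu+1)_{2\ell-k}}.$$ (ii) $\dfrac{dP^{(\nu)}_n}{dx}(x)=n\,P^{(\nu+1)}_{n-1}(x)$ (with $P^{(\nu+1)}_{-1}=0$). (iii) The Rodrigues formula $$P^{(\nu)}_n(x)=G^{(\nu)}_n\left(\frac{d^nW^{(\nu+n)}}{dx^n}(x)\right)W^{(\nu)}(x)^{-1},\qquad x\in(-1,1),$$ holds, where $$\bigl(G^{(\nu)}_n\bigr)_{j,k}=\delta_{j,k}\,\frac{(-1)^n(\nu)_n(\ell+\nu+\frac12)_n(\ell+\nu)_n(2\ell+\nu)_n}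{(\nu+\frac12)_n(\nu+k)_n(2\ell+\nu+1)_n(2\ell+2\nu+n)_n(2\ell+\nu-k)_n}.$$
   Context: Matrices are $(2\ell+1)\times(2\ell+1)$, indexed by $\{0,1,\dots,2\ell\}$; $\mathbb{N}=\{0,1,2,\dots\}$; $(a)_0=1$, $(a)_n=a(a+1)\cdots(a+n-1)$; derivatives are entrywise. The Gegenbauer polynomials are $C^{(\nu)}_n(x)=\frac{(2\nu)_n}{n!}\,{}_2F_1\!\left(-n,\,n+2\nu;\,\nu+\tfrac12;\,\tfrac12(1-x)\right)$. Definition of the weight. For $x\in(-1,1)$ and $m,n\in\{0,\dots,2\ell\}$ with $n\ge m$, $$\bigl(W^{(\nu)}(x)\bigr)_{m,n}=(1-x^2)^{\nu-1/2}\sum_{t=\max(0,n+m-2\ell)}^{m}\alpha^{(\nu)}_t(m,n)\,C^{(\nu)}_{m+n-2t}(x),$$ $$\alpha^{(\nu)}_t(m,n)=(-1)^m\frac{n!\,m!\,(m+n-2t)!}{t!\,(2\nu)_{m+n-2t}\,(\nu)_{n+m-t}}\,\frac{(\nu)_{n-t}(\nu)_{m-t}}{(n-t)!\,(m-t)!}\,\frac{n+m-2t+\nu}{n+m-t+\nu}\,(2\ell-m)!\,(n-2\ell)_{m-t}\,(-2\ell-\nu)_t\,\frac{2\ell+\nu}{(2\ell)!},$$ and $W^{(\nu)}(x)$ is extended to a symmetric matrix; it is positive definite for $x\in(-1,1)$. $P^{(\nu)}_n(x)=x^n\,\mathrm{I}+x^{n-1}P^{(\nu)}_{n,n-1}+\cdots+P^{(\nu)}_{n,0}$,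 with $P^{(\nu)}_{n,i}\in M_{2\ell+1}(\mathbb{C})$, are the unique monic matrix-valued polynomials satisfying $\int_{-1}^1P^{(\nu)}_n(x)W^{(\nu)}(x)\bigl(P^{(\nu)}_m(x)\bigr)^\ast dx=\delta_{n,m}H^{(\nu)}_n$, where $H^{(\nu)}_n$ is a strictly positive definite matrix. *)

(* Defs.v *)
From HB Require Import structures.
From mathcomp Require Import all_boot all_order all_algebra.
From mathcomp Require Import sesquilinear spectral complex.
From mathcomp Require Import all_classical all_reals all_analysis.
Set Implicit Arguments.
Unset Strict Implicit.
Unset Printing Implicit Defensive.
Import Order.TTheory GRing.Theory Num.Theory.
Import numFieldNormedType.Exports.
Local Open Scope classical_set_scope.
Local Open Scope complex_scope.
Local Open Scope sesquilinear_scope.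
Local Open Scope ring_scope.

(* Throughout, the half-integer ell is represented by the natural number
   N = 2 ell, and square matrices of size 2 ell + 1 are indexed by 'I_N.+1. *)

(* (a)_n = a (a + 1) ... (a + n - 1) *)
Definition poch {R : pzRingType} (a : R) (n : nat) : R :=
  \prod_(i < n) (a + i%:R).

(* 2F1(a, b; c; z), as the sum of its power series *)
Definition hyp2F1 {R : realType} (a b c z : R) : R :=
  limn (series (fun k : nat =>
    poch a k * poch b k / (poch c k * k`!%:R) * z ^+ k)).

Definition gegenbauer {R : realType} (nu : R) (n : nat) (x : R) : R :=
  poch (2 * nu) n / n`!%:R *
  hyp2F1 (- n%:R) (n%:R + 2 * nu) (nu + 2^-1) (2^-1 * (1 - x)).

(* Euler's integral, for 0 < z *)
Definition Gamma {R : realType} (z : R) : R :=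
  \int[@lebesgue_measure R]_(t in `]0, +oo[) (t `^ (z - 1) * expR (- t)).

(* Meant for (n + m) - N <= t <= m <= n <= N, so that every subtraction of
   natural numbers below is exact. *)
Definition alpha {R : realType} (N : nat) (nu : R) (t m n : nat) : R :=
  (-1) ^+ m *
  ((n`! * m`! * (m + n - 2 * t)`!)%N%:R /
   (t`!%:R * poch (2 * nu) (m + n - 2 * t) * poch nu (n + m - t))) *
  (poch nu (n - t) * poch nu (m - t) / ((n - t)`! * (m - t)`!)%N%:R) *
  (((n + m - 2 * t)%N%:R + nu) / ((n + m - t)%N%:R + nu)) *
  (N - m)`!%:R * poch (n%:R - N%:R) (m - t) * poch (- N%:R - nu) t *
  ((N%:R + nu) / N`!%:R).

(* The entry (m, n) of the weight, for m <= n <= N; the lower summation bound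
   is max(0, n + m - N) by truncation. *)
Definition weight_entry {R : realType} (N : nat) (nu : R) (m n : nat) (x : R)
    : R :=
  (1 - x ^+ 2) `^ (nu - 2^-1) *
  \sum_((n + m - N)%N <= t < m.+1)
     alpha N nu t m n * gegenbauer nu (m + n - 2 * t) x.

Definition weight {R : realType} (N : nat) (nu : R) (x : R) : 'M[R]_N.+1 :=
  \matrix_(i, j) (if (i <= j)%N then weight_entry N nu i j x
                  else weight_entry N nu j i x).

Definition cmx {R : realType} {m n : nat} (A : 'M[R]_(m, n)) : 'M[R[i]]_(m, n) :=
  map_mx (real_complex R) A.

Definition mxderiv {R : realType} {p q : nat} (n : nat) (F : R -> 'M[R]_(p, q))
    (x : R) : 'M[R]_(p, q) :=
  \matrix_(i, j) derive1n n (fun y => F y i j) x.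

Definition mxintegral {R : realType} {p q : nat} (F : R -> 'M[R[i]]_(p, q))
    : 'M[R[i]]_(p, q) :=
  \matrix_(i, j)
    ((\int[@lebesgue_measure R]_(x in `](-1), 1[) complex.Re (F x i j)) +i*
     (\int[@lebesgue_measure R]_(x in `](-1), 1[) complex.Im (F x i j))).

Definition posdefmx {C : numClosedFieldType} {n : nat} (A : 'M[C]_n) : Prop :=
  A \is hermsymmx /\
  forall v : 'rV[C]_n, v != 0 -> 0 < (v *m A *m v ^t* ) 0 0.

Definition mxeval {R : realType} {N : nat} (p : {poly 'M[R[i]]_N.+1}) (x : R)
    : 'M[R[i]]_N.+1 :=
  p.[(x%:C)%:M].

(* P is the sequence of monic matrix-valued orthogonal polynomials for the
   weight W on (-1, 1), with squared norms H. *)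
Definition monic_mvop {R : realType} {N : nat} (W : R -> 'M[R]_N.+1)
    (P : nat -> {poly 'M[R[i]]_N.+1}) (H : nat -> 'M[R[i]]_N.+1) : Prop :=
  [/\ forall n, size (P n) = n.+1 /\ P n \is monic,
      forall n, posdefmx (H n) &
      forall n m,
        mxintegral (fun x => mxeval (P n) x *m cmx (W x) *m (mxeval (P m) x) ^t* )
        = if n == m then H n else 0].

Definition sqnorm_entry {R : realType} (N : nat) (nu : R) (n k : nat) : R :=
  let ell : R := N%:R / 2 in
  Num.sqrt pi * (Gamma (nu + 2^-1) / Gamma (nu + 1)) *
  (nu * (N%:R + nu + n%:R) / (nu + n%:R)) *
  (n`!%:R * poch (ell + 2^-1 + nu) n * poch (N%:R + nu) n * poch (ell + nu) n /
   (poch (N%:R + nu + 1) n * poch (nu + k%:R) n *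
    poch (N%:R + 2 * nu + n%:R) n * poch (N%:R + nu - k%:R) n)) *
  (k`!%:R * (N - k)`!%:R * poch (n%:R + nu + 1) N /
   (N`!%:R * poch (n%:R + nu + 1) k * poch (n%:R + nu + 1) (N - k))).

Definition rodrigues_entry {R : realType} (N : nat) (nu : R) (n k : nat) : R :=
  let ell : R := N%:R / 2 in
  (-1) ^+ n * poch nu n * poch (ell + nu + 2^-1) n * poch (ell + nu) n *
    poch (N%:R + nu) n /
  (poch (nu + 2^-1) n * poch (nu + k%:R) n * poch (N%:R + nu + 1) n *
    poch (N%:R + 2 * nu + n%:R) n * poch (N%:R + nu - k%:R) n).

(* Main.v *)
Require Import Defs.
From HB Require Import structures.
From mathcomp Require Import all_boot all_order all_algebra.
From mathcomp Require Import sesquilinear spectral complex.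
From mathcomp Require Import all_classical all_reals all_analysis.
From mathcomp Require Import measurable_realfun ring lra zify.
Set Implicit Arguments.
Unset Strict Implicit.
Unset Printing Implicit Defensive.
Import Order.TTheory GRing.Theory Num.Theory.
Import numFieldNormedType.Exports.
Local Open Scope classical_set_scope.
Local Open Scope complex_scope.
Local Open Scope sesquilinear_scope.
Local Open Scope ring_scope.

(* The weight is (1 - x^2)^(nu - 1/2) times a matrix of polynomials whose entries
   satisfy first-order recurrences in x and in the matrix indices. These yield
   the Pearson relations W^(nu+1) = F W^(nu) and (W^(nu+1))' = G W^(nu) with matrix
   polynomials F and G of degrees 2 and 1. Integrating by parts, (P_(n+1)^(nu))' is
   orthogonal with respect to W^(nu+1) to all polynomials of degree < n, hence
   equals (n + 1) P_n^(nu+1); and (P_n^(nu+1))' F + P_n^(nu+1) G is orthogonal with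
   respect to W^(nu) to all polynomials of degree <= n, hence equals K P_(n+1)^(nu)
   for its leading coefficient K, which is diagonal. Reading this as
   (P_n^(nu+1) W^(nu+1))' = K P_(n+1)^(nu) W^(nu) and iterating gives the Rodrigues
   formula; comparing the two pairings gives (n + 1) H_n^(nu+1) = - H_(n+1)^(nu) K,
   so all squared norms follow from the zeroth moment.

   The weight is invertible because a unipotent conjugation decouples its
   differential system, so that det W(x) is a positive multiple of the determinant
   at 0. If that vanished, the determinant would vanish identically and a nonzero
   polynomial row in the left kernel would be orthogonal to every polynomial. *)

(** The coefficients of P do not commute with the weight, and the weight may blow up at the
    endpoints. Both obstacles are confined: orthogonality is an algebraic statement about a sequence
    of self-adjoint moments in a ring with involution, and analysis contributes only two relations
    between the moments for nu and for nu + 1. Behind these stand a truncated fundamental theorem of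
    calculus and one finiteness statement, which is extracted from the positive definiteness of the
    zeroth squared norm, because a divergent integral takes the value 0. The relation W^(nu+1) = F
    W^(nu) is not verified coefficient by coefficient in the Gegenbauer expansion. Both sides
    satisfy the same first-order system, and a polynomial solution h of (1 - x^2) h' + s x h = 0
    vanishes as soon as its coefficient of x^s does. Induction on the sum of the indices thus leaves
    a comparison of leading coefficients. The inductions on n trade (nu, n + 1) for (nu + 1, n);
    hence all parameters are treated at once, and the Gamma quotient only has to be compared between
    nu and nu + 1. *)

Lemma poch0 (R : pzRingType) (a : R) : poch a 0 = 1.
Proof. by rewrite /poch big_ord0. Qed.

Lemma pochSr (R : pzRingType) (a : R) n : poch a n.+1 = poch a n * (a + n%:R).
Proof. by rewrite /poch big_ord_recr. Qed.

Lemma pochSl (R : pzRingType) (a : R) n : poch a n.+1 = a * poch (a + 1) n.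
Proof.
rewrite /poch big_ord_recl addr0; congr (_ * _); apply: eq_bigr => i _.
by rewrite /= /bump add1n -addrA -natr1 [_ + 1]addrC.
Qed.

Lemma poch_gt0 (R : realFieldType) (a : R) n : 0 < a -> 0 < poch a n.
Proof.
by move=> a0; apply: prodr_gt0 => i _; rewrite ltr_wpDr// ler0n.
Qed.

Lemma poch_neq0 (R : realFieldType) (a : R) n : 0 < a -> poch a n != 0.
Proof. by move=> a0; rewrite gt_eqF// poch_gt0. Qed.

Lemma pochD (R : pzRingType) (a : R) m n :
  poch a (m + n) = poch a m * poch (a + m%:R) n.
Proof.
elim: n => [|n IH]; first by rewrite addn0 poch0 mulr1.
by rewrite addnS !pochSr IH natrD -mulrA addrA.
Qed.

Lemma pochN (R : comPzRingType) n k : 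
  poch (- n%:R : R) k = (-1) ^+ k * (n ^_ k)%:R.
Proof.
elim: k => [|k IH]; first by rewrite poch0 ffactn0 mulr1.
rewrite pochSr IH ffactnSr exprS.
have [kn|nk] := leqP k n; first by rewrite natrM natrB//; ring.
by rewrite ffact_small// mul0n mulr0 !mul0r mulr0.
Qed.

Lemma natr_neq0 (R : numDomainType) n : n.+1%:R != 0 :> R.
Proof. by rewrite pnatr_eq0. Qed.

Lemma fact_neq0 (R : numDomainType) n : n`!%:R != 0 :> R.
Proof. by rewrite pnatr_eq0 -lt0n fact_gt0. Qed.

Ltac nonzero := rewrite ?fact_neq0 ?natr_neq0 /=;
  repeat match goal with |- is_true (_ && _) => apply/andP; split end;
  first [done | assumption | apply: lt0r_neq0; lra | idtac].

(** * Gegenbauer polynomials *)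

Section Gegenbauer.
Variable R : realFieldType.
Implicit Types (nu : R) (n k : nat).

Definition geg_coef nu n k : R :=
  (-1) ^+ k * poch (2 * nu) (n + k) * (n ^_ k)%:R /
    (n`!%:R * poch (nu + 2^-1) k * k`!%:R).

(* Gegenbauer polynomials in the variable z = (1 - x) / 2. *)
Definition gegz nu n : {poly R} := \poly_(k < n.+1) geg_coef nu n k.

Definition gegp nu n : {poly R} := gegz nu n \Po (2^-1 *: (1 - 'X)).

Lemma coef_gegz nu n k : (gegz nu n)`_k = geg_coef nu n k.
Proof.
rewrite coef_poly ltnS; case: leqP => // nk.
by rewrite /geg_coef ffact_small// mulr0 mul0r.
Qed.

(** The subtraction is taken in R, so no bound on k is needed: beyond n both sides are 0. *)
Lemma ffactB n k : (n ^_ k.+1)%:R = (n ^_ k)%:R * (n%:R - k%:R) :> R.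
Proof.
rewrite ffactnSr; have [kn|nk] := leqP k n; first by rewrite natrM natrB.
by rewrite ffact_small// mul0n mul0r.
Qed.

Lemma geg_coef0 nu n : geg_coef nu n 0 = poch (2 * nu) n / n`!%:R.
Proof. by rewrite /geg_coef addn0 ffactn0 fact0 poch0 mul1r !mulr1. Qed.

Lemma geg_coefS nu n k : 0 < nu ->
  geg_coef nu n k.+1 =
  - geg_coef nu n k * (2 * nu + n%:R + k%:R) * (n%:R - k%:R)
    / ((nu + 2^-1 + k%:R) * (k%:R + 1)).
Proof.
move=> nu0; rewrite /geg_coef addnS !pochSr ffactB factS exprS natrM -natr1 natrD.
have p0 : poch (nu + 2^-1) k != 0 by rewrite poch_neq0// addr_gt0// invr_gt0.
have k0 := ler0n R k.
field; nonzero.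
Qed.

(** Expressing degree n through degree n + 1 keeps the denominator positive; the opposite direction
    would divide by n + 1 - k. *)
Lemma geg_coefSn nu n k : 0 < nu ->
  geg_coef nu n k = geg_coef nu n.+1 k * (n%:R + 1 - k%:R) / (2 * nu + n%:R + k%:R).
Proof.
move=> nu0; rewrite /geg_coef addSn pochSr factS natrM.
have p0 : poch (nu + 2^-1) k != 0 by rewrite poch_neq0// addr_gt0// invr_gt0.
have n0 := ler0n R n; have k0 := ler0n R k.
have E : (n.+1 ^_ k)%:R * (n%:R + 1 - k%:R) = (n%:R + 1) * (n ^_ k)%:R :> R.
  by have := ffactB n.+1 k; rewrite ffactSS natrM -natr1 => <-.
transitivity ((-1) ^+ k * (poch (2 * nu) (n + k) * (2 * nu + (n + k)%:R)) *
   ((n.+1 ^_ k)%:R * (n%:R + 1 - k%:R)) /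
   (n.+1%:R * n`!%:R * poch (nu + 2^-1) k * k`!%:R) / (2 * nu + n%:R + k%:R)).
  rewrite E natrD; field; nonzero.
rewrite natrD; field; nonzero.
Qed.

Lemma coef_Xderiv (p : {poly R}) k : ('X * p^`())`_k = p`_k * k%:R.
Proof.
rewrite coefXM coef_deriv; case: k => [|k] /=; first by rewrite mulr0.
by rewrite mulr_natr.
Qed.

(* The lowering relation (1 - x^2) C_n' = (n + 2 nu - 1) C_(n-1) - n x C_n. *)
Lemma gegz_down nu n : 0 < nu ->
  - 2 *: (1 - 'X) * ('X * (gegz nu n.+1)^`()) =
  (n%:R + 2 * nu) *: gegz nu n - n.+1%:R *: ((1 - 2 *: 'X) * gegz nu n.+1).
Proof.
move=> nu0; apply/polyP => k.
rewrite -!(@scalerAl _ {poly R}) !mulrBl !mul1r -!(@scalerAl _ {poly R}).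
rewrite !(coefB, coefZ, coef_Xderiv, coefXM, coef_gegz).
have n0 := ler0n R n.
case: k => [|k] /=.
  rewrite [geg_coef nu n 0]geg_coefSn//; field; nonzero.
have k0 := ler0n R k.
rewrite [geg_coef nu n _]geg_coefSn// !geg_coefS//; field; nonzero.
Qed.

Lemma gegz_up nu n : 0 < nu ->
  - 2 *: (1 - 'X) * ('X * (gegz nu n)^`()) =
  (n%:R + 2 * nu) *: ((1 - 2 *: 'X) * gegz nu n) - n.+1%:R *: gegz nu n.+1.
Proof.
move=> nu0; apply/polyP => k.
rewrite -!(@scalerAl _ {poly R}) !mulrBl !mul1r -!(@scalerAl _ {poly R}).
rewrite !(coefB, coefZ, coef_Xderiv, coefXM, coef_gegz).
have n0 := ler0n R n.
case: k => [|k] /=.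
  rewrite [geg_coef nu n 0]geg_coefSn//; field; nonzero.
have k0 := ler0n R k.
rewrite [geg_coef nu n _]geg_coefSn// [geg_coef nu n _]geg_coefSn// !geg_coefS//.
by field; nonzero.
Qed.

Lemma geg_coef_nu nu n k : 0 < nu ->
  geg_coef (nu + 1) n k = geg_coef nu n.+1 k *
   (2 * nu + n%:R + 1 + k%:R) * (n%:R + 1 - k%:R) / (4 * nu * (nu + 2^-1 + k%:R)).
Proof.
move=> nu0; rewrite /geg_coef factS natrM.
have n0 := ler0n R n; have k0 := ler0n R k.
have E : (n.+1 ^_ k)%:R * (n%:R + 1 - k%:R) = (n%:R + 1) * (n ^_ k)%:R :> R.
  by have := ffactB n.+1 k; rewrite ffactSS natrM -natr1 => <-.
have p0 : poch (nu + 2^-1) k != 0 by rewrite poch_neq0// addr_gt0// invr_gt0.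
have p1 : poch (nu + 1 + 2^-1) k != 0.
  by rewrite poch_neq0// !addr_gt0// invr_gt0.
have E1 : poch (2 * nu) (n.+1 + k) * (2 * nu + n%:R + 1 + k%:R) =
   2 * nu * (2 * nu + 1) * poch (2 * (nu + 1)) (n + k).
  rewrite (_ : 2 * nu + n%:R + 1 + k%:R = 2 * nu + (n.+1 + k)%:R); last first.
    by rewrite natrD -natr1; ring.
  rewrite -pochSr addSn !pochSl; rewrite -mulrA; congr (_ * (_ * poch _ _)); ring.
have E2 : poch (nu + 2^-1) k * (nu + 2^-1 + k%:R) =
   (nu + 2^-1) * poch (nu + 1 + 2^-1) k.
  by rewrite -pochSr pochSl; congr (_ * poch _ _); ring.
transitivity ((-1) ^+ k * (2 * nu * (2 * nu + 1) * poch (2 * (nu + 1)) (n + k)) *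
   ((n%:R + 1) * (n ^_ k)%:R) /
   (n.+1%:R * n`!%:R * k`!%:R * (4 * nu) * ((nu + 2^-1) * poch (nu + 1 + 2^-1) k))).
  field; nonzero.
rewrite -E1 -E2 -E; field; nonzero.
Qed.

(** In the variable x this computes the derivative of (1 - x^2)^(nu + 1/2) C_n^(nu+1), up to the
    factor (1 - x^2)^(nu - 1/2), as a multiple of C_(n+1)^(nu). *)
Lemma gegz_raise nu n : 0 < nu ->
  - 2 *: (1 - 'X) * ('X * (gegz (nu + 1) n)^`())
    - (2 * nu + 1) *: ((1 - 2 *: 'X) * gegz (nu + 1) n) =
  - ((n%:R + 1) * (n%:R + 2 * nu + 1) / (2 * nu)) *: gegz nu n.+1.
Proof.
move=> nu0; apply/polyP => k.
rewrite -!(@scalerAl _ {poly R}) !mulrBl !mul1r -!(@scalerAl _ {poly R}).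
rewrite !(coefB, coefZ, coef_Xderiv, coefXM, coef_gegz).
have n0 := ler0n R n.
case: k => [|k] /=.
  by rewrite geg_coef_nu//; field; nonzero.
have k0 := ler0n R k.
by rewrite !geg_coef_nu// !geg_coefS//; field; nonzero.
Qed.

Let Z : {poly R} := 2^-1 *: (1 - 'X).

(** With z = (1 - x) / 2 one has 4 z (1 - z) = 1 - x^2 and dz/dx = -1/2, so (1 - x^2) d/dx becomes
    -2 (1 - z) z d/dz. *)
Let compZ nu n : - 2 *: (1 - Z) * (Z * ((gegz nu n)^`() \Po Z)) =
  (1 - 'X ^+ 2) * (gegp nu n)^`().
Proof.
rewrite /gegp deriv_comp -/Z.
have -> : Z^`() = (- 2^-1)%:P.
  by rewrite derivZ derivB derivX -polyC1 derivC sub0r scalerN -mul_polyC -polyCM mulr1 polyCN.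
rewrite /Z -!mul_polyC polyCN.
have e : (2 : R)%:P * (2^-1)%:P = 1 by rewrite -polyCM mulfV.
set h := (2^-1)%:P in e *; set t := 2%:P in e *; set g := (_^`() \Po _).
have -> : 1 - h * (1 - 'X) = h * (1 + 'X) by rewrite -[X in X - _]e [t * h]mulrC /t polyC_natr; ring.
have -> : - t * (h * (1 + 'X)) = - (1 + 'X) by rewrite mulNr mulrA e mul1r.
by rewrite polyCN -/h; ring.
Qed.

Let compX p : ((1 - 2 *: 'X) * p) \Po Z = 'X * (p \Po Z).
Proof.
rewrite comp_polyM comp_polyB comp_polyZ comp_polyX -polyC1 comp_polyC /Z.
by rewrite scalerA mulfV// scale1r polyC1 opprB addrC subrK.
Qed.

Let compD nu n : (- 2 *: (1 - 'X) * ('X * (gegz nu n)^`())) \Po Z =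
  (1 - 'X ^+ 2) * (gegp nu n)^`().
Proof.
rewrite -compZ !comp_polyM comp_polyZ comp_polyB comp_polyX.
by rewrite -polyC1 comp_polyC.
Qed.

Lemma gegp_down nu n : 0 < nu ->
  (1 - 'X ^+ 2) * (gegp nu n.+1)^`() =
  (n%:R + 2 * nu) *: gegp nu n - n.+1%:R *: ('X * gegp nu n.+1).
Proof.
by move=> nu0; rewrite -compD gegz_down// comp_polyB !comp_polyZ compX.
Qed.

Lemma gegp_up nu n : 0 < nu ->
  (1 - 'X ^+ 2) * (gegp nu n)^`() =
  (n%:R + 2 * nu) *: ('X * gegp nu n) - n.+1%:R *: gegp nu n.+1.
Proof.
by move=> nu0; rewrite -compD gegz_up// comp_polyB !comp_polyZ compX.
Qed.

Lemma gegp_raise nu n : 0 < nu ->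
  (1 - 'X ^+ 2) * (gegp (nu + 1) n)^`() - (2 * nu + 1) *: ('X * gegp (nu + 1) n) =
  - ((n%:R + 1) * (n%:R + 2 * nu + 1) / (2 * nu)) *: gegp nu n.+1.
Proof.
move=> nu0; rewrite -compD -compX -comp_polyZ -comp_polyB gegz_raise//.
by rewrite comp_polyZ.
Qed.

Definition gegpred nu n : {poly R} := if n is m.+1 then gegp nu m else 0.

Lemma gegp0 nu : gegp nu 0 = 1.
Proof.
rewrite /gegp; have -> : gegz nu 0 = 1%:P.
  apply/polyP => k; rewrite coef_gegz coefC; case: k => [|k] /=.
    by rewrite geg_coef0 poch0 fact0 divr1.
  by rewrite /geg_coef ffact_small// mulr0 mul0r.
by rewrite comp_polyC.
Qed.

(** The three-term recurrence, obtained by equating the raising and the lowering expression of (1 -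
    x^2) C_n'. *)
Lemma gegp_mulX nu n : 0 < nu ->
  'X * gegp nu n = ((n%:R + 1) / (2 * (n%:R + nu))) *: gegp nu n.+1 +
    ((n%:R + 2 * nu - 1) / (2 * (n%:R + nu))) *: gegpred nu n.
Proof.
move=> nu0; have n0 := ler0n R n; have := gegp_up n nu0.
have : (1 - 'X ^+ 2) * (gegp nu n)^`() =
  (n%:R + 2 * nu - 1) *: gegpred nu n - n%:R *: ('X * gegp nu n).
  case: n n0 => [|n] n0 /=.
    by rewrite gegp0 -polyC1 derivC mulr0 scaler0 scale0r subrr.
  by rewrite gegp_down//; congr (_ *: _ - _); rewrite -natr1; ring.
move=> -> /polyP E; apply/polyP => i; move/(_ i): E.
rewrite !(coefB, coefD, coefZ).
set a := _`_i; set b := _`_i; set c := _`_i => E.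
have -> : c = ((n%:R + 2 * nu) * b + n%:R * b - (n%:R + 2 * nu - 1) * a) / (n%:R + 1).
  have : n.+1%:R * c = (n%:R + 2 * nu) * b + n%:R * b - (n%:R + 2 * nu - 1) * a.
    by have /eqP := E; rewrite eq_sym subr_eq => /eqP ->; ring.
  by move=> <-; field; nonzero.
by field; nonzero.
Qed.

(** The operator (1 - x^2) d/dx + s x moves the degree up and down by one, and for s = n the upward
    part disappears. *)
Lemma gegp_euler nu n s : 0 < nu ->
  (1 - 'X ^+ 2) * (gegp nu n)^`() + s *: ('X * gegp nu n) =
  ((n%:R + 1) * (s - n%:R) / (2 * (n%:R + nu))) *: gegp nu n.+1 +
  ((n%:R + 2 * nu - 1) * (n%:R + 2 * nu + s) / (2 * (n%:R + nu))) *: gegpred nu n.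
Proof.
move=> nu0; have n0 := ler0n R n; rewrite gegp_up// gegp_mulX//.
by apply/polyP => i; rewrite !(coefB, coefD, coefZ); field; nonzero.
Qed.

Lemma size_gegp nu n : (size (gegp nu n) <= n.+1)%N.
Proof.
apply: leq_trans (size_comp_poly_leq _ _) _; rewrite ltnS.
have sz : (size Z <= 2)%N.
  apply: leq_trans (size_scale_leq _ _) _.
  by apply: leq_trans (size_polyD _ _) _; rewrite size_polyN size_polyX size_poly1.
have sg : (size (gegz nu n) <= n.+1)%N by apply: size_poly.
rewrite -[leqRHS]muln1; apply: leq_mul; first by case: size sg.
by case: size sz.
Qed.

Lemma gegp_lead nu n : 0 < nu -> (gegp nu n)`_n = 2 ^+ n * poch nu n / n`!%:R.
Proof.
move=> nu0; elim: n => [|n IH].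
  by rewrite gegp0 coef1 expr0 poch0 fact0 divr1 mulr1.
have n0 := ler0n R n.
have /(congr1 (fun p : {poly R} => p`_n.+1)) := gegp_up n nu0.
rewrite mulrBl mul1r.
have -> : 'X ^+ 2 * (gegp nu n)^`() = 'X * ('X * (gegp nu n)^`()).
  by rewrite mulrA -expr2.
rewrite !(coefB, coefZ) coef_deriv [('X * ('X * _))`_ _]coefXM coef_Xderiv.
rewrite [('X * gegp _ _)`_ _]coefXM /=.
rewrite [_`_n.+2]nth_default ?mul0rn ?IH; last exact: leqW (size_gegp nu n).
move=> E.
have E2 : n.+1%:R * (gegp nu n.+1)`_n.+1 =
   (2 * n%:R + 2 * nu) * (2 ^+ n * poch nu n / n`!%:R).
  move: E; set d := n.+1%:R * _; set c := 2 ^+ n * _ / _ => E.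
  have -> : d = (n%:R + 2 * nu) * c - (0 - c * n%:R) by rewrite E; ring.
  by ring.
apply: (mulfI (natr_neq0 R n)).
by rewrite E2 exprS pochSr factS natrM; field; nonzero.
Qed.

End Gegenbauer.

(** * The polynomial part of the weight *)

Lemma natrS_neq0 (R : numDomainType) n : n%:R + 1 != 0 :> R.
Proof. by rewrite natr1 natr_neq0. Qed.

Lemma addrn_neq0 (R : realFieldType) (a : R) n : 0 < a -> a + n%:R != 0.
Proof. by move=> a0; rewrite gt_eqF// ltr_wpDr. Qed.

Ltac prep R nu0 i j t :=
  have pi := poch_neq0 i nu0; have pj := poch_neq0 j nu0;
  have pij := poch_neq0 (i + j) (mulr_gt0 (ltr0n R 2) nu0);
  have pijt := poch_neq0 (i + j + t) nu0;
  have i0 := ler0n R i; have j0 := ler0n R j; have t0 := ler0n R t.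

(** Falling factorial: it replaces [poch (- a) t] up to sign, which keeps [alphaD] free of signs. *)
Definition lfact (R : pzRingType) (a : R) (t : nat) : R := \prod_(i < t) (a - i%:R).

(* Generalizing the factors keeps the terms seen by field monomial. *)
Ltac core_field R N nu0 i j t :=
  move: (poch_neq0 (i + j) (mulr_gt0 (ltr0n _ 2) nu0)) (poch_neq0 (i + j + t) nu0)
    (fact_neq0 R N) (fact_neq0 R i) (fact_neq0 R j) (fact_neq0 R t);
  move: (poch _ (i + j)) (poch _ (i + j + t)) (poch _ i) (poch _ j) (lfact _ t);
  move: (N`!%:R) (i`!%:R) (j`!%:R) (t`!%:R);
  move: ((i + j)`!%:R) ((i + t)`!%:R) ((j + t)`!%:R);
  move: ((N - (i + t).+1)`!%:R) (((N - (j + t).+1) ^_ i)%:R) (N%:R + _);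
  move=> *; field; repeat (apply/andP; split); assumption.

(** * Identities between the expansion coefficients of the weight *)

Section Coefficients.
Variables (R : realFieldType) (N : nat).
Implicit Types (nu : R) (t i j m n : nat).

Lemma lfact0 (a : R) : lfact a 0 = 1. Proof. by rewrite /lfact big_ord0. Qed.

Lemma lfactSr (a : R) t : lfact a t.+1 = lfact a t * (a - t%:R).
Proof. by rewrite /lfact big_ord_recr. Qed.

Lemma lfactSl (a : R) t : lfact (a + 1) t.+1 = (a + 1) * lfact a t.
Proof.
rewrite /lfact big_ord_recl subr0; congr (_ * _); apply: eq_bigr => i _.
by rewrite /= /bump add1n -natr1; ring.
Qed.

Lemma factSr n : (n.+1)`!%:R = (n%:R + 1) * n`!%:R :> R.
Proof. by rewrite factS natrM natr1. Qed.

Lemma ffactSSr m n : (m.+1 ^_ n.+1)%:R = (m%:R + 1) * (m ^_ n)%:R :> R.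
Proof. by rewrite ffactSS natrM natr1. Qed.

(* alpha_t (i + t, j + t), in a form symmetric in i and j. *)
Definition alphaD nu t i j : R :=
  (i + t)`!%:R * (j + t)`!%:R / (i`!%:R * j`!%:R * t`!%:R) * poch nu i * poch nu j *
  ((i + j)`!%:R * ((i + j)%:R + nu) / (poch (2 * nu) (i + j) * poch nu (i + j + t).+1)) *
  (N - (i + t))`!%:R * ((N - (j + t)) ^_ i)%:R * lfact (N%:R + nu) t *
  ((N%:R + nu) / N`!%:R).

Lemma poch_shift nu i : 0 < nu -> poch (nu + 1) i = poch nu i * (nu + i%:R) / nu.
Proof. by move=> nu0; rewrite -pochSr pochSl; field; nonzero. Qed.

(** At m = N the number [N - m.+1] truncates and the factorial identity alone fails; the falling
    factorial, zero in that case, is carried along to save it. *)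
Lemma factB_shift m b k : (m <= N)%N -> (N <= m -> b < k)%N ->
  (N%:R - m%:R) * ((N - m.+1)`!%:R * (b ^_ k)%:R) =
  (N - m)`!%:R * (b ^_ k)%:R :> R.
Proof.
move=> mN bk; have [mN'|Nm] := ltnP m N.
  have e : (N - m = (N - m.+1).+1)%N by lia.
  by rewrite mulrA -natrB ?(ltnW mN')// e factSr natr1.
by rewrite (ffact_small (bk Nm)) !mulr0.
Qed.

(* The common factor of all the coefficients that are adjacent to alphaD nu t i j. *)
Definition alpha_core nu t i j : R :=
  (i + t)`!%:R * (j + t)`!%:R / (i`!%:R * j`!%:R * t`!%:R) * poch nu i * poch nu j *
  ((i + j)`!%:R / (poch (2 * nu) (i + j) * poch nu (i + j + t))) *
  (N - (i + t).+1)`!%:R * ((N - (j + t).+1) ^_ i)%:R * lfact (N%:R + nu) t *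
  ((N%:R + nu) / N`!%:R).

Lemma alphaD_succ_t nu t i j : 0 < nu ->
  alphaD nu t.+1 i j = alpha_core nu t i j *
    (((i + t)%:R + 1) * ((j + t)%:R + 1) * ((i + j)%:R + nu) * (N%:R + nu - t%:R) /
     ((t%:R + 1) * (nu + (i + j + t)%:R) * (nu + (i + j + t).+1%:R))).
Proof.
move=> nu0; rewrite /alphaD /alpha_core !(addSn, addnS) !factSr !pochSr !lfactSr.
move: (addrn_neq0 (i + j + t) nu0) (addrn_neq0 (i + j + t).+1 nu0) (natrS_neq0 R t).
move: (nu + (i + j + t)%:R) (nu + (i + j + t).+1%:R) (t%:R + 1).
move: ((i + j)%:R + nu) (N%:R + nu - t%:R) ((i + t)%:R + 1) ((j + t)%:R + 1).
core_field R N nu0 i j t.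
Qed.

Lemma alphaD_succ_ij nu t i j : 0 < nu ->
  alphaD nu t i.+1 j.+1 = alpha_core nu t i j *
    (((i + t)%:R + 1) * ((j + t)%:R + 1) * (nu + i%:R) * (nu + j%:R) *
     ((i + j)%:R + 1) * ((i + j).+1%:R + 1) * ((i + j).+2%:R + nu) *
     ((N - (j + t).+1)%:R - i%:R) /
     ((i%:R + 1) * (j%:R + 1) * (2 * nu + (i + j)%:R) * (2 * nu + (i + j).+1%:R) *
      (nu + (i + j + t)%:R) * (nu + (i + j + t).+1%:R) * (nu + (i + j + t).+2%:R))).
Proof.
move=> nu0; rewrite /alphaD /alpha_core !(addSn, addnS) !factSr !pochSr ffactB.
have nu2 := mulr_gt0 (ltr0n R 2) nu0.
move: (addrn_neq0 (i + j) nu2) (addrn_neq0 (i + j).+1 nu2).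
move: (2 * nu + (i + j)%:R) (2 * nu + (i + j).+1%:R).
move: (addrn_neq0 (i + j + t) nu0) (addrn_neq0 (i + j + t).+1 nu0) (addrn_neq0 (i + j + t).+2 nu0).
move: (nu + (i + j + t)%:R) (nu + (i + j + t).+1%:R) (nu + (i + j + t).+2%:R).
move: (natrS_neq0 R i) (natrS_neq0 R j); move: (i%:R + 1) (j%:R + 1).
move: ((i + j).+2%:R + nu) ((N - (j + t).+1)%:R - i%:R) ((i + t)%:R + 1) ((j + t)%:R + 1).
move: (nu + i%:R) (nu + j%:R) ((i + j)%:R + 1) ((i + j).+1%:R + 1).
core_field R N nu0 i j t.
Qed.

Lemma alphaD_succ_j nu t i j : 0 < nu -> (i + t < N)%N ->
  alphaD nu t i j.+1 = alpha_core nu t i j *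
    (((j + t)%:R + 1) * (nu + j%:R) * ((i + j)%:R + 1) * ((i + j).+1%:R + nu) *
     ((N - (i + t).+1)%:R + 1) /
     ((j%:R + 1) * (2 * nu + (i + j)%:R) *
      (nu + (i + j + t)%:R) * (nu + (i + j + t).+1%:R))).
Proof.
move=> nu0 iN; rewrite /alphaD /alpha_core !(addSn, addnS) -(subnSK iN) !factSr !pochSr.
have nu2 := mulr_gt0 (ltr0n R 2) nu0.
move: (addrn_neq0 (i + j) nu2); move: (2 * nu + (i + j)%:R).
move: (addrn_neq0 (i + j + t) nu0) (addrn_neq0 (i + j + t).+1 nu0).
move: (nu + (i + j + t)%:R) (nu + (i + j + t).+1%:R).
move: (natrS_neq0 R j); move: (j%:R + 1).
move: ((i + j).+1%:R + nu) ((N - (i + t).+1)%:R + 1) ((j + t)%:R + 1).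
move: (nu + j%:R) ((i + j)%:R + 1).
core_field R N nu0 i j t.
Qed.

Lemma alphaD_succ_i nu t i j : 0 < nu -> (j + t < N)%N ->
  alphaD nu t i.+1 j = alpha_core nu t i j *
    (((i + t)%:R + 1) * (nu + i%:R) * ((i + j)%:R + 1) * ((i + j).+1%:R + nu) *
     ((N - (j + t).+1)%:R + 1) /
     ((i%:R + 1) * (2 * nu + (i + j)%:R) *
      (nu + (i + j + t)%:R) * (nu + (i + j + t).+1%:R))).
Proof.
move=> nu0 jN; rewrite /alphaD /alpha_core !(addSn, addnS) -(subnSK jN) ffactSSr !factSr !pochSr.
have nu2 := mulr_gt0 (ltr0n R 2) nu0.
move: (addrn_neq0 (i + j) nu2); move: (2 * nu + (i + j)%:R).
move: (addrn_neq0 (i + j + t) nu0) (addrn_neq0 (i + j + t).+1 nu0).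
move: (nu + (i + j + t)%:R) (nu + (i + j + t).+1%:R).
move: (natrS_neq0 R i); move: (i%:R + 1).
move: ((i + j).+1%:R + nu) ((N - (j + t).+1)%:R + 1) ((i + t)%:R + 1).
move: (nu + i%:R) ((i + j)%:R + 1).
core_field R N nu0 i j t.
Qed.

(** Coefficient of [gegp nu (i + j).+1] in [wpol_euler] for the entry (i + 1 + t, j + 1 + t):
    summand t + 1 contributes by raising the degree, summand t by lowering it. *)
Lemma alphaD_euler nu t i j : 0 < nu -> (i + t < N)%N -> (j + t < N)%N ->
  alphaD nu t.+1 i j * ((t%:R + 1) * ((i + j)%:R + 1) / ((i + j)%:R + nu)) +
  alphaD nu t i.+1 j.+1 *
    (((i + j)%:R + 1 + 2 * nu) * ((i + j)%:R + 2 + t%:R + nu) / ((i + j)%:R + 2 + nu)) =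
  (i%:R + 1 + t%:R) * alphaD nu t i j.+1 + (j%:R + 1 + t%:R) * alphaD nu t i.+1 j.
Proof.
move=> nu0 iN jN.
rewrite alphaD_succ_t// alphaD_succ_ij// alphaD_succ_j// alphaD_succ_i//.
rewrite (_ : i%:R + 1 + t%:R = (i + t)%:R + 1); last by rewrite natrD addrAC.
rewrite (_ : j%:R + 1 + t%:R = (j + t)%:R + 1); last by rewrite natrD addrAC.
rewrite (_ : (i + j)%:R + 1 + 2 * nu = 2 * nu + (i + j).+1%:R); last by rewrite -natr1; ring.
rewrite (_ : (i + j)%:R + 2 + t%:R + nu = nu + (i + j + t).+2%:R); last first.
  by rewrite -addn2 !natrD; ring.
rewrite (_ : (i + j)%:R + 2 + nu = (i + j).+2%:R + nu); last by rewrite -!natr1; ring.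
(* What remains once [alpha_core] and the common denominators are removed. The natural subtractions
   are exact because i + t < N and j + t < N. *)
have key : (N%:R + nu - t%:R) * (2 * nu + (i + j)%:R) * (i%:R + 1) * (j%:R + 1) +
    (nu + i%:R) * (nu + j%:R) * ((i + j).+1%:R + 1) * ((N - (j + t).+1)%:R - i%:R) =
  (nu + j%:R) * ((i + j).+1%:R + nu) * ((N - (i + t).+1)%:R + 1) * (i%:R + 1) +
    (nu + i%:R) * ((i + j).+1%:R + nu) * ((N - (j + t).+1)%:R + 1) * (j%:R + 1) :> R.
  by rewrite !natrB// -!natr1 !natrD; ring.
move: key; have nu2 := mulr_gt0 (ltr0n R 2) nu0.
have ij2 : (i + j).+2%:R + nu != 0 by rewrite addrC addrn_neq0.
have ij0 : (i + j)%:R + nu != 0 by rewrite addrC addrn_neq0.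
move: ij2 ij0; move: ((i + j).+2%:R + nu) ((i + j)%:R + nu).
move: (addrn_neq0 (i + j) nu2) (addrn_neq0 (i + j).+1 nu2).
move: (2 * nu + (i + j)%:R) (2 * nu + (i + j).+1%:R).
move: (addrn_neq0 (i + j + t) nu0) (addrn_neq0 (i + j + t).+1 nu0) (addrn_neq0 (i + j + t).+2 nu0).
move: (nu + (i + j + t)%:R) (nu + (i + j + t).+1%:R) (nu + (i + j + t).+2%:R).
move: (natrS_neq0 R i) (natrS_neq0 R j) (natrS_neq0 R t).
move: (i%:R + 1) (j%:R + 1) (t%:R + 1) => i1 j1 t1.
move: ((N - (j + t).+1)%:R - i%:R) ((N - (i + t).+1)%:R + 1) ((N - (j + t).+1)%:R + 1) => a b c.
move: ((i + t)%:R + 1) ((j + t)%:R + 1) (nu + i%:R) (nu + j%:R) => it jt ni nj.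
move: ((i + j)%:R + 1) ((i + j).+1%:R + 1) ((i + j).+1%:R + nu) (N%:R + nu - t%:R) => s1 s2 s1n Nt.
move: (alpha_core _ _ _ _) => core ? ? ? w0 w1 w2 ? ? ? n0 n1 ? ? s2n s0n ? ? key.
transitivity (core * it * jt * s1 / (i1 * j1 * n0 * w0 * w1) *
  (Nt * n0 * i1 * j1 + ni * nj * s2 * a)).
  by field; repeat (apply/andP; split); assumption.
by rewrite key; field; repeat (apply/andP; split); assumption.
Qed.

(** The boundary case m = t of [wpol_euler], where summand t + 1 is absent. *)
Lemma alphaD_euler0l nu t j : 0 < nu ->
  alphaD nu t 0 j.+1 *
    ((j%:R + 2 * nu) * (j%:R + 1 + t%:R + nu) / (j%:R + 1 + nu)) =
  (j%:R + 1 + t%:R) * alphaD nu t 0 j.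
Proof.
move=> nu0; prep R nu0 0%N j t; move: pij pijt.
rewrite /alphaD !(add0n, addSn, addnS) !ffactn0 => pij pijt.
rewrite !factSr !pochSr fact0.
set p2 := poch (2 * nu) _ in pij *.
rewrite -![_.+1%:R]natr1 !natrD.
have f := fact_neq0 R.
field; nonzero.
Qed.

Lemma alphaD_euler0r nu t i : 0 < nu -> (i + t < N)%N ->
  alphaD nu t i.+1 0 *
    ((i%:R + 2 * nu) * (i%:R + 1 + t%:R + nu) / (i%:R + 1 + nu)) =
  (i%:R + 1 + t%:R) * alphaD nu t i 0.
Proof.
move=> nu0 iN; prep R nu0 i 0%N t; move: pij pijt.
have [a Na] : exists a, N = (a + (i + t).+1)%N by exists (N - (i + t).+1)%N; lia.
have RNa : a%:R = N%:R - (i%:R + t%:R + 1) :> R by rewrite Na natrD -natr1 natrD; ring.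
rewrite /alphaD !(addn0, add0n, addSn, addnS) => pij pijt.
rewrite (_ : N - (i + t).+1 = a)%N; last lia.
rewrite (_ : N - (i + t) = a.+1)%N; last lia.
rewrite ffactB natrB; last lia.
rewrite !factSr !pochSr RNa fact0.
set p2 := poch (2 * nu) _ in pij *.
rewrite -![_.+1%:R]natr1 !natrD.
have f := fact_neq0 R.
field; nonzero.
Qed.

(** The constant is forced by the entry (0, 0) of [wpol_raise], whose two sides are multiples of
    x. *)
Definition raise_scale nu : R :=
  2 * (2 * nu + 1) * (N%:R + nu + 1) / (nu * (N%:R + nu) * (2 * (N%:R + 2 * nu))).

Lemma poch_shift2 nu k : 0 < nu ->
  poch (2 * (nu + 1)) k = poch (2 * nu) k * (2 * nu + k%:R) * (2 * nu + k%:R + 1) /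
    (2 * nu * (2 * nu + 1)).
Proof.
move=> nu0; have k0 := ler0n R k.
rewrite (_ : 2 * (nu + 1) = 2 * nu + 1 + 1); last by ring.
rewrite !poch_shift; try lra.
Qed.

(** Top coefficient, of [gegp nu (i + j).+1], in [wpol_raise] for the entry (i, j); row i - 1 has
    too small a degree to contribute. *)
Lemma alphaD_raise0 nu i j : 0 < nu -> (i <= N)%N -> (j <= N)%N ->
  - (((i + j)%:R + 1) * ((i + j)%:R + 2 * nu + 1) / (2 * nu)) * alphaD (nu + 1) 0 i j =
  raise_scale nu * (- 2 * (nu + i%:R) * (N%:R + nu - i%:R) *
      (alphaD nu 0 i j * (((i + j)%:R + 1) / (2 * ((i + j)%:R + nu)))) +
    (nu + i%:R) * ((N%:R - i%:R) * alphaD nu 0 i.+1 j)).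
Proof.
move=> nu0 iN jN; prep R nu0 i j 0%N.
have N0 := ler0n R N.
have E := @factB_shift i (N - j) i.+1 iN.
have {}E := E ltac:(lia).
have RNb : (N - j)%:R = N%:R - j%:R :> R by rewrite natrB.
rewrite [in RHS]mulrA /alphaD !(addn0, addSn, lfact0).
move: E; rewrite ffactB RNb.
set x := (N - i.+1)`!%:R; set y := (N - i)`!%:R; set z := (_ ^_ _)%:R.
move=> E.
transitivity (raise_scale nu * (- 2 * (nu + i%:R) * (N%:R + nu - i%:R) *
      (alphaD nu 0 i j * (((i + j)%:R + 1) / (2 * ((i + j)%:R + nu)))) + 
      (nu + i%:R) * (
   (i.+1`!%:R * j`!%:R / (i.+1`!%:R * j`!%:R * 1) * poch nu i.+1 * poch nu j *
  ((i + j).+1`!%:R * ((i + j).+1%:R + nu) / (poch (2 * nu) (i + j).+1 * poch nu (i + j).+2)) *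
  (y * (z * (N%:R - j%:R - i%:R))) *
  ((N%:R + nu) / N`!%:R))))); last first.
  by rewrite -E /alphaD !(addn0, addSn, lfact0) fact0 -/x -/y -/z; congr (_ * (_ + _)); ring.
rewrite /alphaD !(addn0, addSn, lfact0) -/y -/z fact0.
rewrite !poch_shift2// !poch_shift// !factSr !pochSr /raise_scale.
have p2 := poch_neq0 i nu0.
set p3 := poch (2 * nu) _ in pij *.
rewrite !natrD -![_.+1%:R]natr1.
have f := fact_neq0 R.
rewrite addn0 in pijt.
field; nonzero.
Qed.

End Coefficients.

Section RaisedCoefficients.
Variables (R : realFieldType) (N : nat).
Implicit Types (nu : R) (t i j m n : nat).
Local Notation alphaD := (alphaD N).
Local Notation raise_scale := (raise_scale N).

(** Row i + t + 2 is junk when it equals N + 1. The factor in front vanishes there, and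
    [factB_shift] absorbs the truncated factorial. *)
Lemma alphaD_succ_ti nu t i j : 0 < nu -> (i + t < N)%N ->
  (N%:R - (i + t).+1%:R) * alphaD nu t.+1 i.+1 j = alpha_core N nu t i j *
    (((i + t)%:R + 1) * ((i + t).+1%:R + 1) * ((j + t)%:R + 1) * (nu + i%:R) *
     ((i + j)%:R + 1) * ((i + j).+1%:R + nu) * ((N - (j + t).+1)%:R - i%:R) *
     (N%:R + nu - t%:R) /
     ((i%:R + 1) * (t%:R + 1) * (2 * nu + (i + j)%:R) *
      (nu + (i + j + t)%:R) * (nu + (i + j + t).+1%:R) * (nu + (i + j + t).+2%:R))).
Proof.
move=> nu0 iN; have pull (a b c d e f : R) : a * (b * c * d * e * f) = b * (a * (c * d)) * e * f.
  by ring.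
rewrite /alphaD !(addSn, addnS) [LHS]pull factB_shift//; last by lia.
rewrite /alpha_core ffactB !factSr !pochSr !lfactSr.
have nu2 := mulr_gt0 (ltr0n R 2) nu0.
move: (addrn_neq0 (i + j) nu2); move: (2 * nu + (i + j)%:R).
move: (addrn_neq0 (i + j + t) nu0) (addrn_neq0 (i + j + t).+1 nu0) (addrn_neq0 (i + j + t).+2 nu0).
move: (nu + (i + j + t)%:R) (nu + (i + j + t).+1%:R) (nu + (i + j + t).+2%:R).
move: (natrS_neq0 R i) (natrS_neq0 R t); move: (i%:R + 1) (t%:R + 1).
move: ((i + j).+1%:R + nu) ((N - (j + t).+1)%:R - i%:R) (N%:R + nu - t%:R).
move: ((i + t)%:R + 1) ((i + t).+1%:R + 1) ((j + t)%:R + 1) (nu + i%:R) ((i + j)%:R + 1).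
core_field R N nu0 i j t.
Qed.

Lemma alphaD_raise nu t i j : 0 < nu ->
  alphaD (nu + 1) t.+1 i j = alpha_core N nu t i j *
    (((i + t)%:R + 1) * ((j + t)%:R + 1) * (nu + i%:R) * (nu + j%:R) *
     ((i + j).+1%:R + nu) * (2 * (2 * nu + 1)) * (N%:R + nu + 1) ^+ 2 /
     ((N%:R + nu) * (t%:R + 1) * (2 * nu + (i + j)%:R) * (2 * nu + (i + j).+1%:R) *
      (nu + (i + j + t)%:R) * (nu + (i + j + t).+1%:R) * (nu + (i + j + t).+2%:R))).
Proof.
move=> nu0; rewrite /alphaD /alpha_core !(addSn, addnS).
rewrite (_ : N%:R + (nu + 1) = N%:R + nu + 1); last by ring.
rewrite (_ : (i + j)%:R + (nu + 1) = (i + j).+1%:R + nu); last by rewrite -natr1; ring.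
rewrite poch_shift2// !poch_shift// !lfactSl !factSr !pochSr.
rewrite (_ : 2 * nu + (i + j)%:R + 1 = 2 * nu + (i + j).+1%:R); last by rewrite -natr1; ring.
have nu2 := mulr_gt0 (ltr0n R 2) nu0.
have nu21 : 2 * nu + 1 != 0 by rewrite (addrn_neq0 1).
move: nu21 (lt0r_neq0 nu0).
have : N%:R + nu != 0 by rewrite addrC addrn_neq0.
move: (addrn_neq0 (i + j) nu2) (addrn_neq0 (i + j).+1 nu2).
move: (2 * nu + (i + j)%:R) (2 * nu + (i + j).+1%:R).
move: (addrn_neq0 (i + j + t) nu0) (addrn_neq0 (i + j + t).+1 nu0) (addrn_neq0 (i + j + t).+2 nu0).
move: (nu + (i + j + t)%:R) (nu + (i + j + t).+1%:R) (nu + (i + j + t).+2%:R).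
move: (natrS_neq0 R t); move: (t%:R + 1).
move: ((i + j).+1%:R + nu) (N%:R + nu + 1) (2 * nu + 1).
move: ((i + t)%:R + 1) ((j + t)%:R + 1) (nu + i%:R) (nu + j%:R).
core_field R N nu0 i j t.
Qed.

(** Coefficient of [gegp nu (i + j).+1] in [wpol_raise] for the entry (i + 1 + t, j + 1 + t). On the
    right, the bracket comes from multiplication by x, the other two terms from the neighbouring
    rows. *)
Lemma alphaD_raiseS nu t i j : 0 < nu -> (i.+1 + t <= N)%N -> (j.+1 + t <= N)%N ->
  - (((i + j)%:R + 1) * ((i + j)%:R + 2 * nu + 1) / (2 * nu)) *
    alphaD (nu + 1) t.+1 i j =
  raise_scale nu * (- 2 * (nu + (i%:R + 1 + t%:R)) * (N%:R + nu - (i%:R + 1 + t%:R)) *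
      (alphaD nu t.+1 i j * (((i + j)%:R + 1) / (2 * ((i + j)%:R + nu))) +
       alphaD nu t i.+1 j.+1 *
         (((i + j)%:R + 2 * nu + 1) / (2 * ((i + j)%:R + 2 + nu)))) +
    (nu + (i%:R + 1 + t%:R)) *
      ((N%:R - (i%:R + 1 + t%:R)) * alphaD nu t.+1 i.+1 j) +
    (N%:R + nu - (i%:R + 1 + t%:R)) *
      ((i%:R + 1 + t%:R) * alphaD nu t i j.+1)).
Proof.
move=> nu0; rewrite !addSn => iN jN.
rewrite (_ : i%:R + 1 + t%:R = (i + t).+1%:R); last by rewrite -natr1 natrD addrAC.
rewrite alphaD_succ_ti// alphaD_raise// alphaD_succ_t// alphaD_succ_ij// alphaD_succ_j//.
rewrite /raise_scale.
rewrite (_ : (i + j)%:R + 2 * nu + 1 = 2 * nu + (i + j).+1%:R); last by rewrite -natr1; ring.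
rewrite (_ : (i + j)%:R + 2 + nu = (i + j).+2%:R + nu); last by rewrite -!natr1; ring.
rewrite (natr1 (i + t)).
have key : - (nu + i%:R) * (nu + j%:R) * ((i + j).+1%:R + nu) * (N%:R + nu + 1) *
    (N%:R + 2 * nu) * (i%:R + 1) * (j%:R + 1) =
  - (nu + (i + t).+1%:R) * (N%:R + nu - (i + t).+1%:R) * (N%:R + nu - t%:R) *
    (2 * nu + (i + j)%:R) * (nu + (i + j + t).+2%:R) * (i%:R + 1) * (j%:R + 1) -
  (nu + (i + t).+1%:R) * (N%:R + nu - (i + t).+1%:R) * (t%:R + 1) * (nu + i%:R) *
    (nu + j%:R) * ((i + j).+1%:R + 1) * ((N - (j + t).+1)%:R - i%:R) +
  (nu + (i + t).+1%:R) * ((i + t).+1%:R + 1) * (nu + i%:R) * ((i + j).+1%:R + nu) *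
    ((N - (j + t).+1)%:R - i%:R) * (N%:R + nu - t%:R) * (j%:R + 1) +
  (N%:R + nu - (i + t).+1%:R) * (t%:R + 1) * (nu + j%:R) * ((i + j).+1%:R + nu) *
    ((N - (i + t).+1)%:R + 1) * (nu + (i + j + t).+2%:R) * (i%:R + 1) :> R.
  by rewrite !natrB// -!natr1 !natrD; ring.
have nu2 := mulr_gt0 (ltr0n R 2) nu0.
have n0 := lt0r_neq0 nu0.
have : (i + j).+2%:R + nu != 0 by rewrite addrC addrn_neq0.
have : (i + j)%:R + nu != 0 by rewrite addrC addrn_neq0.
have : N%:R + nu != 0 by rewrite addrC addrn_neq0.
have : N%:R + 2 * nu != 0 by rewrite addrC addrn_neq0.
move: n0 key; move: ((i + j).+2%:R + nu) ((i + j)%:R + nu) (N%:R + nu + 1) => s2n s0n Nn1.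
move: (nu + (i + t).+1%:R) (N%:R + nu - (i + t).+1%:R) (N%:R + nu - t%:R) => nit Nnit Nt.
move: (N%:R + nu) (N%:R + 2 * nu) (2 * nu + 1) => Nn N2n n21.
move: (addrn_neq0 (i + j) nu2) (addrn_neq0 (i + j).+1 nu2).
move: (2 * nu + (i + j)%:R) (2 * nu + (i + j).+1%:R) => n0 n1.
move: (addrn_neq0 (i + j + t) nu0) (addrn_neq0 (i + j + t).+1 nu0) (addrn_neq0 (i + j + t).+2 nu0).
move: (nu + (i + j + t)%:R) (nu + (i + j + t).+1%:R) (nu + (i + j + t).+2%:R) => w0 w1 w2.
move: (natrS_neq0 R i) (natrS_neq0 R j) (natrS_neq0 R t).
move: (i%:R + 1) (j%:R + 1) (t%:R + 1) => i1 j1 t1.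
move: ((N - (j + t).+1)%:R - i%:R) ((N - (i + t).+1)%:R + 1) => a b.
move: ((i + t).+1%:R : R) ((i + t).+1%:R + 1) ((j + t)%:R + 1) (nu + i%:R) (nu + j%:R) => it it2 jt ni nj.
move: ((i + j)%:R + 1) ((i + j).+1%:R + 1) ((i + j).+1%:R + nu) => s1 s2 s1n.
move: (alpha_core _ _ _ _ _) => core ? ? ? ? ? ? ? ? ? key ? ? ? ?.
transitivity (core * it * jt * s1 * n21 * Nn1 /
    (nu * Nn * N2n * t1 * n0 * w0 * w1 * w2 * i1 * j1) *
    (- ni * nj * s1n * Nn1 * N2n * i1 * j1)).
  by field; repeat (apply/andP; split); assumption.
by rewrite key; field; repeat (apply/andP; split); assumption.
Qed.

End RaisedCoefficients.

(** * First-order recurrences for the entries of the weight *)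

Section Weight.
Variables (R : realFieldType) (N : nat).
Implicit Types (nu : R) (t i j m n : nat).
Local Notation alphaD := (alphaD N).
Local Notation raise_scale := (raise_scale N).

Lemma alphaD_raise0l nu t j : 0 < nu -> (j.+1 + t <= N)%N ->
  2 * (N%:R + nu - t%:R) *
      (alphaD nu t 0 j.+1 * ((j%:R + 2 * nu) / (2 * (j%:R + 1 + nu)))) =
  (N%:R - t%:R) * alphaD nu t.+1 0 j.
Proof.
move=> nu0 jN; prep R nu0 0%N j t; move: pij pijt.
rewrite /alphaD !(add0n, addSn, addnS) !ffactn0 => pij pijt.
have [a Na] : exists a, N = (a + t.+1)%N by exists (N - t.+1)%N; lia.
have RNa : N%:R - t%:R = a%:R + 1 :> R by rewrite Na natrD -natr1; ring.
rewrite (_ : N - t.+1 = a)%N; last lia.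
rewrite (_ : N - t = a.+1)%N; last lia.
rewrite !factSr !pochSr !lfactSr RNa fact0.
have -> : (j + t).+1%:R = j%:R + t%:R + 1 :> R by rewrite -!natr1 !natrD; ring.
rewrite -(natr1 j) natrD.
have f := fact_neq0 R.
by field; nonzero.
Qed.

Lemma alphaD_raise0r nu t i : 0 < nu -> (i.+1 + t <= N)%N ->
  2 * (nu + (i%:R + 1 + t%:R)) *
      (alphaD nu t i.+1 0 * ((i%:R + 2 * nu) / (2 * (i%:R + 1 + nu)))) =
  (i%:R + 1 + t%:R) * alphaD nu t i 0.
Proof.
move=> nu0; rewrite addSn => iN; rewrite -alphaD_euler0r//.
have i0 := ler0n R i.
by field; nonzero.
Qed.

Definition alphas nu t m n : R :=
  if ((t <= m) && (t <= n))%N then alphaD nu t (m - t) (n - t) else 0.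

(* The weight is (1 - x^2)^(nu - 1/2) times this matrix of polynomials. Entries
   whose index is N + 1, or a predecessor truncated at 0, are junk; below they
   only occur with a zero coefficient. *)
Definition wpol nu m n : {poly R} :=
  \sum_(t < N.+1) alphas nu t m n *: gegp nu (m + n - 2 * t).

Lemma alphas_gt nu t m n : (m < t)%N || (n < t)%N -> alphas nu t m n = 0.
Proof. by rewrite /alphas ![(t <= _)%N]leqNgt; case: (m < t)%N; case: (n < t)%N. Qed.

Lemma alphasE nu t i j : alphas nu t (i + t) (j + t) = alphaD nu t i j.
Proof. by rewrite /alphas !leq_addl !addnK. Qed.

Lemma sum_shift (V : zmodType) (f : nat -> V) n : f n = 0 ->
  \sum_(t < n) f t = f 0%N + \sum_(t < n) f t.+1.
Proof.
move=> fn0; have : \sum_(t < n.+1) f t = \sum_(t < n) f t.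
  by rewrite big_ord_recr /= fn0 addr0.
by rewrite big_ord_recl => <-.
Qed.

(** Row m - 1 in the case m = t. For t > 0 the coefficient is out of range; for t = 0 the
    predecessor truncates to 0 and only the factor t makes the product vanish. *)
Lemma alphas_predl nu t n : t%:R * alphas nu t t.-1 n = 0.
Proof. by case: t => [|t]; rewrite ?mul0r// alphas_gt ?mulr0//= ltnSn. Qed.

Lemma alphas_predr nu t m : t%:R * alphas nu t m t.-1 = 0.
Proof.
by case: t => [|t]; rewrite ?mul0r// alphas_gt ?mulr0//= ltnSn orbT.
Qed.

(** The operator on the left shifts every degree of the Gegenbauer expansion by one in both
    directions, so both sides expand in the degrees m + n - 1 - 2t and can be compared termwise. *)
Lemma wpol_euler nu m n : 0 < nu -> (m <= N)%N -> (n <= N)%N ->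
  (1 - 'X ^+ 2) * (wpol nu m n)^`() + (m + n)%:R *: ('X * wpol nu m n) =
  m%:R *: wpol nu m.-1 n + n%:R *: wpol nu m n.-1.
Proof.
move=> nu0 mN nN; rewrite /wpol raddf_sum /= !mulr_sumr !scaler_sumr -!big_split /=.
pose k t : R := (m + n - 2 * t)%N%:R.
pose A t := alphas nu t m n *: (((k t + 1) * ((m + n)%:R - k t) / (2 * (k t + nu))) *:
   gegp nu (m + n - 2 * t).+1).
pose B t := alphas nu t m n *: (((k t + 2 * nu - 1) * (k t + 2 * nu + (m + n)%:R) /
   (2 * (k t + nu))) *: gegpred nu (m + n - 2 * t)).
have kA t : A t + B t = alphas nu t m n *: ((1 - 'X ^+ 2) * (gegp nu (m + n - 2 * t))^`() +
    (m + n)%:R *: ('X * gegp nu (m + n - 2 * t))).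
  by rewrite gegp_euler// scalerDr.
transitivity (\sum_(t < N.+1) (A t + B t)).
  apply: eq_bigr => t _; rewrite kA derivZ scalerDr -!scalerAr !scalerA.
  by rewrite [_%:R * _]mulrC.
(* The raised summand t + 1 and the lowered summand t have the same degree, so the sum of the A is
   shifted by one. Its first term is 0 because s = m + n is the degree of the top Gegenbauer
   polynomial. *)
rewrite big_split /= (@sum_shift _ A); last by rewrite /A alphas_gt ?scale0r// ltnS mN.
have A0 : A 0%N = 0 by rewrite /A /k subn0 subrr mulr0 mul0r scale0r scaler0.
rewrite A0 add0r -!big_split /=.
apply: eq_bigr => t _.
case: t => t /= _.
have [tm|mt] := leqP t m; last first.
  by rewrite /A /B !alphas_gt ?scale0r ?scaler0 ?addr0//; lia.
have [tn|nt] := leqP t n; last first.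
  by rewrite /A /B !alphas_gt ?scale0r ?scaler0 ?addr0//; lia.
rewrite /A /B /k {A B kA A0 k}.
have [i mE] : exists i, m = (i + t)%N by exists (m - t)%N; rewrite subnK.
have [j nE] : exists j, n = (j + t)%N by exists (n - t)%N; rewrite subnK.
subst m n; rewrite !scalerA => {tm tn}.
have i0 := ler0n R i; have j0 := ler0n R j; have t0 := ler0n R t.
(* If i or j is 0, then t + 1 exceeds m or n and only the lowered part of summand t is left; if both
   are 0, every term vanishes. *)
case: i mN i0 => [|i] mN i0; case: j nN j0 => [|j] nN j0.
- rewrite !add0n (_ : t + t - 2 * t = 0)%N; last lia.
  rewrite (@alphas_gt _ t.+1) ?ltnSn// alphas_predl alphas_predr.
  by rewrite mul0r !scale0r scaler0 addr0.
- rewrite !add0n alphas_predl (@alphas_gt _ t.+1) ?ltnSn// mul0r !scale0r !add0r.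
  rewrite addSn [_.+1.-1]/= (_ : t + (j + t).+1 - 2 * t = j.+1)%N; last lia.
  rewrite (_ : t + (j + t) - 2 * t = j)%N; last lia.
  have := alphasE nu t 0 j.+1; rewrite add0n addSn => ->.
  have := alphasE nu t 0 j; rewrite add0n => ->.
  congr (_ *: _).
  have -> : (j + t).+1%:R = j%:R + 1 + t%:R :> R by rewrite -natr1 natrD; ring.
  rewrite -alphaD_euler0l//.
  rewrite addnS -(natr1 (t + _)) !natrD -(natr1 j); field; nonzero.
- have z : alphas nu t.+1 (i.+1 + t) t = 0 by rewrite alphas_gt// ltnSn orbT.
  rewrite (add0n t) z (alphas_predr nu t (i.+1 + t)) mul0r !scale0r add0r addr0.
  rewrite addSn [_.+1.-1]/= (_ : (i + t).+1 + t - 2 * t = i.+1)%N; last lia.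
  rewrite (_ : i + t + t - 2 * t = i)%N; last lia.
  have := alphasE nu t i.+1 0; rewrite add0n addSn => ->.
  have := alphasE nu t i 0; rewrite add0n => ->.
  congr (_ *: _).
  have -> : (i + t).+1%:R = i%:R + 1 + t%:R :> R by rewrite -natr1 natrD; ring.
  rewrite -alphaD_euler0r//.
  rewrite addSn -(natr1 (_ + t)) !natrD -(natr1 i); field; nonzero.
- rewrite !addSn !addnS [_.+1.-1]/= [X in X.-1]/=.
  rewrite (_ : (i + t + (j + t)).+2 - 2 * t = (i + j).+2)%N; last lia.
  rewrite (_ : (i + t + (j + t)).+2 - 2 * t.+1 = i + j)%N; last lia.
  rewrite (_ : (i + t + (j + t)).+1 - 2 * t = (i + j).+1)%N; last lia.
  rewrite [gegpred _ _]/= -!scalerDl.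
  have := alphasE nu t.+1 i j; rewrite !addnS => ->.
  have := alphasE nu t i.+1 j; rewrite !addSn => ->.
  have := alphasE nu t i j.+1; rewrite !addSn => ->.
  have := alphasE nu t i.+1 j.+1; rewrite !addSn => ->.
  congr (_ *: _).
  have E := @alphaD_euler R N nu t i j nu0 mN nN.
  have e1 : (i + t).+1%:R = i%:R + 1 + t%:R :> R by rewrite -natr1 natrD; ring.
  have e2 : (j + t).+1%:R = j%:R + 1 + t%:R :> R by rewrite -natr1 natrD; ring.
  rewrite e1 e2 -E -(natr1 (_ + (j + t)).+1) -(natr1 (_ + (j + t))).
  rewrite -(natr1 (i + j).+1) -(natr1 (i + j)) !natrD.
  have ij0 : 0 <= i%:R + j%:R :> R by rewrite addr_ge0.
  by congr (_ * _ + _ * _); field; nonzero.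
Qed.

End Weight.

Section WeightRaise.
Variables (R : realFieldType) (N : nat).
Implicit Types (nu : R) (t i j m n : nat).
Local Notation alphaD := (alphaD N).
Local Notation alphas := (alphas N).
Local Notation wpol := (wpol N).
Local Notation raise_scale := (raise_scale N).

(** Multiplied by (1 - x^2)^(nu - 1/2), the left side is the derivative of (1 - x^2)^(nu + 1/2)
    [wpol (nu + 1) m n]; this is the relation with G, entry by entry. *)
Lemma wpol_raise nu m n : 0 < nu -> (m <= N)%N -> (n <= N)%N ->
  (1 - 'X ^+ 2) * (wpol (nu + 1) m n)^`() - (2 * nu + 1) *: ('X * wpol (nu + 1) m n) =
  raise_scale nu *: (- 2 * (nu + m%:R) * (N%:R + nu - m%:R) *: ('X * wpol nu m n) +
    (nu + m%:R) * (N%:R - m%:R) *: wpol nu m.+1 n +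
    (N%:R + nu - m%:R) * m%:R *: wpol nu m.-1 n).
Proof.
move=> nu0 mN nN; rewrite /wpol raddf_sum /= !mulr_sumr !scaler_sumr.
pose k t : R := (m + n - 2 * t)%N%:R.
pose l : R := raise_scale nu * (- 2 * (nu + m%:R) * (N%:R + nu - m%:R)).
pose u : R := raise_scale nu * ((nu + m%:R) * (N%:R - m%:R)).
pose d : R := raise_scale nu * ((N%:R + nu - m%:R) * m%:R).
(* A t collects the terms of degree m + n + 1 - 2t and B t those of degree m + n - 1 - 2t, with
   opposite signs, so that A (t + 1) has to equal B t. *)
pose A t :=
  (alphas (nu + 1) t m n * - ((k t + 1) * (k t + 2 * nu + 1) / (2 * nu)) -
   l * (alphas nu t m n * ((k t + 1) / (2 * (k t + nu))))) *: gegp nu (m + n - 2 * t).+1 -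
   (u * alphas nu t m.+1 n) *: gegp nu (m.+1 + n - 2 * t).
pose B t :=
  (l * (alphas nu t m n * ((k t + 2 * nu - 1) / (2 * (k t + nu))))) *: gegpred nu (m + n - 2 * t) +
   (d * alphas nu t m.-1 n) *: gegp nu (m.-1 + n - 2 * t).
apply/eqP; rewrite -subr_eq0; apply/eqP.
transitivity (\sum_(t < N.+1) (A t - B t)).
  rewrite -!big_split -!sumrN -!big_split /= scaler_sumr -sumrN -big_split /=.
  apply: eq_bigr => t _.
  have E1 := gegp_raise (m + n - 2 * t) nu0.
  have E2 := gegp_mulX (m + n - 2 * t) nu0.
  rewrite derivZ -!scalerAr; have /eqP := E1; rewrite subr_eq => /eqP ->.
  rewrite E2 /A /B /k /l /u /d.
  apply/polyP => i; rewrite !(coefD, coefN, coefZ).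
  by ring.
rewrite sumrB sum_shift; last first.
  rewrite /A !alphas_gt ?ltnS ?mN ?nN ?orbT//.
  by rewrite !mul0r !mulr0 oppr0 addr0 !scale0r subrr.
have A0 : A 0%N = 0.
  rewrite /A /k /l /u muln0 !subn0 addSn -scalerBl.
  have := alphasE N nu 0 m n; rewrite !addn0 => ->.
  have := alphasE N (nu + 1) 0 m n; rewrite !addn0 => ->.
  have := alphasE N nu 0 m.+1 n; rewrite !addn0 => ->.
  have := alphaD_raise0 nu0 mN nN.
  set a := alphaD _ _ _ _; set b := alphaD _ _ _ _; set c := alphaD _ _ _ _.
  move=> E; rewrite [a * _]mulrC E.
  by rewrite (_ : _ - _ = 0) ?scale0r//; ring.
rewrite A0 add0r; apply/eqP; rewrite subr_eq0; apply/eqP; apply: eq_bigr => t _.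
rewrite /A /B /k {A B A0 k}.
case: t => t /= _.
have [tm|mt] := leqP t m; last first.
  rewrite !(@alphas_gt _ _ _ t.+1) ?(@alphas_gt _ _ _ t); try lia.
  by rewrite !(mul0r, mulr0) subrr !scale0r subrr addr0.
have [tn|nt] := leqP t n; last first.
  rewrite !(@alphas_gt _ _ _ t.+1) ?(@alphas_gt _ _ _ t); try lia.
  by rewrite !(mul0r, mulr0) subrr !scale0r subrr addr0.
have [i mE] : exists i, m = (i + t)%N by exists (m - t)%N; rewrite subnK.
have [j nE] : exists j, n = (j + t)%N by exists (n - t)%N; rewrite subnK.
subst m n; rewrite {tm tn}.
have i0 := ler0n R i; have j0 := ler0n R j; have t0 := ler0n R t.
case: i mN i0 @l @u @d => [|i] mN i0 l u d; case: j nN j0 => [|j] nN j0.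
- rewrite !(add0n t) (_ : t + t - 2 * t = 0)%N; last lia.
  have z p : alphas p t.+1 t t = 0 by rewrite alphas_gt// ltnSn.
  have z1 : alphas nu t.+1 t.+1 t = 0 by rewrite alphas_gt// ltnSn orbT.
  have -> : d * alphas nu t t.-1 t = 0.
    by rewrite /d (add0n t) -!mulrA alphas_predl !mulr0.
  by rewrite !z z1 !(mul0r, mulr0) subrr !scale0r scaler0 subrr addr0.
- rewrite !(add0n t).
  have z p : alphas p t.+1 t (j.+1 + t) = 0 by rewrite alphas_gt// ltnSn.
  have -> : d * alphas nu t t.-1 (j.+1 + t) = 0.
    by rewrite /d (add0n t) -!mulrA alphas_predl !mulr0.
  rewrite !z !(mul0r, mulr0) subrr !scale0r sub0r addr0 -scaleNr.
  rewrite (_ : t + (j.+1 + t) - 2 * t = j.+1)%N; last lia.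
  rewrite (_ : t.+1 + (j.+1 + t) - 2 * t.+1 = j)%N; last lia.
  have := alphasE N nu t 0 j.+1; rewrite add0n => ->.
  have := alphasE N nu t.+1 0 j; rewrite add0n addnS -addSn => ->.
  congr (_ *: _); rewrite /l /u (add0n t).
  have := alphaD_raise0l nu0 nN; set x := alphaD _ _ _ _; set y := alphaD _ _ _ _ => E.
  set r := raise_scale nu.
  have -> : r * ((nu + t%:R) * (N%:R - t%:R)) * y = r * (nu + t%:R) * ((N%:R - t%:R) * y).
    by ring.
  by rewrite -E -(natr1 j); field; nonzero.
- have z p : alphas p t.+1 (i.+1 + t) (0 + t) = 0.
    by rewrite alphas_gt// add0n ltnSn orbT.
  have z1 : alphas nu t.+1 (i.+1 + t).+1 (0 + t) = 0.
    by rewrite alphas_gt// add0n ltnSn orbT.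
  rewrite !z z1 !(mul0r, mulr0) subrr !scale0r subrr.
  rewrite (_ : i.+1 + t + (0 + t) - 2 * t = i.+1)%N; last lia.
  rewrite (_ : (i.+1 + t).-1 + (0 + t) - 2 * t = i)%N; last lia.
  rewrite (_ : (i.+1 + t).-1 = i + t)%N// !alphasE -scalerDl.
  have := alphaD_raise0r nu0 mN; set x := alphaD _ _ _ _; set y := alphaD _ _ _ _ => E.
  have e3 : (i.+1 + t)%:R = i%:R + 1 + t%:R :> R by rewrite natrD -natr1.
  rewrite /l /d e3 -(natr1 i); apply/esym.
  set r := raise_scale nu; set c := N%:R + nu - (i%:R + 1 + t%:R).
  have -> : r * (c * (i%:R + 1 + t%:R)) * y = r * c * ((i%:R + 1 + t%:R) * y) by ring.
  rewrite -E [X in X *: _](_ : _ = 0) ?scale0r//.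
  by field; nonzero.
- have E := alphaD_raiseS nu0 mN nN.
  rewrite (_ : i.+1 + t + (j.+1 + t) - 2 * t.+1 = i + j)%N; last lia.
  rewrite (_ : (i.+1 + t).+1 + (j.+1 + t) - 2 * t.+1 = (i + j).+1)%N; last lia.
  rewrite (_ : i.+1 + t + (j.+1 + t) - 2 * t = (i + j).+2)%N; last lia.
  rewrite (_ : (i.+1 + t).-1 + (j.+1 + t) - 2 * t = (i + j).+1)%N; last lia.
  rewrite (_ : (i.+1 + t).-1 = i + t)%N// !alphasE.
  have e p : alphas p t.+1 (i.+1 + t) (j.+1 + t) = alphaD p t.+1 i j.
    by rewrite !addSn -!addnS alphasE.
  have e1 : alphas nu t.+1 (i.+1 + t).+1 (j.+1 + t) = alphaD nu t.+1 i.+1 j.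
    by rewrite -[RHS](alphasE N) addnS [(j.+1 + t)%N]addSnnS.
  rewrite !e e1 [gegpred _ _]/= -scalerBl -scalerDl; congr (_ *: _).
  have ij0 := ler0n R (i + j).
  have e2 : (i + j).+2%:R = (i + j)%:R + 2 :> R by rewrite -!natr1; ring.
  have e3 : (i.+1 + t)%:R = i%:R + 1 + t%:R :> R by rewrite natrD -natr1.
  rewrite /l /u /d e2 e3 [X in X - _ - _]mulrC E.
  set a := alphaD _ _ _ _; set b := alphaD _ _ _ _; set c := alphaD _ _ _ _.
  set f := alphaD _ _ _ _; set r := raise_scale _.
  by field; nonzero.
Qed.

End WeightRaise.

(** * Symmetry, leading coefficients and uniqueness for the entries *)

Section Symmetry.
Variables (R : realFieldType) (N : nat).
Implicit Types (nu : R) (t i j m n : nat).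
Local Notation alphaD := (alphaD N).
Local Notation alphas := (alphas N).
Local Notation wpol := (wpol N).
Local Notation raise_scale := (raise_scale N).

(** Only one factor is not visibly symmetric. With a = N - i - t and b = N - j - t it is a! b! / (b
    - i)! if i <= b, and b - i = a - j. *)
Lemma alphaDC nu t i j : (i + t <= N)%N -> (j + t <= N)%N ->
  alphaD nu t i j = alphaD nu t j i.
Proof.
move=> iN jN; rewrite /alphaD [(j + i)%N]addnC.
set a := (N - (i + t))%N; set b := (N - (j + t))%N.
have e : (a`! * b ^_ i = b`! * a ^_ j)%N.
  have [ib|bi] := leqP i b; last by rewrite !ffact_small ?muln0//; lia.
  have ja : (j <= a)%N by lia.
  apply/eqP; rewrite -(eqn_pmul2r (fact_gt0 (b - i))) -!mulnA ffact_fact//.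
  by rewrite (_ : b - i = a - j)%N ?ffact_fact// 1?mulnC//; lia.
rewrite -[X in X * lfact _ _]mulrA -[_`!%:R * (b ^_ i)%:R]natrM e natrM.
rewrite [j`!%:R * i`!%:R]mulrC; ring.
Qed.

Lemma alphasC nu t m n : (m <= N)%N -> (n <= N)%N -> alphas nu t m n = alphas nu t n m.
Proof.
move=> mN nN; rewrite /alphas andbC; case: ifP => // /andP[tn tm].
by rewrite alphaDC ?subnK.
Qed.

Lemma wpolC nu m n : (m <= N)%N -> (n <= N)%N -> wpol nu m n = wpol nu n m.
Proof.
move=> mN nN; apply: eq_bigr => t _; rewrite alphasC//.
by rewrite [(n + m)%N]addnC.
Qed.

Lemma size_wpol nu m n : (size (wpol nu m n) <= (m + n).+1)%N.
Proof.
apply: leq_trans (size_sum _ _ _) _; apply/bigmax_leqP => t _.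
apply: leq_trans (size_scale_leq _ _) _; apply: leq_trans (size_gegp _ _) _.
by rewrite ltnS leq_subr.
Qed.

Definition wlead nu m n : R := (N%:R + nu) / N`!%:R * 2 ^+ (m + n) *
  poch nu m * poch nu n / poch (2 * nu) (m + n) * ((N - m)`!%:R * ((N - n) ^_ m)%:R).

Lemma wpol_lead nu m n : 0 < nu -> (wpol nu m n)`_(m + n) = wlead nu m n.
Proof.
move=> nu0; rewrite coef_sum big_ord_recl big1 => [|i _].
  rewrite addr0 coefZ muln0 subn0 gegp_lead//.
  have := alphasE N nu 0 m n; rewrite !addn0 => ->.
  rewrite /alphaD /wlead !addn0 lfact0 pochSr fact0 natrD.
  have f := fact_neq0 R.
  have p0 := poch_neq0 (m + n) nu0.
  have p1 := poch_neq0 (m + n) (mulr_gt0 (ltr0n R 2) nu0).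
  have m0 := ler0n R m; have n0 := ler0n R n.
  move: (2 ^+ _) => z; field; nonzero.
rewrite coefZ; have [it|ti] := leqP (bump 0 i) m; last by rewrite alphas_gt ?mul0r// ti.
rewrite nth_default ?mulr0//; apply: leq_trans (size_gegp _ _) _.
by move: it; rewrite /= /bump leq0n add1n; move: (nat_of_ord i) => k; lia.
Qed.

(** Comparing the coefficients one above the degree d of a nonzero solution gives (s - d) times its
    leading coefficient equal to 0, hence d = s. *)
Lemma euler_poly_eq0 (s : nat) (p : {poly R}) :
  (1 - 'X ^+ 2) * p^`() + s%:R *: ('X * p) = 0 -> p`_s = 0 -> p = 0.
Proof.
move=> E ps; apply/eqP; apply: contraPT isT => p0 _.
have sp : (0 < size p)%N by rewrite size_poly_gt0.
have E1 : (1 - 'X ^+ 2) * p^`() = p^`() - 'X * ('X * p^`()) by ring.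
have := congr1 (fun q : {poly R} => q`_(size p)) E.
rewrite E1 !(coefD, coefB, coefN, coefZ) coef_deriv coef0 -(prednK sp).
rewrite [('X * ('X * _))`_ _]coefXM coef_Xderiv [('X * p)`_ _]coefXM /= prednK//.
rewrite nth_default ?leqW// mul0rn sub0r => /eqP.
rewrite addrC mulrC -mulrBr mulf_eq0 => /orP[|].
  by rewrite -/(lead_coef p) lead_coef_eq0 (negPf p0).
rewrite subr_eq0 eqr_nat => /eqP sE.
by move: p0; rewrite -lead_coef_eq0 /lead_coef -sE ps eqxx.
Qed.

End Symmetry.

(** * The relation W^(nu+1) = F W^(nu) *)

Section Pearson.
Variables (R : realFieldType) (N : nat).
Implicit Types (nu : R) (t i j m n : nat).
Local Notation wpol := (wpol N).
Local Notation wlead := (wlead N).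
Local Notation raise_scale := (raise_scale N).

Lemma wpol_deriv nu m n : 0 < nu -> (m <= N)%N -> (n <= N)%N ->
  (1 - 'X ^+ 2) * (wpol nu m n)^`() =
  m%:R * wpol nu m.-1 n + n%:R * wpol nu m n.-1 - (m%:R + n%:R) * ('X * wpol nu m n).
Proof.
move=> nu0 mN nN; rewrite -[LHS](addrK ((m + n)%:R *: ('X * wpol nu m n))).
by rewrite wpol_euler// !scaler_nat -[_ *+ m]mulr_natl -[_ *+ n]mulr_natl
  -[_ *+ (m + n)]mulr_natl natrD.
Qed.

(** The constant is forced by the leading coefficients in the entry (0, 0) of [wpol_mul]. *)
Definition pearson_scale nu : R := raise_scale nu / (2 * (N%:R + 2 * nu + 1)).

(* Entry (m, n) of W^(nu + 1), up to the factor pearson_scale (1 - x^2)^(nu - 1/2):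
   a combination of the entries of column n of W^(nu). *)
Definition pearson_row nu m n : {poly R} :=
  (4 * (nu%:P + m%:R) * (N%:R + nu%:P - m%:R) * (1 - 'X ^+ 2) +
     (m%:R * (N%:R - m%:R + 1) * (2 * m%:R - 1 - N%:R) -
      (m%:R + 1) * (N%:R - m%:R) * (2 * m%:R + 1 - N%:R))) * wpol nu m n +
  2 * 'X * ((N%:R - m%:R) * (2 * m%:R + 1 - N%:R)) * wpol nu m.+1 n +
  2 * 'X * (m%:R * (N%:R - 2 * m%:R + 1)) * wpol nu m.-1 n +
  (N%:R - m%:R) * (N%:R - m%:R - 1) * wpol nu m.+2 n +
  m%:R * (m%:R - 1) * wpol nu m.-2 n.

(** Row m + 1 may not exist, so its relation is only available with a factor that vanishes in that
    case. The coefficients of [pearson_row] contain exactly such factors; the three lemmas below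
    follow the same pattern. *)
Lemma wpol_deriv_up nu m n : 0 < nu -> (m <= N)%N -> (n <= N)%N ->
  (N%:R - m%:R) * ((1 - 'X ^+ 2) * (wpol nu m.+1 n)^`()) = (N%:R - m%:R) *
  ((m%:R + 1) * wpol nu m n + n%:R * wpol nu m.+1 n.-1 -
    (m%:R + 1 + n%:R) * ('X * wpol nu m.+1 n)).
Proof.
move=> nu0; rewrite leq_eqVlt => /orP[/eqP->|mN] nN; first by rewrite subrr !mul0r.
by rewrite wpol_deriv//= -natr1.
Qed.

Lemma wpol_deriv_up2 nu m n : 0 < nu -> (m <= N)%N -> (n <= N)%N ->
  (N%:R - m%:R) * (N%:R - m%:R - 1) * ((1 - 'X ^+ 2) * (wpol nu m.+2 n)^`()) =
  (N%:R - m%:R) * (N%:R - m%:R - 1) *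
  ((m%:R + 2) * wpol nu m.+1 n + n%:R * wpol nu m.+2 n.-1 -
    (m%:R + 2 + n%:R) * ('X * wpol nu m.+2 n)).
Proof.
move=> nu0; rewrite leq_eqVlt => /orP[/eqP->|mN] nN; first by rewrite subrr !mul0r.
move: mN; rewrite leq_eqVlt => /orP[/eqP <-|mN].
  by rewrite -natr1 (_ : m%:R + 1 - m%:R - 1 = 0) ?mulr0 ?mul0r//; ring.
by rewrite wpol_deriv//= -addn2 natrD.
Qed.

Lemma wpol_deriv_down nu m n : 0 < nu -> (m <= N)%N -> (n <= N)%N ->
  m%:R * ((1 - 'X ^+ 2) * (wpol nu m.-1 n)^`()) = m%:R *
  ((m%:R - 1) * wpol nu m.-2 n + n%:R * wpol nu m.-1 n.-1 -
    (m%:R - 1 + n%:R) * ('X * wpol nu m.-1 n)).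
Proof.
move=> nu0; case: m => [|m] mN nN; first by rewrite !mul0r.
by rewrite wpol_deriv//= ?(ltnW mN)// -natr1 addrK.
Qed.

Lemma wpol_deriv_down2 nu m n : 0 < nu -> (m <= N)%N -> (n <= N)%N ->
  m%:R * (m%:R - 1) * ((1 - 'X ^+ 2) * (wpol nu m.-2 n)^`()) = m%:R * (m%:R - 1) *
  ((m%:R - 2) * wpol nu m.-2.-1 n + n%:R * wpol nu m.-2 n.-1 -
    (m%:R - 2 + n%:R) * ('X * wpol nu m.-2 n)).
Proof.
move=> nu0; case: m => [|[|m]] mN nN; [by rewrite !mul0r|by rewrite subrr mulr0 !mul0r|].
rewrite wpol_deriv//= 1?ltnW 1?ltnW//.
by rewrite -addn2 natrD addrK.
Qed.

(** The multipliers form a certificate: an identity modulo five relations becomes a single call of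
    [ring]. *)
Lemma lin_comb5 (A : comPzRingType) (a1 b1 a2 b2 a3 b3 a4 b4 a5 b5 : A) k1 k2 k3 k4 k5 g :
  a1 = b1 -> a2 = b2 -> a3 = b3 -> a4 = b4 -> a5 = b5 ->
  g = k1 * (a1 - b1) + k2 * (a2 - b2) + k3 * (a3 - b3) + k4 * (a4 - b4) +
      k5 * (a5 - b5) -> g = 0.
Proof. by move=> -> -> -> -> -> ->; rewrite !subrr !mulr0 !addr0. Qed.

(** This is the system satisfied by (1 - x^2) w whenever w satisfies [wpol_deriv]: the extra factor
    adds 2 to the coefficient of x. *)
Lemma pearson_row_euler nu m n : 0 < nu -> (m <= N)%N -> (n <= N)%N ->
  (1 - 'X ^+ 2) * (pearson_row nu m n)^`() =
  m%:R * pearson_row nu m.-1 n + n%:R * pearson_row nu m n.-1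
  - (m%:R + n%:R + 2) * ('X * pearson_row nu m n).
Proof.
move=> nu0 mN nN.
have E0 := wpol_deriv nu0 mN nN.
have E1 := wpol_deriv_up nu0 mN nN.
have E2 := wpol_deriv_up2 nu0 mN nN.
have F1 := wpol_deriv_down nu0 mN nN.
have F2 := wpol_deriv_down2 nu0 mN nN.
have dn k : (k%:R : {poly R})^`() = 0 by rewrite -polyC_natr derivC.
(* Row m - 1 is written with ring subtraction; for m = 0, where the predecessor truncates, the
   factor m removes the discrepancy. *)
have -> : m%:R * pearson_row nu m.-1 n = m%:R * (
  (4 * (nu%:P + (m%:R - 1)) * (N%:R + nu%:P - (m%:R - 1)) * (1 - 'X ^+ 2) +
     ((m%:R - 1) * (N%:R - m%:R + 2) * (2 * m%:R - 3 - N%:R) -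
      m%:R * (N%:R - m%:R + 1) * (2 * m%:R - 1 - N%:R))) * wpol nu m.-1 n +
  2 * 'X * ((N%:R - m%:R + 1) * (2 * m%:R - 1 - N%:R)) * wpol nu m n +
  2 * 'X * ((m%:R - 1) * (N%:R - 2 * m%:R + 3)) * wpol nu m.-2 n +
  (N%:R - m%:R + 1) * (N%:R - m%:R) * wpol nu m.+1 n +
  (m%:R - 1) * (m%:R - 2) * wpol nu m.-2.-1 n).
  case: (m) => [|k]; first by rewrite !mul0r.
  by rewrite /pearson_row /= -natr1; ring.
rewrite /pearson_row !(derivD, derivB, derivM, derivN, derivC, derivX, dn, derivXn).
rewrite [2.-1]/= expr1.
move: E0 E1 E2 F1 F2 {dn mN nN}.
move: (wpol nu m n)^`() (wpol nu m.+1 n)^`() (wpol nu m.+2 n)^`() => d0 d1 d2.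
move: (wpol nu m.-1 n)^`() (wpol nu m.-2 n)^`() => b1 b2.
move: (wpol nu m n) (wpol nu m.+1 n) (wpol nu m.+2 n) => w0 w1 w2.
move: (wpol nu m.-1 n) (wpol nu m.-2 n) (wpol nu m.-1.-2 n) => u1 u2 u3.
move: (wpol nu m n.-1) (wpol nu m.+1 n.-1) (wpol nu m.+2 n.-1) => y0 y1 y2.
move: (wpol nu m.-1 n.-1) (wpol nu m.-2 n.-1) (nu%:P) => v1 v2 t.
move: (m%:R) (n%:R) (N%:R) 'X => a b c x E0 E1 E2 F1 F2.
apply/eqP; rewrite -subr_eq0; apply/eqP.
(* The multipliers are the coefficients of [pearson_row], without the vanishing factors already
   contained in E1, E2, F1 and F2. *)
apply: (lin_comb5 E0 E1 E2 F1 F2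
  (k1 := 4 * (t + a) * (c + t - a) * (1 - x ^+ 2) +
     (a * (c - a + 1) * (2 * a - 1 - c) - (a + 1) * (c - a) * (2 * a + 1 - c)))
  (k2 := 2 * x * (2 * a + 1 - c)) (k3 := 1)
  (k4 := 2 * x * (c - 2 * a + 1)) (k5 := 1)).
ring.
Qed.

(** Comparison of the coefficients of x^(m+n+2) in [wpol_mul]; the sign on the left comes from the
    factor 1 - x^2. *)
Lemma pearson_lead nu m n : 0 < nu -> (m <= N)%N -> (n <= N)%N ->
  - wlead (nu + 1) m n = pearson_scale nu * (
    - 4 * (nu + m%:R) * (N%:R + nu - m%:R) * wlead nu m n +
    2 * ((N%:R - m%:R) * (2 * m%:R + 1 - N%:R)) * wlead nu m.+1 n +
    (N%:R - m%:R) * (N%:R - m%:R - 1) * wlead nu m.+2 n).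
Proof.
move=> nu0 mN nN.
have E1 := @factB_shift R N m (N - n) m.+1 mN.
have {}E1 := E1 ltac:(lia).
have E2 : (N%:R - m%:R) * (N%:R - m%:R - 1) * ((N - m.+2)`!%:R * ((N - n) ^_ m.+2)%:R) =
    (N - m)`!%:R * ((N - n) ^_ m.+2)%:R :> R.
  have [mN1|Nm] := ltnP m N; last first.
    by rewrite ffact_small ?mulr0//; lia.
  have F1 := @factB_shift R N m (N - n) m.+2 mN.
  have {}F1 := F1 ltac:(lia).
  have F2 := @factB_shift R N m.+1 (N - n) m.+2 mN1.
  have {}F2 := F2 ltac:(lia).
  by rewrite -F1 -F2 -(natr1 m) -!mulrA; congr (_ * _); rewrite opprD addrA.
rewrite /wlead.
set f := (N%:R + nu) / _.
have RNn : (N - n)%:R = N%:R - n%:R :> R by rewrite natrB.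
move: E1 E2; rewrite !ffactB RNn -(natr1 m).
rewrite !addSn !exprS !pochSr !poch_shift2// !poch_shift// -[(_ + n).+1%:R]natr1 natrD.
rewrite -(natr1 m) /f /pearson_scale /raise_scale.
have f0 := fact_neq0 R N.
have pm := poch_neq0 m nu0; have pn := poch_neq0 n nu0.
have pmn := poch_neq0 (m + n) (mulr_gt0 (ltr0n R 2) nu0).
move: {f} f0 pm pn pmn (ler0n R m) (ler0n R n) (ler0n R N).
move: (N`!%:R : R) (poch nu m) (poch nu n) (poch (2 * nu) _) (m%:R : R) (n%:R : R) (N%:R : R).
move: ((N - m)`!%:R : R) ((N - m.+1)`!%:R : R) ((N - m.+2)`!%:R : R) (((N - n) ^_ m)%:R : R).
move: (2 ^+ (m + n) : R) => p g0 g1 g2 h fN pm pn pmn a b c ? ? ? ? ? ? ? E1 E2.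
transitivity (2 * (2 * nu + 1) * (c + nu + 1) / (nu * (c + nu) * (2 * (c + 2 * nu))) /
  (2 * (c + 2 * nu + 1)) *
  (- 4 * (nu + a) * (c + nu - a) *
   ((c + nu) / fN * p * pm * pn / pmn * (g0 * h)) +
   2 * (2 * a + 1 - c) *
   ((c + nu) / fN * (2 * p) * (pm * (nu + a)) * pn /
    (pmn * (2 * nu + (a + b))) * (g0 * (h * (c - b - a)))) +
   ((c + nu) / fN * (2 * (2 * p)) * (pm * (nu + a) * (nu + (a + 1))) * pn /
    (pmn * (2 * nu + (a + b)) * (2 * nu + (a + b + 1))) *
    (g0 * (h * (c - b - a) * (c - b - (a + 1))))))).
  by clear E1 E2; field; nonzero.
by rewrite -E1 -E2; ring.
Qed.

Lemma pearson_rowE nu m n : pearson_row nu m n =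
  (4 * (nu + m%:R) * (N%:R + nu - m%:R)) *: wpol nu m n +
  (m%:R * (N%:R - m%:R + 1) * (2 * m%:R - 1 - N%:R) -
      (m%:R + 1) * (N%:R - m%:R) * (2 * m%:R + 1 - N%:R)) *: wpol nu m n +
  (- 4 * (nu + m%:R) * (N%:R + nu - m%:R)) *: ('X * ('X * wpol nu m n)) +
  (2 * ((N%:R - m%:R) * (2 * m%:R + 1 - N%:R))) *: ('X * wpol nu m.+1 n) +
  (2 * (m%:R * (N%:R - 2 * m%:R + 1))) *: ('X * wpol nu m.-1 n) +
  ((N%:R - m%:R) * (N%:R - m%:R - 1)) *: wpol nu m.+2 n +
  (m%:R * (m%:R - 1)) *: wpol nu m.-2 n.
Proof.
rewrite -!mul_polyC !(polyCM, polyCD, polyCN, polyC_natr) /pearson_row.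
by ring.
Qed.

Lemma coef_pearson_row nu m n : 0 < nu ->
  (pearson_row nu m n)`_(m + n).+2 =
    - 4 * (nu + m%:R) * (N%:R + nu - m%:R) * wlead nu m n +
    2 * ((N%:R - m%:R) * (2 * m%:R + 1 - N%:R)) * wlead nu m.+1 n +
    (N%:R - m%:R) * (N%:R - m%:R - 1) * wlead nu m.+2 n.
Proof.
move=> nu0; rewrite pearson_rowE !(coefD, coefZ, coefXM) /=.
have z (p : {poly R}) k : (size p <= k)%N -> p`_k = 0 by move=> ?; rewrite nth_default.
have s k l := size_wpol N nu k l.
rewrite (z _ _ (leq_trans (s m n) _)); last lia.
rewrite (z _ _ (leq_trans (s m.-1 n) _)); last lia.
rewrite (z _ _ (leq_trans (s m.-2 n) _)); last lia.
rewrite wpol_lead// -!addSn !wpol_lead//.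
by ring.
Qed.

(** Induction on m + n: in the first-order equation for the difference F of the two sides, the
    inhomogeneity consists of the differences at (m - 1, n) and (m, n - 1). The resulting
    homogeneous equation has s = m + n + 2, and the coefficient of that order vanishes by
    [pearson_lead]. *)
Lemma wpol_mul nu m n : 0 < nu -> (m <= N)%N -> (n <= N)%N ->
  (1 - 'X ^+ 2) * wpol (nu + 1) m n = pearson_scale nu *: pearson_row nu m n.
Proof.
move=> nu0; have nu1 : 0 < nu + 1 by lra.
have [k] := ubnP (m + n); elim: k => // k IH in m n * => mnk mN nN.
apply/eqP; rewrite -subr_eq0; apply/eqP.
set F := _ - _.
have Fp : (1 - 'X ^+ 2) * F^`() + (m + n).+2%:R *: ('X * F) =
   m%:R * ((1 - 'X ^+ 2) * wpol (nu + 1) m.-1 n - pearson_scale nu *: pearson_row nu m.-1 n) +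
   n%:R * ((1 - 'X ^+ 2) * wpol (nu + 1) m n.-1 - pearson_scale nu *: pearson_row nu m n.-1).
  have E := wpol_deriv nu1 mN nN.
  have E2 := pearson_row_euler nu0 mN nN.
  have d2 : (1 - 'X ^+ 2 : {poly R})^`() = - (2 * 'X).
    by rewrite derivB derivXn -polyC1 derivC expr1 sub0r mulr_natl.
  have -> : F^`() = - (2 * 'X) * wpol (nu + 1) m n + (1 - 'X ^+ 2) * (wpol (nu + 1) m n)^`()
      - pearson_scale nu *: (pearson_row nu m n)^`().
    by rewrite /F derivB derivM derivZ d2.
  rewrite /F scaler_nat -mulr_natl -!mul_polyC; set q := (pearson_scale nu)%:P.
  rewrite mulrBr mulrDr mulrCA E [_ * (q * _)]mulrCA E2 -addn2 !natrD.
  by ring.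
have Fp0 : (1 - 'X ^+ 2) * F^`() + (m + n).+2%:R *: ('X * F) = 0.
  rewrite Fp; case: (m) (n) mN nN mnk IH {Fp F} => [|a] [|b] aN bN abk IH /=.
  - by rewrite !mul0r addr0.
  - by rewrite mul0r add0r IH ?subrr ?mulr0//; lia.
  - by rewrite mul0r addr0 IH ?subrr ?mulr0//; lia.
  - by rewrite !IH ?subrr ?mulr0 ?addr0//; lia.
apply: (euler_poly_eq0 Fp0).
rewrite /F coefB coefZ coef_pearson_row// -pearson_lead// mulrBl mul1r.
rewrite coefB nth_default; last by apply: leq_trans (size_wpol _ _ _ _) _; lia.
have -> : 'X ^+ 2 * wpol (nu + 1) m n = 'X * ('X * wpol (nu + 1) m n).
  by rewrite mulrA -expr2.
by rewrite !coefXM /= wpol_lead// sub0r subrr.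
Qed.

End Pearson.

(** * Beta integrals *)

Section Affine.
Variable R : realType.
Local Notation mu := (@lebesgue_measure R).

Definition affine (c d : R) : measurableTypeR R -> measurableTypeR R := fun x : R => c * x + d.

Lemma measurable_affine c d : measurable_fun setT (affine c d).
Proof.
have m : measurable_fun setT (fun x : R => c * x + d).
  by apply: measurable_funD => //; apply: measurable_funM.
exact: m.
Qed.

HB.instance Definition _ c d :=
  isMeasurableFun.Build _ _ _ _ (affine c d) (measurable_affine c d).

(** By uniqueness of Lebesgue measure it suffices to test half-open intervals, and the preimage of
    ]a, b] has length (b - a) / c. *)
Lemma lebesgue_measure_affine (c d : R) (A : set R) : 0 < c -> measurable A ->
  (c%:E * pushforward mu (affine c d) A = mu A)%E.
Proof.
move=> c0 mA.
apply/esym.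
apply: (@lebesgue_measure_unique R (mscale (NngNum (ltW c0)) (pushforward mu (affine c d)))) => //.
move=> _ [[a b]] _ <-.
pose J : set R := [set` `](a - d) / c, (b - d) / c]].
pose I : set R := [set` `]a, b]].
transitivity (c%:E * mu J)%E; last first.
  rewrite -[RHS]/(c%:E * mu (affine c d @^-1` I))%E; congr (_ * mu _)%E.
  apply/seteqP; split => x; rewrite /I /J /= !in_itv /= ltr_pdivrMr// ler_pdivlMr// /affine.
    by move=> /andP[? ?]; apply/andP; split; lra.
  by move=> /andP[? ?]; apply/andP; split; lra.
rewrite /J !lebesgue_measure_itv /= !lte_fin ltr_pM2r ?invr_gt0// ltrBlDr subrK.
case: ifPn => ab; last by rewrite mule0.
rewrite -!EFinD -EFinM; congr (_%:E); rewrite -mulrBl mulrC divfK ?gt_eqF//.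
by ring.
Qed.

Lemma ge0_integral_affine (c d : R) (f : R -> \bar R) : 0 < c ->
  measurable_fun setT f -> (forall x, 0 <= f x)%E ->
  (\int[mu]_x f x = c%:E * \int[mu]_x f (c * x + d)%R)%E.
Proof.
move=> c0 mf f0.
have := @ge0_integral_pushforward _ _ _ _ R _ (measurable_affine c d) mu setT f measurableT mf.
move=> /(_ (fun y _ => f0 y)); rewrite preimage_setT => <-.
rewrite -(@ge0_integral_mscale _ _ _ (pushforward mu (affine c d)) _ measurableT (NngNum (ltW c0)))//.
apply: eq_measure_integral => A mA _; apply/esym.
exact: (lebesgue_measure_affine d c0 mA).
Qed.

End Affine.

Section Beta.
Variable R : realType.
Local Notation mu := (@lebesgue_measure R).

(** Extending the integrands by 0 to the whole line lets affine substitutions act without changing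
    the domain. *)
Definition gammaf (z t : R) : R := if 0 < t then t `^ (z - 1) * expR (- t) else 0.

Definition betaf (a x : R) : R := if x ^+ 2 < 1 then (1 - x ^+ 2) `^ a else 0.

Let kernel (a : R) (p : measurableTypeR R * measurableTypeR R) : R :=
  if p.2 ^+ 2 < p.1 then (p.1 - p.2 ^+ 2) `^ a * expR (- p.1) else 0.

Lemma gammaf_ge0 z t : 0 <= gammaf z t.
Proof. by rewrite /gammaf; case: ifP => // _; rewrite mulr_ge0 ?powR_ge0 ?expR_ge0. Qed.

Lemma betaf_ge0 a x : 0 <= betaf a x.
Proof. by rewrite /betaf; case: ifP => // _; exact: powR_ge0. Qed.

Let kernel_ge0 a p : 0 <= kernel a p.
Proof. by rewrite /kernel; case: ifP => // _; rewrite mulr_ge0 ?powR_ge0 ?expR_ge0. Qed.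

Lemma measurable_gammaf z : measurable_fun setT (gammaf z).
Proof.
apply: measurable_fun_ifT => //; first exact: measurable_fun_ltr.
apply: measurable_funM; first exact: measurable_powR.
by apply: measurableT_comp => //; exact: measurable_expR.
Qed.

Lemma measurable_betaf a : measurable_fun setT (betaf a).
Proof.
have m2 : measurable_fun setT (fun x : R => x ^+ 2) by exact: measurable_funX.
apply: measurable_fun_ifT => //; first exact: measurable_fun_ltr.
exact: (measurableT_comp (@measurable_powR R a) (measurable_funB (measurable_cst (1 : R)) m2)).
Qed.

Let measurable_kernel a : measurable_fun setT (kernel a).
Proof.
have m1 : measurable_fun setT (fun p : measurableTypeR R * measurableTypeR R => p.1 : R).
  exact: measurable_fst.
have m2 : measurable_fun setT (fun p : measurableTypeR R * measurableTypeR R => (p.2 : R) ^+ 2).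
  exact: (measurable_funX 2 (@measurable_snd _ _ (measurableTypeR R) (measurableTypeR R))).
apply: measurable_fun_ifT => //; first exact: measurable_fun_ltr.
apply: measurable_funM.
  exact: (measurableT_comp (@measurable_powR R a) (measurable_funB m1 m2)).
exact: (measurableT_comp (@measurable_expR R) (measurable_funN m1)).
Qed.

(* Integrating (t - y^2)^a e^(-t) over y^2 < t in either order: y = x sqrt t
   in the inner integral gives the left-hand side, t = s + y^2 the right one. *)
Lemma beta_gamma_gauss (a : R) :
  (\int[mu]_x (betaf a x)%:E * \int[mu]_t (gammaf (a + 2^-1 + 1) t)%:E =
   (Num.sqrt pi)%:E * \int[mu]_t (gammaf (a + 1) t)%:E)%E.
Proof.
have mK : measurable_fun setT (EFin \o kernel a) by exact/measurable_EFinP.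
have K0 p : (0 <= (EFin \o kernel a) p)%E by rewrite lee_fin.
have := @fubini_tonelli _ _ (measurableTypeR R) (measurableTypeR R) R mu mu _ mK K0.
have inner1 t : (\int[mu]_y (EFin \o kernel a) (t, y) =
    \int[mu]_x (betaf a x)%:E * (gammaf (a + 2^-1 + 1) t)%:E)%E.
  have [t0|t0] := ltP 0 t; last first.
    rewrite /gammaf ltNge t0 /= mule0; apply: integral0_eq => y _ /=.
    by rewrite /kernel /= ltNge (le_trans t0) ?sqr_ge0.
  have st : 0 < Num.sqrt t by rewrite sqrtr_gt0.
  rewrite (@ge0_integral_affine R (Num.sqrt t) 0)//; last first.
    by apply: measurableT_comp => //; exact: measurable_pair1.
  rewrite [X in (_ * X)%E](_ : _ =
      (\int[mu]_x ((t `^ a * expR (- t))%:E * (betaf a x)%:E))%E); last first.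
    apply: eq_integral => x _; rewrite /= /kernel /betaf /= addr0 exprMn sqr_sqrtr ?ltW//.
    have -> : (t * x ^+ 2 < t) = (x ^+ 2 < 1) by rewrite -[ltRHS]mulr1 ltr_pM2l.
    have -> : t - t * x ^+ 2 = t * (1 - x ^+ 2) by ring.
    rewrite -EFinM; case: ifPn => x1; last by rewrite mulr0.
    by rewrite powRM ?ltW ?subr_gt0//; congr _%:E; ring.
  rewrite ge0_integralZl//; last 3 first.
  - by apply/measurable_EFinP; exact: measurable_betaf.
  - by move=> x _; rewrite lee_fin betaf_ge0.
  - by rewrite lee_fin mulr_ge0 ?powR_ge0 ?expR_ge0.
  rewrite muleA -EFinM muleC /gammaf t0 addrK powRD; last by rewrite (gt_eqF t0) implybT.
  by rewrite powR12_sqrt ?ltW//; congr (_ * _%:E)%E; ring.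
under eq_integral do rewrite inner1.
rewrite ge0_integralZl//; last 3 first.
- by apply/measurable_EFinP; exact: measurable_gammaf.
- by move=> x _; rewrite lee_fin gammaf_ge0.
- by apply: integral_ge0 => x _; rewrite lee_fin betaf_ge0.
move=> ->.
have inner2 y : (\int[mu]_t (EFin \o kernel a) (t, y) =
    (gauss_fun y)%:E * \int[mu]_t (gammaf (a + 1) t)%:E)%E.
  rewrite (@ge0_integral_affine R 1 (y ^+ 2))//; last first.
    by apply: measurableT_comp => //; exact: measurable_pair2.
  rewrite mul1e -ge0_integralZl//; last 3 first.
  - by apply/measurable_EFinP; exact: measurable_gammaf.
  - by move=> x _; rewrite lee_fin gammaf_ge0.
  - by rewrite lee_fin gauss_fun_ge0.
  apply: eq_integral => t _; rewrite /= /kernel /gammaf /gauss_fun /= mul1r -EFinM.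
  rewrite ltrDr addrK addrK; case: ifP => _; last by rewrite mulr0.
  by rewrite opprD expRD; congr _%:E; ring.
under eq_integral do rewrite inner2.
rewrite ge0_integralZr// ?integralT_gauss//.
- by apply/measurable_EFinP; exact: measurable_gauss_fun.
- by move=> x _; rewrite lee_fin gauss_fun_ge0.
- by apply: integral_ge0 => x _; rewrite lee_fin gammaf_ge0.
Qed.

End Beta.

(** * Integration of polynomials against (1 - x^2)^a *)

Section Moments.
Variable R : realType.
Local Notation mu := (@lebesgue_measure R).

Let I : set R := `]-1, 1[%classic.

Lemma itv_sqr_lt1 (x : R) : (-1 < x < 1) = (x ^+ 2 < 1).
Proof. by rewrite -ltr_norml -[in RHS](expr1n _ 2) -real_normK ?num_real// ltr_pXn2r// nnegrE. Qed.

Lemma horner_bounded (p : {poly R}) (x : R) : `|x| <= 1 -> `|p.[x]| <= \sum_(i < size p) `|p`_i|.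
Proof.
move=> x1; rewrite horner_coef; apply: le_trans (ler_norm_sum _ _ _) _.
apply: ler_sum => i _; rewrite normrM normrX ler_piMr//.
by rewrite exprn_ile1.
Qed.

Lemma is_derive_weight_poly (a x : R) (p : {poly R}) : -1 < x < 1 ->
  is_derive x 1 (fun y : R => (1 - y ^+ 2) `^ a * p.[y])
    ((1 - x ^+ 2) `^ (a - 1) * ((1 - 'X ^+ 2) * p^`() - (2 * a) *: ('X * p)).[x]).
Proof.
rewrite itv_sqr_lt1 => x1; have x0 : 0 < 1 - x ^+ 2 by rewrite subr_gt0.
have d1 : is_derive x 1 (fun y : R => 1 - y ^+ 2) (- (2 * x)).
  apply: is_derive_eq.
  by rewrite -![_ *: _]/(_ * _); ring.
have d2 := is_derive1_powR a x0.
have d3 := @is_derive1_comp _ (fun z => z `^ a) (fun y : R => 1 - y ^+ 2) _ _ _ d2 d1.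
have d4 := is_derive_poly p x.
have d5 := is_deriveM d3 d4.
apply: (is_derive_eq d5).
rewrite !hornerE /= -![_ *: _]/(_ * _).
have -> : (1 - x ^+ 2) `^ a = (1 - x ^+ 2) * (1 - x ^+ 2) `^ (a - 1).
  rewrite -{2}[1 - x ^+ 2]powRr1 ?ltW//.
  by rewrite -powRD ?(gt_eqF x0) ?implybT// [1 + (a - 1)]addrC subrK.
by ring.
Qed.

Lemma weight_poly_continuous (a x : R) (p : {poly R}) : -1 < x < 1 ->
  {for x, continuous (fun y : R => (1 - y ^+ 2) `^ a * p.[y])}.
Proof.
move=> x1; apply: differentiable_continuous; apply/derivable1_diffP.
by have [] := @is_derive_weight_poly a x p x1.
Qed.

Section Finite.
Variable a : R.
Hypothesis betaf_fin : (\int[mu]_x (betaf a x)%:E < +oo)%E.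

(** A polynomial is bounded on (-1, 1), so finiteness of the beta integral is all that is
    required. *)
Lemma weight_poly_integrable (p : {poly R}) :
  mu.-integrable I (EFin \o (fun x : R => (1 - x ^+ 2) `^ a * p.[x])).
Proof.
have iI : mu.-integrable I (EFin \o betaf a).
  apply: (@integrableS _ _ _ _ setT) => //; first exact: measurable_itv.
  apply/integrableP; split; first by apply/measurable_EFinP; exact: measurable_betaf.
  under eq_integral do rewrite /= ger0_norm ?betaf_ge0//.
  exact: betaf_fin.
have := @integrableMl _ _ _ mu I (measurable_itv _) (EFin \o betaf a) (horner p) iI.
move=> /(_ (@measurable_poly R p I)) int.
apply: eq_integrable (int _); first exact: measurable_itv.
  move=> x; rewrite inE /= /I /= in_itv /= itv_sqr_lt1 /betaf => ->.
  by rewrite EFinM.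
exists (\sum_(i < size p) `|p`_i|); split; first exact: num_real.
move=> M Mb x; rewrite /I /= in_itv /= -ltr_norml => x1.
by apply: le_trans (ltW Mb); apply: horner_bounded; exact: ltW.
Qed.

(** The interval stays away from the endpoints because the integrand is unbounded there when a <
    0. *)
Lemma FTC_truncated (p : {poly R}) (r : R) : 0 < r < 1 ->
  (\int[mu]_(x in `[(- r)%R, r]) ((1 - x ^+ 2) `^ a *
     ((1 - 'X ^+ 2) * p^`() - (2 * (a + 1)) *: ('X * p)).[x])%:E =
   ((1 - r ^+ 2) `^ (a + 1) * (p.[r] - p.[- r]))%:E)%E.
Proof.
move=> /andP[r0 r1].
have sub x : - r <= x <= r -> -1 < x < 1.
  by move=> /andP[? ?]; apply/andP; split; lra.
rewrite (@continuous_FTC2 _ _ (fun x : R => (1 - x ^+ 2) `^ (a + 1) * p.[x])).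
- by rewrite -EFinB sqrrN mulrBr.
- by lra.
- apply: continuous_in_subspaceT => x; rewrite inE /= in_itv /= => /sub.
  exact: weight_poly_continuous.
- have c x : - r <= x <= r -> {for x, continuous (fun y : R => (1 - y ^+ 2) `^ (a + 1) * p.[y])}.
    by move=> /sub; exact: weight_poly_continuous.
  split.
  + move=> x; rewrite in_itv /= => /andP[xr rx].
    have [] := @is_derive_weight_poly (a + 1) x p; last by [].
    by apply: sub; rewrite !ltW.
  + by apply: cvg_at_right_filter; apply: c; rewrite lexx /=; lra.
  + by apply: cvg_at_left_filter; apply: c; rewrite lexx andbT; lra.
- move=> x; rewrite in_itv /= => /andP[xr rx].
  rewrite derive1E; have [|_ ->] := @is_derive_weight_poly (a + 1) x p.
    by apply: sub; rewrite !ltW.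
  by rewrite addrK.
Qed.

(** Exhaustion by [-r, r] with r tending to 1: dominated convergence handles the integrals, and the
    boundary terms contain (1 - r^2)^(a+1), which tends to 0 as a > -1. *)
Lemma integral_weight_deriv (p : {poly R}) : -1 < a ->
  \int[mu]_(x in I) ((1 - x ^+ 2) `^ a *
     ((1 - 'X ^+ 2) * p^`() - (2 * (a + 1)) *: ('X * p)).[x]) = 0.
Proof.
move=> a1; set q := (1 - 'X ^+ 2) * p^`() - _.
pose f (x : R) := (1 - x ^+ 2) `^ a * q.[x].
have intf := weight_poly_integrable q.
have mI : measurable I by exact: measurable_itv.
have mf : measurable_fun I (EFin \o f) by case/integrableP : intf.
pose r (n : nat) : R := 1 - n.+2%:R^-1.
have r01 n : 0 < r n < 1.
  rewrite subr_gt0 invf_lt1 ?ltr0n// ltr1n /= ltrBlDr ltrDl invr_gt0 ltr0n//.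
pose D n : set R := `[- r n, r n]%classic.
have DI n : D n `<=` I.
  move=> x; rewrite /D /I /= !in_itv /= => /andP[? ?]; have /andP[? ?] := r01 n.
  by apply/andP; split; lra.
pose f_ n : R -> \bar R := (EFin \o f) \_ (D n).
have mD n : measurable (D n) by exact: measurable_itv.
have mf_ n : measurable_fun I (f_ n).
  apply/(measurable_restrict _ (mD n) mI).
  by apply: measurable_funS mf => //; apply: subIsetl.
have r_cvg : r n @[n --> \oo] --> (1 : R).
  rewrite -[X in _ --> X]subr0; apply: cvgB; first exact: cvg_cst.
  have : @harmonic R n.+1 @[n --> \oo] --> (0 : R) by rewrite cvg_shiftS; exact: cvg_harmonic.
  exact.
have f_f : {ae mu, forall x, I x -> f_ ^~ x @ \oo --> (EFin \o f) x}.
  apply: aeW => x; rewrite /I /= in_itv /= -ltr_norml => x1.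
  apply: cvg_near_cst; near=> n; rewrite /f_ patchE mem_set// /D /= in_itv /= -ler_norml.
  by apply: ltW; near: n; exact: (cvgr_gt _ r_cvg).
have f_g : {ae mu, forall x n, I x -> (`|f_ n x| <= (abse \o (EFin \o f)) x)%E}.
  apply: aeW => x n _; rewrite /f_ patchE /=; case: ifP => // _.
  by rewrite abse0 lee_fin.
have [_ _] := @dominated_convergence _ (measurableTypeR R) R mu I mI f_ (EFin \o f) _
  mf_ mf f_f (integrable_abse intf) f_g.
have intE n : (\int[mu]_(x in I) f_ n x)%E =
    ((1 - r n ^+ 2) `^ (a + 1) * (p.[r n] - p.[- r n]))%:E.
  rewrite -FTC_truncated// /f_ -integral_mkcondr; congr (integral _ _ _).
  by apply: setIidr.
under eq_fun do rewrite intE.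
have lim0 : ((1 - r n ^+ 2) `^ (a + 1) * (p.[r n] - p.[- r n])) @[n --> \oo] --> (0 : R).
  rewrite -(mul0r (p.[1] - p.[- 1])); apply: cvgM.
    have /cvg_at_rightP := @powR_cvg0 R (a + 1) ltac:(lra).
    apply; split=> [n|].
      have /andP[? ?] := r01 n; have : r n ^+ 2 < 1; last by rewrite subr_gt0.
      by rewrite -itv_sqr_lt1; apply/andP; split; lra.
    rewrite -[X in _ --> X](subrr (1 : R)) -[X in _ --> _ - X](expr1n R 2).
    by apply: cvgB; [exact: cvg_cst|rewrite expr2; under eq_fun do rewrite expr2; exact: cvgM].
  apply: cvgB; first exact: (continuous_cvg _ (@continuous_horner _ p 1) r_cvg).
  apply: (continuous_cvg _ (@continuous_horner _ p (- 1))); exact: cvgN.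
move=> h.
rewrite /Rintegral; suff -> : (\int[mu]_(x in I) (f x)%:E = 0)%E by [].
apply: (cvg_unique _ h) => //.
by apply: cvg_EFin; [exact: nearW|exact: lim0].
Unshelve. all: end_near. Qed.

End Finite.
End Moments.

(** * The beta integral as a quotient of Gamma values *)

Section GammaValue.
Variable R : realType.
Local Notation mu := (@lebesgue_measure R).

Lemma Gamma_fine (z : R) : Gamma z = fine (\int[mu]_t (gammaf z t)%:E)%E.
Proof.
rewrite /Gamma Rintegral_mkcond /Rintegral; congr fine; apply: eq_integral => t _.
congr _%:E; rewrite patchE /gammaf (_ : (t \in _) = (0 < t))//.
by apply/idP/idP; rewrite inE /= in_itv /= andbT.
Qed.

(** Raise 1 + y <= exp y at y = t / (2 nu) to the power nu. *)
Lemma powR_le_expR (nu t : R) : 0 < nu -> 0 <= t ->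
  t `^ nu <= (2 * nu) `^ nu * expR (t / 2).
Proof.
move=> nu0 t0; have n2 : 0 < 2 * nu by rewrite mulr_gt0.
have -> : t / 2 = t / (2 * nu) * nu by field; rewrite gt_eqF.
have -> : t `^ nu = (2 * nu) `^ nu * (t / (2 * nu)) `^ nu.
  by rewrite -powRM ?divr_ge0// ?ltW// mulrC divfK// gt_eqF.
rewrite ler_pM2l ?powR_gt0//.
rewrite expRM; apply: ge0_ler_powR; rewrite ?nnegrE ?expR_ge0 ?divr_ge0 ?(ltW nu0) ?(ltW n2)//.
by apply: le_trans (expR_ge1Dx _); rewrite lerDr.
Qed.

Lemma gamma_integral_fin (nu : R) : 0 < nu -> (\int[mu]_t (gammaf (nu + 1) t)%:E < +oo)%E.
Proof.
(* The exponential density of rate 1/2 is exp(- t / 2) / 2, whence the factor 2. *)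
move=> nu0; pose C : R := 2 * (2 * nu) `^ nu.
have C0 : 0 <= C by rewrite mulr_ge0 ?powR_ge0.
have mpdf : measurable_fun setT (fun t => (exponential_pdf (2^-1 : R) t)%:E).
  by apply/measurable_EFinP; exact: measurable_exponential_pdf.
apply: (@le_lt_trans _ _ (\int[mu]_t (C%:E * (exponential_pdf (2^-1 : R) t)%:E))%E).
  apply: ge0_le_integral => //.
  - by move=> t _; rewrite lee_fin gammaf_ge0.
  - by apply/measurable_EFinP; exact: measurable_gammaf.
  - by apply: emeasurable_funM => //; exact: measurable_cst.
  - move=> t _; rewrite -EFinM lee_fin /gammaf addrK; case: ifPn => t0; last first.
      by rewrite mulr_ge0// exponential_pdf_ge0.
    rewrite exponential_pdfE; last exact: ltW.
    apply: (@le_trans _ _ ((2 * nu) `^ nu * expR (t / 2) * expR (- t))).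
      by rewrite ler_pM2r ?expR_gt0//; apply: powR_le_expR => //; exact: ltW.
    rewrite -mulrA -expRD /C (_ : t / 2 - t = - 2^-1 * t); last by field.
    by rewrite [leRHS](_ : _ = (2 * nu) `^ nu * expR (- 2^-1 * t))//; field.
rewrite ge0_integralZl//; last by move=> t _; rewrite lee_fin exponential_pdf_ge0.
by rewrite integral_exponential_pdf// mule1 ltry.
Qed.

(** On [1, 2] the integrand is at least exp(-2). *)
Lemma gamma_integral_gt0 (nu : R) : 0 < nu -> (0 < \int[mu]_t (gammaf (nu + 1) t)%:E)%E.
Proof.
move=> nu0; pose c : R := expR (- 2).
have c0 : 0 < c by rewrite expR_gt0.
have mI : measurable (`[1, 2]%classic : set R) by exact: measurable_itv.
apply: (@lt_le_trans _ _ (\int[mu]_(t in `[1%R, 2%R]) c%:E)%E).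
  rewrite integral_cst//= lebesgue_measure_itv /= lte_fin ltr1n.
  by rewrite -EFinD -EFinM lte_fin mulr_gt0//; lra.
apply: (@le_trans _ _ (\int[mu]_(t in `[1%R, 2%R]) (gammaf (nu + 1) t)%:E)%E); last first.
  apply: ge0_subset_integral => //.
    by apply/measurable_EFinP; exact: measurable_gammaf.
  by move=> t _; rewrite lee_fin gammaf_ge0.
apply: ge0_le_integral => //.
- by move=> t _; rewrite lee_fin ltW.
- by apply/measurable_EFinP; apply: measurable_funS (measurable_gammaf _).
move=> t; rewrite /= in_itv /= => /andP[t1 t2]; rewrite lee_fin /gammaf addrK.
rewrite (lt_le_trans _ t1)// -[c]mul1r; apply: ler_pM => //; first exact: ltW.
  have <- : (1 : R) `^ nu = 1 by rewrite powR1.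
  apply: ge0_ler_powR; rewrite ?nnegrE ?(ltW nu0)//.
  exact: le_trans t1.
by rewrite ler_expR; lra.
Qed.

(** Finiteness of the integral for Gamma (nu + 1/2) is deduced, not assumed: in [beta_gamma_gauss]
    the product on the left is finite. Division is then possible since the integral for Gamma (nu +
    1) is positive. *)
Lemma beta_value (nu : R) : 0 < nu -> (\int[mu]_x (betaf (nu - 2^-1) x)%:E < +oo)%E ->
  (\int[mu]_x (betaf (nu - 2^-1) x)%:E =
    (Num.sqrt pi * (Gamma (nu + 2^-1) / Gamma (nu + 1)))%:E)%E.
Proof.
move=> nu0 Bfin; have := beta_gamma_gauss (nu - 2^-1).
rewrite subrK !Gamma_fine (_ : nu - 2^-1 + 1 = nu + 2^-1); last by field.
have G1 := gamma_integral_fin nu0; have G0 := gamma_integral_gt0 nu0.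
have B0 : (0 <= \int[mu]_x (betaf (nu - 2^-1) x)%:E)%E.
  by apply: integral_ge0 => x _; rewrite lee_fin betaf_ge0.
have H0 : (0 <= \int[mu]_x (gammaf (nu + 2^-1) x)%:E)%E.
  by apply: integral_ge0 => x _; rewrite lee_fin gammaf_ge0.
have s0 : 0 < Num.sqrt (pi : R) by rewrite sqrtr_gt0 pi_gt0.
move: B0 Bfin G0 G1 H0.
case: (\int[mu]_x (betaf _ x)%:E)%E => [b| |]// _ _.
case: (\int[mu]_x (gammaf (nu + 1) x)%:E)%E => [g| |]// g0 _.
case: (\int[mu]_x (gammaf (nu + 2^-1) x)%:E)%E => [h| |]// _; last first.
  by rewrite -EFinM gt0_muley// lte_fin.
rewrite -!EFinM => -[E] /=; congr _%:E.
rewrite lte_fin in g0.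
by rewrite mulrA -E mulfK// gt_eqF.
Qed.

End GammaValue.

(** * The given weight in terms of [wpol] *)

Section WeightEntry.
Variable R : realType.
Implicit Types (nu x : R).

(** The hypergeometric series terminates because (-n)_k = 0 for k > n. *)
Lemma gegenbauerE nu n x : 0 < nu -> gegenbauer nu n x = (gegp nu n).[x].
Proof.
move=> nu0; rewrite /gegenbauer /hyp2F1 /gegp horner_comp.
have -> : (2^-1 *: (1 - 'X)).[x] = 2^-1 * (1 - x) by rewrite !hornerE.
set z := 2^-1 * (1 - x).
set u := fun k : nat => _ * z ^+ k.
have u0 k : (n < k)%N -> u k = 0.
  by move=> nk; rewrite /u pochN ffact_small// mulr0 !mul0r.
have -> : limn (series u) = \sum_(k < n.+1) u k.
  apply/cvg_lim => //; apply: cvg_near_cst; exists n.+1 => // m /= nm.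
  rewrite /series /= (@big_cat_nat _ _ _ n.+1)//= big_mkord.
  rewrite [X in _ + X](_ : _ = 0) ?addr0// big_nat.
  by apply: big1 => k /andP[nk _]; exact: u0.
rewrite /gegz horner_poly mulr_sumr; apply: eq_bigr => k _.
rewrite /u /geg_coef pochN pochD [2 * nu + _]addrC.
have f := fact_neq0 R.
have p0 : poch (nu + 2^-1) k != 0 by rewrite poch_neq0// addr_gt0// invr_gt0.
by field; rewrite p0 !f.
Qed.

Lemma lfactN (a : R) t : poch (- a) t = (-1) ^+ t * lfact a t.
Proof.
elim: t => [|t IH]; first by rewrite poch0 lfact0 mulr1.
by rewrite pochSr lfactSr IH exprS; ring.
Qed.

(** The signs (-1)^(i+t), (-1)^i and (-1)^t, from the prefactor and the two Pochhammer symbols of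
    negative argument, cancel. *)
Lemma alphaE N nu t i j : 0 < nu -> (i + t <= j + t)%N -> (j + t <= N)%N ->
  alpha N nu t (i + t) (j + t) = alphaD N nu t i j.
Proof.
move=> nu0 ij jN; rewrite /alpha /alphaD !addnK.
rewrite (_ : i + t + (j + t) - 2 * t = i + j)%N; last lia.
rewrite (_ : j + t + (i + t) - 2 * t = i + j)%N; last lia.
rewrite (_ : j + t + (i + t) - t = i + j + t)%N; last lia.
rewrite (_ : (j + t)%:R - N%:R = - (N - (j + t))%:R :> R); last by rewrite natrB// opprB.
rewrite -opprD pochN lfactN exprD pochSr !natrM ?natrD.
have s k : (-1) ^+ k * (-1) ^+ k = 1 :> R by rewrite -expr2 sqrr_sign.
set rhs := (X in _ = X); transitivity ((-1) ^+ i * (-1) ^+ i * ((-1) ^+ t * (-1) ^+ t) * rhs).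
  rewrite /rhs {rhs s}.
  have f := fact_neq0 R.
  have p1 := poch_neq0 (i + j) (mulr_gt0 (ltr0n R 2) nu0).
  have p2 := poch_neq0 (i + j + t) nu0.
  have i0 := ler0n R i; have j0 := ler0n R j; have t0 := ler0n R t.
  move: ((-1) ^+ i) ((-1) ^+ t) (lfact _ _) => si st l.
  move: p1 p2 (f N) (f i) (f j) (f t).
  move: (poch (2 * nu) _) (poch nu (i + j + t)) (poch nu i) (poch nu j) => q1 q2 q3 q4.
  move: (N`!%:R) (i`!%:R) (j`!%:R) (t`!%:R) ((i + t)`!%:R : R) ((j + t)`!%:R : R)
    ((i + j)`!%:R : R) ((N - (i + t))`!%:R : R) (((N - (j + t)) ^_ i)%:R : R).
  move=> fN fi fj ft fit fjt fij fa fb ? ? ? ? ? ?.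
  by field; nonzero.
by rewrite !s !mul1r.
Qed.

(** The summation ranges differ only in zero terms: for t > m the coefficient is out of range, and
    for t < m + n - N the falling factorial in [alphaD] vanishes since N - n < m - t. *)
Lemma weight_entryE N nu m n x : 0 < nu -> (m <= n)%N -> (n <= N)%N ->
  weight_entry N nu m n x = (1 - x ^+ 2) `^ (nu - 2^-1) * (wpol N nu m n).[x].
Proof.
move=> nu0 mn nN; rewrite /weight_entry /wpol horner_sum; congr (_ * _).
pose g t := (alphas N nu t m n *: gegp nu (m + n - 2 * t)).[x].
rewrite -(big_mkord predT g) [RHS](@big_cat_nat _ _ _ m.+1)//=; last lia.
rewrite [X in _ = _ + X](_ : _ = 0) ?addr0; last first.
  rewrite big_nat; apply: big1 => t /andP[mt _].
  by rewrite /g alphas_gt ?mt// scale0r horner0.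
rewrite [RHS](@big_cat_nat _ _ _ (n + m - N))//=; last lia.
rewrite [X in _ = X + _](_ : _ = 0) ?add0r; last first.
  rewrite big_nat; apply: big1 => t /= tl.
  have e1 : m = (m - t + t)%N by lia.
  have e2 : n = (n - t + t)%N by lia.
  rewrite /g {1}e1 {1}e2 alphasE /alphaD ffact_small; last lia.
  by rewrite mulr0 !mul0r scale0r horner0.
apply: eq_big_nat => t /andP[_]; rewrite ltnS => tm.
have e1 : m = (m - t + t)%N by lia.
have e2 : n = (n - t + t)%N by lia.
rewrite /g hornerZ gegenbauerE//; congr (_ * _).
rewrite e1 e2 alphasE alphaE//; lia.
Qed.

Lemma weightE N nu (i j : 'I_N.+1) x : 0 < nu ->
  weight N nu x i j = (1 - x ^+ 2) `^ (nu - 2^-1) * (wpol N nu i j).[x].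
Proof.
move=> nu0; rewrite mxE; case: leqP => ij.
  by rewrite weight_entryE// -ltnS.
rewrite weight_entryE ?(ltnW ij)//; last by rewrite -ltnS.
by rewrite wpolC// -ltnS.
Qed.

End WeightEntry.

(** * Orthogonal polynomials over a noncommutative ring *)

Section MomentFunctional.
Variable M : unitRingType.
Implicit Types (mm : nat -> M) (p q : {poly M}).

(** Stands for the integral of p W; the coefficients stay on the left because they do not commute
    with the moments. *)
Definition momval mm p : M := \sum_(i < size p) p`_i * mm i.

Lemma momvalE mm p n : (size p <= n)%N -> momval mm p = \sum_(i < n) p`_i * mm i.
Proof.
move=> pn; rewrite /momval -(big_mkord predT (fun i => p`_i * mm i)).
rewrite -(big_mkord predT (fun i => p`_i * mm i)) (@big_cat_nat _ _ _ (size p) 0 n)//=.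
rewrite [X in _ = _ + X](_ : _ = 0) ?addr0// big_nat.
by apply: big1 => i /andP[pi _]; rewrite nth_default// mul0r.
Qed.

Lemma momvalD mm p q : momval mm (p + q) = momval mm p + momval mm q.
Proof.
rewrite (@momvalE mm p (maxn (size p) (size q))) ?leq_maxl//.
rewrite (@momvalE mm q (maxn (size p) (size q))) ?leq_maxr//.
rewrite (momvalE _ (size_polyD p q)) -big_split /=; apply: eq_bigr => i _.
by rewrite coefD mulrDl.
Qed.

Lemma momval0 mm : momval mm 0 = 0.
Proof. by rewrite /momval size_poly0 big_ord0. Qed.

Lemma momvalZ mm (a : M) p : momval mm (a%:P * p) = a * momval mm p.
Proof.
rewrite (@momvalE _ (a%:P * p) (size p)); last by rewrite mul_polyC size_scale_leq.
by rewrite mulr_sumr; apply: eq_bigr => i _; rewrite coefCM mulrA.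
Qed.

Lemma momvalN mm p : momval mm (- p) = - momval mm p.
Proof. by apply/eqP; rewrite -addr_eq0 -momvalD addNr momval0. Qed.

Lemma momvalB mm p q : momval mm (p - q) = momval mm p - momval mm q.
Proof. by rewrite momvalD momvalN. Qed.

Lemma momval_sum mm I (r : seq I) (F : I -> {poly M}) :
  momval mm (\sum_(i <- r) F i) = \sum_(i <- r) momval mm (F i).
Proof.
by elim/big_rec2: _ => [|i x y _ <-]; rewrite ?momval0 ?momvalD.
Qed.

Lemma momvalMn mm p k : momval mm (p *+ k) = momval mm p *+ k.
Proof. by elim: k => [|k IH]; rewrite ?mulr0n ?momval0// !mulrS momvalD IH. Qed.

Lemma momval_monomial mm (a : M) k : momval mm (a%:P * 'X^k) = a * mm k.
Proof.
rewrite momvalZ; congr (_ * _); rewrite (@momvalE _ _ k.+1) ?size_polyXn//.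
rewrite big_ord_recr /= coefXn eqxx mul1r big1 ?add0r// => i _.
by rewrite coefXn ltn_eqF ?mul0r.
Qed.

Lemma poly_monomials p : p = \sum_(i < size p) (p`_i)%:P * 'X^i.
Proof.
by rewrite -[LHS]coefK poly_def; apply: eq_bigr => i _; rewrite mul_polyC.
Qed.

Variable st : M -> M.
Hypothesis stD : {morph st : x y / x + y}.
Hypothesis stM : forall x y, st (x * y) = st y * st x.
Hypothesis stK : involutive st.

Let st0 : st 0 = 0.
Proof. by apply: (addrI (st 0)); rewrite -stD !addr0. Qed.

Let stN x : st (- x) = - st x.
Proof. by apply: (addrI (st x)); rewrite -stD !subrr st0. Qed.

Let st1 : st 1 = 1.
Proof. by rewrite -[LHS]mulr1 -{2}[1]stK -stM mulr1 stK. Qed.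

Let st_sum I (r : seq I) (P : pred I) (F : I -> M) :
  st (\sum_(i <- r | P i) F i) = \sum_(i <- r | P i) st (F i).
Proof. exact: (big_morph st stD st0). Qed.

(** Stands for the integral of p W times the adjoint of q. *)
Definition pairing mm p q : M :=
  \sum_(i < size p) \sum_(j < size q) p`_i * mm (i + j)%N * st q`_j.

Lemma momval_mulXn mm p k : momval mm (p * 'X^k) = \sum_(i < size p) p`_i * mm (i + k)%N.
Proof.
rewrite {1}[p]poly_monomials mulr_suml.
rewrite (eq_bigr (fun i : 'I_(size p) => (p`_i)%:P * 'X^(i + k))); last first.
  by move=> i _; rewrite -mulrA exprD.
by rewrite momval_sum; apply: eq_bigr => i _; rewrite momval_monomial.
Qed.

Lemma pairingE mm p q n : (size q <= n)%N ->
  pairing mm p q = \sum_(j < n) momval mm (p * 'X^j) * st q`_j.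
Proof.
move=> qn; rewrite /pairing exchange_big /=.
transitivity (\sum_(j < size q) momval mm (p * 'X^j) * st q`_j).
  by apply: eq_bigr => j _; rewrite momval_mulXn mulr_suml.
rewrite -(big_mkord predT (fun j => momval mm (p * 'X^j) * st q`_j)).
rewrite -(big_mkord predT (fun j => momval mm (p * 'X^j) * st q`_j)).
rewrite (@big_cat_nat _ _ _ (size q) 0 n)//=.
rewrite [X in _ = _ + X](_ : _ = 0) ?addr0// big_nat.
by apply: big1 => i /andP[pi _]; rewrite nth_default// st0 mulr0.
Qed.

Lemma pairing_st mm p q : (forall k, st (mm k) = mm k) ->
  st (pairing mm p q) = pairing mm q p.
Proof.
move=> mmst; rewrite /pairing exchange_big st_sum; apply: eq_bigr => i _.
rewrite st_sum; apply: eq_bigr => j _.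
by rewrite !stM stK mmst mulrA addnC.
Qed.

Section Orthogonal.
Variables (mm : nat -> M) (P : nat -> {poly M}) (H : nat -> M).
Hypothesis mmst : forall k, st (mm k) = mm k.
Hypothesis sizeP : forall n, size (P n) = n.+1.
Hypothesis monP : forall n, P n \is monic.
Hypothesis unitH : forall n, H n \is a GRing.unit.
Hypothesis orthP : forall n m, pairing mm (P n) (P m) = if n == m then H n else 0.

Let leadP n : (P n)`_n = 1.
Proof. by have /monicP := monP n; rewrite /lead_coef sizeP. Qed.

(** P m is x^m plus lower terms, and by strong induction these pair to 0 with P n. *)
Lemma orth_momval n m : (m <= n)%N -> momval mm (P n * 'X^m) = if n == m then H n else 0.
Proof.
elim/ltn_ind: m => m IH mn; rewrite -orthP (@pairingE _ _ _ m.+1) ?sizeP//.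
rewrite big_ord_recr /= leadP st1 mulr1 big1 ?add0r// => i _.
have im := ltn_ord i.
by rewrite IH ?(leq_trans (ltnW im))// gtn_eqF ?mul0r// (leq_trans im).
Qed.

(** If p has degree k, then pairing p with P k gives 0, while the adjoint of this pairing is H k
    times the adjoint of the leading coefficient; H k is invertible. *)
Lemma orth_eq0 n p : (size p <= n)%N ->
  (forall b, (b < n)%N -> momval mm (p * 'X^b) = 0) -> p = 0.
Proof.
move=> pn pX; apply/eqP; apply: contraPT isT => p0 _.
have sp : (0 < size p)%N by rewrite size_poly_gt0.
have : pairing mm p (P (size p).-1) = 0.
  rewrite (@pairingE _ _ _ (size p)) ?sizeP ?prednK// big1// => i _.
  by rewrite pX ?mul0r// (leq_trans (ltn_ord i)).
rewrite -pairing_st// => /(congr1 st); rewrite stK st0.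
rewrite (@pairingE _ _ _ (size p).-1.+1) ?prednK//.
have [k sk] : exists k, size p = k.+1 by exists (size p).-1; rewrite prednK.
rewrite sk /= big_ord_recr /= orth_momval// eqxx big1 => [|i _]; last first.
  by rewrite orth_momval ?(ltnW (ltn_ord i))// (gtn_eqF (ltn_ord i)) mul0r.
rewrite add0r => E.
have /(congr1 st) : st p`_k = 0 by rewrite -[LHS](mulKr (unitH k)) E mulr0.
rewrite stK st0 => pk; move: p0; rewrite -lead_coef_eq0 /lead_coef sk /= pk.
by rewrite eqxx.
Qed.

Lemma orth_unique n p : (size p <= n.+1)%N ->
  (forall b, (b < n)%N -> momval mm (p * 'X^b) = 0) -> p = (p`_n)%:P * P n.
Proof.
move=> pn pX; apply/eqP; rewrite -subr_eq0; apply/eqP; apply: (@orth_eq0 n).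
  apply/leq_sizeP => j; rewrite leq_eqVlt => /orP[/eqP <-|nj].
    by rewrite coefB coefCM leadP mulr1 subrr.
  rewrite coefB coefCM [p`_j]nth_default ?(leq_trans pn)//.
  by rewrite [(P n)`_j]nth_default ?sizeP// mulr0 subrr.
move=> b bn; rewrite mulrBl momvalB pX// -mulrA momvalZ orth_momval 1?ltnW//.
by rewrite gtn_eqF// mulr0 subrr.
Qed.

End Orthogonal.

Section Ladder.
Variables (mm mm' : nat -> M) (P P' : nat -> {poly M}) (H H' : nat -> M).
Hypothesis mmst : forall k, st (mm k) = mm k.
Hypothesis sizeP : forall n, size (P n) = n.+1.
Hypothesis monP : forall n, P n \is monic.
Hypothesis unitH : forall n, H n \is a GRing.unit.
Hypothesis orthP : forall n m, pairing mm (P n) (P m) = if n == m then H n else 0.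
Hypothesis mmst' : forall k, st (mm' k) = mm' k.
Hypothesis sizeP' : forall n, size (P' n) = n.+1.
Hypothesis monP' : forall n, P' n \is monic.
Hypothesis unitH' : forall n, H' n \is a GRing.unit.
Hypothesis orthP' : forall n m, pairing mm' (P' n) (P' m) = if n == m then H' n else 0.
Variables F0 F1 F2 G0 G1 : M.
(** The moment form of the two Pearson relations, the second one after integrating by parts against
    x^k. At k = 0 its left side is 0, whatever the truncated index refers to. *)
Hypothesis mulF : forall k, mm' k = F0 * mm k + F1 * mm k.+1 + F2 * mm k.+2.
Hypothesis mulG : forall k, mm' k.-1 *+ k = - (G0 * mm k + G1 * mm k.+1).

(** Self-adjointness of the moments moves the Pearson matrices to their right, where they no longer
    interfere with the coefficients of p. *)
Let mulFr k : mm' k = mm k * st F0 + mm k.+1 * st F1 + mm k.+2 * st F2.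
Proof. by rewrite -mmst' mulF !stD !stM !mmst. Qed.

Let st_mulrn x k : st (x *+ k) = st x *+ k.
Proof. by elim: k => [|k IH]; rewrite ?mulr0n ?st0// !mulrS stD IH. Qed.

Let mulGr k : mm' k.-1 *+ k = - (mm k * st G0 + mm k.+1 * st G1).
Proof. by rewrite -(mmst' k.-1) -st_mulrn mulG stN !stD !stM !mmst. Qed.

Let momvalFr p : momval mm' p =
  momval mm p * st F0 + momval mm (p * 'X) * st F1 + momval mm (p * 'X^2) * st F2.
Proof.
rewrite -[p * 'X]/(p * 'X^1) !momval_mulXn /momval !mulr_suml -!big_split /=.
by apply: eq_bigr => i _; rewrite mulFr !mulrDr !mulrA addn1 addn2.
Qed.

Let momval_deriv_monomial a k : momval mm' (a%:P * 'X^k)^`() = a * (mm' k.-1 *+ k).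
Proof.
rewrite derivM derivC mul0r add0r derivXn mulrnAr momvalMn.
by rewrite momval_monomial mulrnAr.
Qed.

Let momval_deriv p : momval mm' p^`() = \sum_(i < size p) p`_i * (mm' i.-1 *+ i).
Proof.
rewrite {1}[p]poly_monomials raddf_sum momval_sum.
by apply: eq_bigr => i _; rewrite momval_deriv_monomial.
Qed.

Let momvalGr p : momval mm' p^`() = - (momval mm p * st G0 + momval mm (p * 'X) * st G1).
Proof.
rewrite momval_deriv -[p * 'X]/(p * 'X^1) !momval_mulXn /momval !mulr_suml -big_split -sumrN /=.
by apply: eq_bigr => i _; rewrite mulGr mulrN mulrDr !mulrA addn1.
Qed.

Let monomialM a b i j : (a%:P * 'X^i) * (b%:P * 'X^j) = (a * b)%:P * 'X^(i + j) :> {poly M}.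
Proof.
rewrite -mulrA ['X^i * _]mulrA -[_ * b%:P](commr_polyXn b%:P i).
by rewrite -mulrA -exprD mulrA polyCM.
Qed.

Definition pearsonF : {poly M} := F0%:P * 'X^0 + F1%:P * 'X^1 + F2%:P * 'X^2.
Definition pearsonG : {poly M} := G0%:P * 'X^0 + G1%:P * 'X^1.

Let momvalF p : momval mm (p * pearsonF) = momval mm' p.
Proof.
rewrite {1}[p]poly_monomials mulr_suml momval_sum; apply: eq_bigr => i _.
rewrite mulF !mulrDr !monomialM !momvalD !momval_monomial !mulrA.
by rewrite addn0 addn1 addn2.
Qed.

Let momvalG p : momval mm (p * pearsonG) = - momval mm' p^`().
Proof.
rewrite {1}[p]poly_monomials mulr_suml momval_sum momval_deriv -sumrN.
apply: eq_bigr => i _.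
rewrite mulG !mulrN opprK !mulrDr !monomialM !momvalD !momval_monomial !mulrA.
by rewrite addn0 addn1.
Qed.

Let derivMXn p b : (p * 'X^b)^`() = p^`() * 'X^b + (p * 'X^(b.-1)) *+ b.
Proof. by rewrite derivM derivXn mulrnAr. Qed.

(** By Leibniz, P' x^b is (P x^b)' - b P x^(b-1). G and F turn these into moments of P_(n+1) against
    powers up to x^(b+1), of which only x^(n+1) survives, so b = n. *)
Let deriv_orth n b : (b <= n)%N ->
  momval mm' (((P n.+1)^`()) * 'X^b) = if n == b then - (H n.+1 * (st G1 + st F2 *+ n)) else 0.
Proof.
move=> bn.
have o := orth_momval sizeP monP orthP.
have E : momval mm' (((P n.+1)^`()) * 'X^b) =
    momval mm' ((P n.+1 * 'X^b)^`()) - momval mm' (P n.+1 * 'X^(b.-1)) *+ b.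
  by rewrite derivMXn momvalD momvalMn addrK.
rewrite E momvalGr (o _ _ (leqW bn)) -mulrA -exprSr o// eqSS gtn_eqF ?ltnS//.
rewrite mul0r add0r.
have -> : momval mm' (P n.+1 * 'X^(b.-1)) *+ b = (if n == b then H n.+1 * st F2 else 0) *+ b.
  case: b bn {E} => [|b] bn; first by rewrite !mulr0n.
  have e1 : (n.+1 == b) = false by apply/eqP; lia.
  have e2 : (n.+1 == b.+1) = false by apply/eqP; lia.
  rewrite momvalFr /= -!mulrA -exprSr -exprD addn2 !o; try lia.
  by rewrite e1 e2 eqSS !mul0r !add0r; case: eqP; rewrite ?mul0r.
case: eqP => [->|_]; last by rewrite mul0r mul0rn subr0 oppr0.
by rewrite mulrDr opprD mulrnAr.
Qed.

Lemma ladder_deriv n : (P n.+1)^`() = P' n *+ n.+1.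
Proof.
have := @orth_unique mm' P' H' mmst' sizeP' monP' unitH' orthP' n (P n.+1)^`().
move=> ->.
- rewrite coef_deriv (_ : (P n.+1)`_n.+1 = 1); last first.
    by have /monicP := monP n.+1; rewrite /lead_coef sizeP.
  by rewrite polyCMn mulrnAl mul1r.
- apply/leq_sizeP => j nj.
  by rewrite coef_deriv nth_default ?mul0rn// sizeP.
- by move=> b bn; rewrite deriv_orth ?gtn_eqF// ltnW.
Qed.

Lemma ladder_norm n : H' n *+ n.+1 = - (H n.+1 * (st G1 + st F2 *+ n)).
Proof.
have := deriv_orth (leqnn n); rewrite eqxx => <-.
rewrite ladder_deriv mulrnAl momvalMn.
by rewrite (orth_momval sizeP' monP' orthP')// eqxx.
Qed.

Lemma ladder_rodrigues n :
  (P' n)^`() * pearsonF + P' n * pearsonG = (G1 + F2 *+ n)%:P * P n.+1.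
Proof.
set Q := _ + _.
have sF : (size pearsonF <= 3)%N.
  apply/leq_sizeP => j j3; rewrite /pearsonF !coefD !coefCM !coefXn.
  by rewrite !gtn_eqF ?mulr0 ?addr0//; lia.
have sG : (size pearsonG <= 2)%N.
  apply/leq_sizeP => j j3; rewrite /pearsonG !coefD !coefCM !coefXn.
  by rewrite !gtn_eqF ?mulr0 ?addr0//; lia.
have sD : (size (P' n)^`() <= n)%N.
  apply/leq_sizeP => j nj.
  by rewrite coef_deriv nth_default ?mul0rn// sizeP'.
have Pn1 : (P' n)`_n = 1 by have /monicP := monP' n; rewrite /lead_coef sizeP'.
have cM p a k j : (p * (a%:P * 'X^k))`_j = (if (j < k)%N then 0 else p`_(j - k) * a) :> M.
  by rewrite mulrA coefMXn coefMC.
have := @orth_unique mm P H mmst sizeP monP unitH orthP n.+1 Q.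
move=> ->.
- congr (_%:P * _); rewrite /Q coefD.
  have -> : (P' n * pearsonG)`_n.+1 = G1.
    by rewrite /pearsonG mulrDr coefD !cM subn0 subn1 /= Pn1 mul1r nth_default ?mul0r ?add0r ?sizeP'.
  have -> : ((P' n)^`() * pearsonF)`_n.+1 = F2 *+ n.
    rewrite /pearsonF !mulrDr !coefD !cM subn0 subn1 /=.
    have z j : (n <= j)%N -> (P' n)^`()`_j = 0.
      by move=> nj; rewrite nth_default// (leq_trans sD).
    rewrite (z _ (leqnSn n)) (z _ (leqnn n)) !mul0r !add0r.
    case: n Pn1 {sD Q z} => [|n] Pn1 /=; first by rewrite mulr0n.
    by rewrite subSS subn1 /= coef_deriv Pn1 mulrnAl mul1r.
  by rewrite addrC.
- apply/leq_sizeP => j nj; rewrite /Q coefD !coefM !big1 ?addr0// => i _.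
    have [ji|ij] := ltnP n i.
      by rewrite nth_default ?mul0r// sizeP'.
    by rewrite [pearsonG`__]nth_default ?mulr0// (leq_trans sG)//; have := ltn_ord i; lia.
  have [ji|ij] := leqP n i.
    by rewrite nth_default ?mul0r// (leq_trans sD).
  by rewrite [pearsonF`__]nth_default ?mulr0// (leq_trans sF)//; have := ltn_ord i; lia.
(* Against x^b, F leads to the moments mm' of the derivative times x^b, and G to minus those of the
   derivative of the product. Leibniz leaves -b times the moment of P' n against x^(b-1), which is 0
   as b - 1 < n. *)
- move=> b bn; rewrite /Q mulrDl momvalD.
  have cX k p q : p * q * 'X^k = p * 'X^k * q :> {poly M}.
    by rewrite -!mulrA (commr_polyXn q k).
  rewrite !cX momvalF momvalG derivMXn momvalD opprD addrA subrr sub0r.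
  rewrite momvalMn; case: b bn => [|b] bn; first by rewrite mulr0n oppr0.
  rewrite (orth_momval sizeP' monP' orthP') /=; last by lia.
  by rewrite gtn_eqF ?mul0rn ?oppr0//; lia.
Qed.

End Ladder.
End MomentFunctional.

(** * Moments of the weight *)

Section WeightMoments.
Variable R : realType.
Local Notation mu := (@lebesgue_measure R).
Local Notation I := (`]-1, 1[%classic : set R).

Definition wint (a : R) (p : {poly R}) : R :=
  \int[mu]_(x in I) ((1 - x ^+ 2) `^ a * p.[x]).

Section Linear.
Variable a : R.
Hypothesis betaf_fin : (\int[mu]_x (betaf a x)%:E < +oo)%E.
Let integ := weight_poly_integrable betaf_fin.
Let mI : measurable (I : set (measurableTypeR R)). Proof. exact: measurable_itv. Qed.

Lemma wintD p q : wint a (p + q) = wint a p + wint a q.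
Proof.
rewrite /wint -(RintegralD mI (integ p) (integ q)).
by apply: eq_Rintegral => x _; rewrite hornerD mulrDr.
Qed.

Lemma wintZ c p : wint a (c *: p) = c * wint a p.
Proof.
rewrite /wint -(RintegralZl _ mI (integ p)).
by apply: eq_Rintegral => x _; rewrite hornerZ mulrCA.
Qed.

Lemma wintB p q : wint a (p - q) = wint a p - wint a q.
Proof. by rewrite -scaleN1r wintD wintZ mulN1r. Qed.

Lemma wint0 : wint a 0 = 0.
Proof. by rewrite -(scale0r 0) wintZ mul0r. Qed.

Lemma wint_sum J (r : seq J) (P : pred J) (F : J -> {poly R}) :
  wint a (\sum_(i <- r | P i) F i) = \sum_(i <- r | P i) wint a (F i).
Proof. exact: (big_morph _ wintD wint0). Qed.

Lemma wint_deriv p : -1 < a ->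
  wint a ((1 - 'X ^+ 2) * p^`() - (2 * (a + 1)) *: ('X * p)) = 0.
Proof. exact: integral_weight_deriv. Qed.

End Linear.

Lemma wint_up a p : wint (a + 1) p = wint a ((1 - 'X ^+ 2) * p).
Proof.
apply: eq_Rintegral => x; rewrite inE /= in_itv /= itv_sqr_lt1 => x1.
have x0 : 0 < 1 - x ^+ 2 by rewrite subr_gt0.
rewrite powRD ?(gt_eqF x0) ?implybT// powRr1 ?ltW// hornerM !hornerE /=.
by ring.
Qed.

Lemma wint1 nu : 0 < nu -> (\int[mu]_x (betaf (nu - 2^-1) x)%:E < +oo)%E ->
  wint (nu - 2^-1) 1 = Num.sqrt pi * (Gamma (nu + 2^-1) / Gamma (nu + 1)).
Proof.
move=> nu0 fin; rewrite -[RHS]/(fine _%:E) -beta_value//.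
rewrite /wint Rintegral_mkcond /Rintegral; congr fine; apply: eq_integral => x _.
congr _%:E; rewrite patchE (_ : (x \in I) = (x ^+ 2 < 1)).
  by rewrite /betaf hornerE mulr1.
by rewrite -itv_sqr_lt1; apply/idP/idP; rewrite inE /= in_itv.
Qed.

Section Moments.
Variable N : nat.
Implicit Types (nu : R) (i j l : 'I_N.+1).

Definition momentmx nu k : 'M[R]_N.+1 :=
  \matrix_(i, j) wint (nu - 2^-1) ('X^k * wpol N nu i j).

Lemma momentmx_tr nu k : (momentmx nu k)^T = momentmx nu k.
Proof. by apply/matrixP => i j; rewrite !mxE wpolC// -ltnS. Qed.

(** An indicator row picks one entry of f. The index may run past N, where nothing is picked, so c
    has to be 0 there. *)
Lemma sum_at (c : R) (m : nat) (f : nat -> R) : ((N < m)%N -> c = 0) ->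
  \sum_(l < N.+1) (c *+ (l == m :> nat)) * f l = c * f m.
Proof.
move=> cm; have [mN|Nm] := leqP m N; last first.
  by rewrite cm// mul0r big1// => l _; rewrite mul0rn mul0r.
rewrite (bigD1 (Ordinal (mN : (m < N.+1)%N)))//= eqxx mulr1n big1 ?addr0// => l lm.
by rewrite (_ : (l == m :> nat) = false) ?mulr0n ?mul0r//;
  apply: contraNF lm => /eqP lm; apply/eqP/val_inj.
Qed.

Lemma sum_at2 (s c1 c2 : R) (m1 m2 : nat) (f : nat -> R) :
  ((N < m1)%N -> c1 = 0) -> ((N < m2)%N -> c2 = 0) ->
  \sum_(l < N.+1) (s * (c1 *+ (l == m1 :> nat) + c2 *+ (l == m2 :> nat))) * f l =
  s * (c1 * f m1 + c2 * f m2).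
Proof.
move=> h1 h2; rewrite -(sum_at _ h1) -(sum_at _ h2) -big_split mulr_sumr /=.
by apply: eq_bigr => l _; rewrite -mulrA mulrDl.
Qed.

Lemma sum_at3 (s c1 c2 c3 : R) (m1 m2 m3 : nat) (f : nat -> R) :
  ((N < m1)%N -> c1 = 0) -> ((N < m2)%N -> c2 = 0) -> ((N < m3)%N -> c3 = 0) ->
  \sum_(l < N.+1) (s * (c1 *+ (l == m1 :> nat) + c2 *+ (l == m2 :> nat) +
    c3 *+ (l == m3 :> nat))) * f l = s * (c1 * f m1 + c2 * f m2 + c3 * f m3).
Proof.
move=> h1 h2 h3; rewrite -(sum_at _ h1) -(sum_at _ h2) -(sum_at _ h3) -!big_split mulr_sumr /=.
by apply: eq_bigr => l _; rewrite -mulrA !mulrDl.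
Qed.

(** F = F0 + x F1 + x^2 F2 and, below, G = G0 + x G1 are read off [pearson_rowE] and [wpol_raise];
    indices that truncate at 0 carry zero coefficients. *)
Definition pearsonF0 nu : 'M[R]_N.+1 := \matrix_(i, l) (pearson_scale N nu * (
  (4 * (nu + i%:R) * (N%:R + nu - i%:R) +
    (i%:R * (N%:R - i%:R + 1) * (2 * i%:R - 1 - N%:R) -
      (i%:R + 1) * (N%:R - i%:R) * (2 * i%:R + 1 - N%:R))) *+ (l == i :> nat) +
  ((N%:R - i%:R) * (N%:R - i%:R - 1)) *+ (l == i.+2 :> nat) +
  (i%:R * (i%:R - 1)) *+ (l == i.-2 :> nat))).

Definition pearsonF1 nu : 'M[R]_N.+1 := \matrix_(i, l) (pearson_scale N nu * (
  (2 * ((N%:R - i%:R) * (2 * i%:R + 1 - N%:R))) *+ (l == i.+1 :> nat) +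
  (2 * (i%:R * (N%:R - 2 * i%:R + 1))) *+ (l == i.-1 :> nat))).

Definition pearsonF2 nu : 'M[R]_N.+1 := \matrix_(i, l) (
  (pearson_scale N nu * (- 4 * (nu + i%:R) * (N%:R + nu - i%:R))) *+ (l == i :> nat)).

Definition pearsonG0 nu : 'M[R]_N.+1 := \matrix_(i, l) (raise_scale N nu * (
  ((nu + i%:R) * (N%:R - i%:R)) *+ (l == i.+1 :> nat) +
  ((N%:R + nu - i%:R) * i%:R) *+ (l == i.-1 :> nat))).

Definition pearsonG1 nu : 'M[R]_N.+1 := \matrix_(i, l) (
  (raise_scale N nu * (- 2 * (nu + i%:R) * (N%:R + nu - i%:R))) *+ (l == i :> nat)).

Let up0 i : (N < i.+1)%N -> N%:R - i%:R = 0 :> R.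
Proof.
rewrite ltnS => Ni; have := ltn_ord i; rewrite ltnS => iN.
by rewrite (_ : i = N :> nat) ?subrr//; apply/eqP; rewrite eqn_leq iN.
Qed.

Let up20 i : (N < i.+2)%N -> (N%:R - i%:R) * (N%:R - i%:R - 1) = 0 :> R.
Proof.
move=> Ni; have := ltn_ord i; rewrite ltnS leq_eqVlt => /orP[/eqP ->|iN].
  by rewrite subrr mul0r.
have -> : N%:R = i%:R + 1 :> R by rewrite natr1; congr (_%:R); lia.
by rewrite (_ : i%:R + 1 - i%:R - 1 = 0) ?mulr0//; ring.
Qed.

Let ord_le0 i m : (m <= i)%N -> (N < m)%N -> forall c : R, c = 0.
Proof. by move=> mi Nm; have := ltn_ord i; lia. Qed.

(* f stands for one column of the weight. *)
Lemma pearsonF0_sum nu i (f : nat -> R) : \sum_l pearsonF0 nu i l * f l = pearson_scale N nu * (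
  (4 * (nu + i%:R) * (N%:R + nu - i%:R) +
    (i%:R * (N%:R - i%:R + 1) * (2 * i%:R - 1 - N%:R) -
      (i%:R + 1) * (N%:R - i%:R) * (2 * i%:R + 1 - N%:R))) * f i +
  ((N%:R - i%:R) * (N%:R - i%:R - 1)) * f i.+2 +
  (i%:R * (i%:R - 1)) * f i.-2).
Proof.
under eq_bigr do rewrite mxE.
apply: sum_at3; [|exact: up20|].
- by move=> h; apply: (ord_le0 _ h).
- by move=> h; apply: (ord_le0 _ h); exact: leq_trans (leq_pred _) (leq_pred _).
Qed.

Lemma pearsonF1_sum nu i (f : nat -> R) : \sum_l pearsonF1 nu i l * f l = pearson_scale N nu * (
  (2 * ((N%:R - i%:R) * (2 * i%:R + 1 - N%:R))) * f i.+1 +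
  (2 * (i%:R * (N%:R - 2 * i%:R + 1))) * f i.-1).
Proof.
under eq_bigr do rewrite mxE.
apply: sum_at2.
- by move=> /up0 ->; rewrite mul0r mulr0.
- by move=> h; apply: (ord_le0 _ h); exact: leq_pred.
Qed.

Lemma pearsonF2_sum nu i (f : nat -> R) : \sum_l pearsonF2 nu i l * f l =
  pearson_scale N nu * (- 4 * (nu + i%:R) * (N%:R + nu - i%:R)) * f i.
Proof.
under eq_bigr do rewrite mxE.
by rewrite sum_at// => h; apply: (ord_le0 _ h).
Qed.

Lemma pearsonG0_sum nu i (f : nat -> R) : \sum_l pearsonG0 nu i l * f l = raise_scale N nu * (
  ((nu + i%:R) * (N%:R - i%:R)) * f i.+1 + ((N%:R + nu - i%:R) * i%:R) * f i.-1).
Proof.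
under eq_bigr do rewrite mxE.
apply: sum_at2.
- by move=> /up0 ->; rewrite mulr0.
- by move=> h; apply: (ord_le0 _ h); exact: leq_pred.
Qed.

Lemma pearsonG1_sum nu i (f : nat -> R) : \sum_l pearsonG1 nu i l * f l =
  raise_scale N nu * (- 2 * (nu + i%:R) * (N%:R + nu - i%:R)) * f i.
Proof.
under eq_bigr do rewrite mxE.
by rewrite sum_at// => h; apply: (ord_le0 _ h).
Qed.

Section Relations.
Variable nu : R.
Hypothesis nu0 : 0 < nu.
Hypothesis fin : (\int[mu]_x (betaf (nu - 2^-1) x)%:E < +oo)%E.

Lemma momentmxF k : momentmx (nu + 1) k = pearsonF0 nu *m momentmx nu k +
  pearsonF1 nu *m momentmx nu k.+1 + pearsonF2 nu *m momentmx nu k.+2.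
Proof.
apply/matrixP => i j; rewrite !mxE.
(* Passing through an existential makes f opaque, so the integrals are atoms for [ring]. *)
have [f fE] : exists f : nat -> nat -> R, forall m u,
    f m u = wint (nu - 2^-1) ('X^(m + k) * wpol N nu u j).
  by exists (fun m u => wint (nu - 2^-1) ('X^(m + k) * wpol N nu u j)).
under eq_bigr => l _ do rewrite [momentmx _ _ _ _]mxE -(fE 0%N l).
under [X in _ = _ + X + _]eq_bigr => l _ do rewrite [momentmx _ _ _ _]mxE -(fE 1%N l).
under [X in _ = _ + X]eq_bigr => l _ do rewrite [momentmx _ _ _ _]mxE -(fE 2%N l).
rewrite pearsonF0_sum pearsonF1_sum pearsonF2_sum.
rewrite (_ : nu + 1 - 2^-1 = nu - 2^-1 + 1); last by ring.
rewrite wint_up mulrCA wpol_mul//; [|by rewrite -ltnS..].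
pose L p := wint (nu - 2^-1) ('X^k * p).
have LD p q : L (p + q) = L p + L q by rewrite /L mulrDr (wintD fin).
have LZ c p : L (c *: p) = c * L p by rewrite /L -scalerAr (wintZ fin).
rewrite -/(L _) LZ pearson_rowE !LD !LZ /L.
have X1 p : 'X^k * ('X * p) = 'X^(1 + k) * p :> {poly R} by rewrite exprS; ring.
have X2 p : 'X^k * ('X * ('X * p)) = 'X^(2 + k) * p :> {poly R} by rewrite !exprS; ring.
have f0E u : wint (nu - 2^-1) ('X^k * wpol N nu u j) = f 0%N u by rewrite fE.
rewrite X2 !X1 !f0E -!fE.
move: (pearson_scale N nu) => s.
by ring.
Qed.

Lemma momentmxG k : momentmx (nu + 1) k.-1 *+ k =
  - (pearsonG0 nu *m momentmx nu k + pearsonG1 nu *m momentmx nu k.+1).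
Proof.
apply/matrixP => i j; rewrite mulmxnE !mxE.
have [f fE] : exists f : nat -> nat -> R, forall m u,
    f m u = wint (nu - 2^-1) ('X^(m + k) * wpol N nu u j).
  by exists (fun m u => wint (nu - 2^-1) ('X^(m + k) * wpol N nu u j)).
under eq_bigr => l _ do rewrite [momentmx _ _ _ _]mxE -(fE 0%N l).
under [X in _ = - (_ + X)]eq_bigr => l _ do rewrite [momentmx _ _ _ _]mxE -(fE 1%N l).
rewrite pearsonG0_sum pearsonG1_sum.
rewrite (_ : nu + 1 - 2^-1 = nu - 2^-1 + 1); last by ring.
rewrite wint_up -[_ *+ k]mulr_natl -(wintZ fin).
have a1 : -1 < nu - 2^-1.
  by rewrite ltrBrDr (lt_trans _ nu0)// addrC subr_lt0 invf_lt1 ?ltr0n// ltr1n.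
(* The derivative of (1 - x^2)^(nu + 1/2) x^k [wpol (nu + 1) i j] integrates to 0; it splits into
   the moment of order k - 1 for nu + 1 and x^k times the left side of [wpol_raise]. *)
have := wint_deriv fin ('X^k * wpol N (nu + 1) i j) a1.
have iN : (i <= N)%N by rewrite -ltnS.
have jN : (j <= N)%N by rewrite -ltnS.
have -> : (1 - 'X ^+ 2) * ('X^k * wpol N (nu + 1) i j)^`() -
    (2 * (nu - 2^-1 + 1)) *: ('X * ('X^k * wpol N (nu + 1) i j)) =
  k%:R *: ((1 - 'X ^+ 2) * ('X^(k.-1) * wpol N (nu + 1) i j)) +
  'X^k * ((1 - 'X ^+ 2) * (wpol N (nu + 1) i j)^`() -
    (2 * nu + 1) *: ('X * wpol N (nu + 1) i j)).
  rewrite derivM derivXn -['X^(k.-1) *+ k]mulr_natl -!mul_polyC polyC_natr.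
  rewrite (_ : 2 * (nu - 2^-1 + 1) = 2 * nu + 1); last by field.
  by ring.
rewrite wpol_raise// (wintD fin) => /eqP; rewrite addr_eq0 => /eqP ->; congr (- _).
pose L p := wint (nu - 2^-1) ('X^k * p).
have LD p q : L (p + q) = L p + L q by rewrite /L mulrDr (wintD fin).
have LZ c p : L (c *: p) = c * L p by rewrite /L -scalerAr (wintZ fin).
rewrite -/(L _) LZ !LD !LZ /L.
have -> : 'X^k * ('X * wpol N nu i j) = 'X^(1 + k) * wpol N nu i j by rewrite exprS; ring.
have f0E u : wint (nu - 2^-1) ('X^k * wpol N nu u j) = f 0%N u by rewrite fE.
rewrite !f0E -!fE.
move: (raise_scale N nu) => s.
by ring.
Qed.

End Relations.
End Moments.
End WeightMoments.

(** * From matrix integrals to moment pairings *)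

Section MatrixIntegral.
Variables (R : realType) (N : nat).
Local Notation mu := (@lebesgue_measure R).
Local Notation I := (`]-1, 1[%classic : set R).
Local Notation C := R[i].

Lemma cmxE (m n : nat) (A : 'M[R]_(m, n)) i j : cmx A i j = (A i j)%:C.
Proof. by rewrite /cmx mxE. Qed.

Lemma cmxM (m n p : nat) (A : 'M[R]_(m, n)) (B : 'M[R]_(n, p)) :
  cmx (A *m B) = cmx A *m cmx B.
Proof. exact: map_mxM. Qed.

Lemma wpol00 (nu : R) : 0 < nu -> wpol N nu 0 0 = (N%:R + nu)%:P.
Proof.
move=> nu0; rewrite [LHS]size1_polyC; last exact: size_wpol.
have := wpol_lead N 0 0 nu0; rewrite addn0 => ->; congr _%:P.
rewrite /wlead addn0 subn0 ffactn0 expr0 !poch0 divr1 !mulr1.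
by rewrite divfK// fact_neq0.
Qed.

(** The entry (0, 0) of the zeroth squared norm is N + nu times the beta integral. A real integral
    of value +oo is read as 0, which positive definiteness excludes. *)
Lemma mvop_betaf_fin (nu : R) P H : 0 < nu -> monic_mvop (weight N nu) P H ->
  (\int[mu]_x (betaf (nu - 2^-1) x)%:E < +oo)%E.
Proof.
move=> nu0 [mon posH orth].
have P0 : P 0%N = 1.
  have [sP mP] := mon 0%N; rewrite [P 0%N]size1_polyC ?sP// -polyC1; congr _%:P.
  by have /monicP := mP; rewrite /lead_coef sP.
pose e : 'rV[C]_N.+1 := delta_mx 0 0.
have [_ /(_ e)] := posH 0%N.
have -> : e != 0.
  by apply/eqP => /matrixP/(_ 0 0); rewrite !mxE !eqxx /= => /eqP; rewrite oner_eq0.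
move=> /(_ isT).
have := orth 0%N 0%N; rewrite eqxx => <-; rewrite P0.
have eval1 x : mxeval (1 : {poly 'M[C]_N.+1}) x = 1%:M by rewrite /mxeval hornerE.
have st1 : (1%:M : 'M[C]_N.+1) ^t* = 1%:M by rewrite trmx1 map_mx1.
rewrite -rowE mxE (bigD1 0)//= big1 ?addr0 => [|i i0]; last first.
  by rewrite !mxE (negPf i0) andbF conjC0 mulr0.
rewrite !mxE !eqxx /= conjC1 mulr1 ltcE /= => /andP[_].
rewrite /Rintegral.
set J := integral _ _ _.
have c0 : 0 < N%:R + nu by rewrite ltr_wpDl.
have -> : J = ((N%:R + nu)%:E * \int[mu]_x (betaf (nu - 2^-1) x)%:E)%E.
  rewrite -ge0_integralZl//; last 3 first.
  - by apply/measurable_EFinP; exact: measurable_betaf.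
  - by move=> x _; rewrite lee_fin betaf_ge0.
  - by rewrite lee_fin ltW.
  rewrite /J integral_mkcond; apply: eq_integral => x _.
  rewrite patchE (_ : (x \in I) = (x ^+ 2 < 1)); last first.
    by rewrite -itv_sqr_lt1; apply/idP/idP; rewrite inE /= in_itv.
  rewrite /betaf; case: ifP => _; last by rewrite mule0.
  rewrite eval1 st1 mul1mx mulmx1 cmxE weightE// wpol00// hornerC.
  by rewrite /= -EFinM mulrC.
case: (\int[mu]_x _)%E => [r| |] //=; first by rewrite ltry.
by rewrite gt0_muley ?ltxx// lte_fin.
Qed.

End MatrixIntegral.

Section MatrixPairing.
Variables (R : realType) (N : nat).
Local Notation mu := (@lebesgue_measure R).
Local Notation I := (`]-1, 1[%classic : set R).
Local Notation C := R[i].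

Section Lint.
Variable a : R.
Hypothesis fin : (\int[mu]_x (betaf a x)%:E < +oo)%E.

(** Carrying an explicit finite combination of weighted polynomials, rather than integrability,
    makes closure under sums immediate. *)
Definition lint (F : R -> C) (c : C) := exists r : seq (C * {poly R}),
  (forall x, -1 < x < 1 -> F x = \sum_(s <- r) s.1 * ((1 - x ^+ 2) `^ a * s.2.[x])%:C) /\
  c = \sum_(s <- r) s.1 * (wint a s.2)%:C.

Lemma lint_cint F c : lint F c ->
  (\int[mu]_(x in I) complex.Re (F x)) +i* (\int[mu]_(x in I) complex.Im (F x)) = c.
Proof.
move=> [r [Fr ->]].
(* h is the real or the imaginary part; only additivity and real homogeneity matter. *)
have part (h : C -> R) : {morph h : x y / x + y} -> (forall z (y : R), h (z * y%:C) = h z * y) ->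
    \int[mu]_(x in I) h (F x) = h (\sum_(s <- r) s.1 * (wint a s.2)%:C).
  move=> hD hZ; have h0 : h 0 = 0 by rewrite -(mul0r 0%:C) hZ mulr0.
  rewrite (big_morph h hD h0) (eq_bigr (fun s => wint a (h s.1 *: s.2))); last first.
    by move=> s _; rewrite hZ (wintZ fin).
  rewrite -(wint_sum fin); apply: eq_Rintegral => x; rewrite inE /= in_itv /= => x1.
  rewrite Fr// (big_morph h hD h0) horner_sum mulr_sumr; apply: eq_bigr => s _.
  by rewrite hZ hornerZ mulrCA.
rewrite !part; first by case: (\sum_(s <- r) _).
- by move=> [a1 b1] [a2 b2].
- by move=> [a1 b1] y /=; rewrite mulr0 addr0 add0r || rewrite mulr0 add0r.
- by move=> [a1 b1] [a2 b2].
- by move=> [a1 b1] y /=; rewrite mulr0 subr0.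
Qed.

Lemma lint0 : lint (fun=> 0) 0.
Proof. by exists [::]; split=> [x _|]; rewrite big_nil. Qed.

Lemma lintD F G c d : lint F c -> lint G d -> lint (fun x => F x + G x) (c + d).
Proof.
move=> [r [Fr ->]] [s [Gs ->]]; exists (r ++ s); split=> [x x1|]; rewrite big_cat//=.
by rewrite Fr// Gs.
Qed.

Lemma lint_sum (J : finType) (F : J -> R -> C) (c : J -> C) :
  (forall j, lint (F j) (c j)) -> lint (fun x => \sum_j F j x) (\sum_j c j).
Proof.
move=> Fc; rewrite -[index_enum J]/(index_enum J).
elim: (index_enum J) => [|j r IH].
  by rewrite big_nil; under eq_fun do rewrite big_nil; exact: lint0.
by rewrite big_cons; under eq_fun do rewrite big_cons; exact: lintD.
Qed.

Lemma lint_poly z (p : {poly R}) :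
  lint (fun x => z * ((1 - x ^+ 2) `^ a * p.[x])%:C) (z * (wint a p)%:C).
Proof. by exists [:: (z, p)]; split=> [x _|]; rewrite big_seq1. Qed.

Lemma eq_lint F G c d : (forall x, -1 < x < 1 -> F x = G x) -> c = d -> lint F c -> lint G d.
Proof.
move=> FG <- [r [Fr cr]]; exists r; split=> // x x1.
by rewrite -FG// Fr.
Qed.

End Lint.

Lemma mxevalE (p : {poly 'M[C]_N.+1}) x :
  mxeval p x = \sum_(i < size p) (x ^+ i)%:C *: p`_i.
Proof.
rewrite /mxeval horner_coef; apply: eq_bigr => i _.
rewrite -rmorphXn -[LHS]/(p`_i *m _) mul_mx_scalar; congr (_ *: _).
by rewrite rmorphXn.
Qed.

Local Notation st := (fun A : 'M[C]_N.+1 => A ^t*).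

Lemma conjC_real_complex (y : R) : (y%:C)^* = y%:C :> C.
Proof. by apply/CrealP/complex_realP; exists y. Qed.

Lemma conjCM_real (y : R) (z : C) : (y%:C * z)^* = y%:C * z^*.
Proof. by rewrite -[in RHS](conjC_real_complex y); exact: rmorphM. Qed.

Lemma mxintegral_pairing nu (p q : {poly 'M[C]_N.+1}) : 0 < nu ->
  (\int[mu]_x (betaf (nu - 2^-1) x)%:E < +oo)%E ->
  mxintegral (fun x => mxeval p x *m cmx (weight N nu x) *m (mxeval q x) ^t*) =
  pairing st (fun k => cmx (momentmx N nu k)) p q.
Proof.
move=> nu0 fin; apply/matrixP => u v; rewrite mxE; apply: (lint_cint fin).
pose F (i : 'I_(size p)) (j : 'I_(size q)) (l k : 'I_N.+1) (x : R) : C :=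
  (p`_i u k * (q`_j v l)^* ) *
    ((1 - x ^+ 2) `^ (nu - 2^-1) * ('X^(i + j) * wpol N nu k l).[x])%:C.
pose c (i : 'I_(size p)) (j : 'I_(size q)) (l k : 'I_N.+1) : C :=
  (p`_i u k * (q`_j v l)^* ) * (wint (nu - 2^-1) ('X^(i + j) * wpol N nu k l))%:C.
apply: (@eq_lint _ (fun x => \sum_i \sum_j \sum_l \sum_k F i j l k x) _
  (\sum_i \sum_j \sum_l \sum_k c i j l k)); last first.
- by do 4! (apply: lint_sum => ?); exact: lint_poly.
- rewrite /pairing summxE; apply: eq_bigr => i _.
  rewrite summxE; apply: eq_bigr => j _.
  rewrite -mulmxE mxE; apply: eq_bigr => l _.
  rewrite mxE mulr_suml; apply: eq_bigr => k _.
  by rewrite !mxE /c mulrAC.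
move=> x x1; rewrite !mxevalE.
rewrite !mulmx_suml summxE; apply: eq_bigr => i _.
rewrite linear_sum /= raddf_sum mulmx_sumr summxE; apply: eq_bigr => j _.
rewrite mxE; apply: eq_bigr => l _.
rewrite mxE mulr_suml; apply: eq_bigr => k _.
rewrite cmxE weightE// !mxE -[X in _ = _ * X]/(((x ^+ j)%:C * q`_j v l)^* ).
rewrite conjCM_real /F hornerM hornerXn exprD !rmorphM /=.
by ring.
Qed.

End MatrixPairing.

(** * Invertibility of the weight *)

Section Invertibility.
Variables (R : realType) (N : nat).
Local Notation C := R[i].

Lemma constant_itv (f : R -> R) : (forall x : R, -1 < x < 1 -> is_derive x 1 f 0) ->
  forall x : R, -1 < x < 1 -> f x = f 0.
Proof.
move=> df x x1.
have main u v : -1 < u -> u < v -> v < 1 -> f v = f u.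
  move=> u1 uv v1; apply/eqP; rewrite -subr_eq0; apply/eqP.
  have [|?|c /andP[_ _] ->] := @MVT_segment R f (fun=> 0) u v (ltW uv).
  - by move=> y; rewrite in_itv /= => /andP[uy yv]; apply: df; apply/andP; split; lra.
  - apply: derivable_within_continuous => y; rewrite in_itv /= => /andP[uy yv].
    by have [] : is_derive y 1 f 0 by apply: df; apply/andP; split; lra.
  - by rewrite mul0r.
have /andP[xm xp] := x1.
have [x0|x0|->//] := ltgtP x 0.
- by apply/esym/main => //; lra.
- by apply: main => //; lra.
Qed.

(** The integrating factor (1 - x^2)^(-p/2) turns the equation into the vanishing of a
    derivative. *)
Lemma euler_horner (p : nat) (h : {poly R}) :
  (1 - 'X ^+ 2) * h^`() + p%:R *: ('X * h) = 0 ->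
  forall x : R, -1 < x < 1 -> h.[x] = (1 - x ^+ 2) `^ (p%:R / 2) * h.[0].
Proof.
move=> E x x1.
pose f (y : R) := (1 - y ^+ 2) `^ (- (p%:R / 2)) * h.[y].
have fc : f x = f 0.
  apply: constant_itv => // y y1.
  have := is_derive_weight_poly (- (p%:R / 2)) h y1.
  rewrite (_ : (1 - 'X ^+ 2) * h^`() - _ = 0) ?horner0 ?mulr0//.
  by rewrite -E; congr (_ + _); rewrite -scaleNr; congr (_ *: _); field.
have x0 : 0 < 1 - x ^+ 2 by rewrite subr_gt0 -itv_sqr_lt1.
have -> : h.[0] = f 0 by rewrite /f expr0n subr0 powR1 mul1r.
rewrite -fc /f mulrA -powRD ?(gt_eqF x0) ?implybT//.
by rewrite subrr powRr0 mul1r.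
Qed.

(* Conjugation by this unipotent matrix decouples the linear differential system
   satisfied by the weight. *)
Definition shear : 'M[{poly R}]_N.+1 := \matrix_(i, k) ('C(i, k)%:R * (- 'X) ^+ (i - k)).

Definition lowermx : 'M[{poly R}]_N.+1 := \matrix_(i, k) (i%:R *+ (k.+1 == i)).

Definition indexmx : 'M[{poly R}]_N.+1 := diag_mx (\row_i i%:R).

Lemma det_shear : \det shear = 1.
Proof.
rewrite det_trig; first by rewrite big1// => i _; rewrite mxE binn subnn mul1r.
by apply/is_trig_mxP => i j ij; rewrite mxE bin_small// mul0r.
Qed.

Lemma shear_lower i k : (shear *m lowermx) i k = 'C(i, k)%:R * ((- 'X) ^+ (i - k).-1 *+ (i - k)).
Proof.
rewrite mxE; have [ki|ik] := ltnP k i; last first.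
  rewrite (eqP (_ : (i - k == 0)%N)) ?subn_eq0// mulr0n mulr0 big1// => l _.
  rewrite !mxE; case: eqP => [kl|_]; last by rewrite mulr0n mulr0.
  by rewrite bin_small ?mul0r// -kl ltnS.
have kN : (k.+1 < N.+1)%N by apply: leq_ltn_trans ki _.
rewrite (bigD1 (Ordinal kN))//= big1 ?addr0 => [|l lk]; last first.
  rewrite !mxE (_ : (k.+1 == l) = false) ?mulr0//.
  by apply: contraNF lk => /eqP kl; apply/eqP/val_inj.
rewrite !mxE /= eqxx mulr1n subnS mulrAC -natrM mulnC mul_bin_left.
by rewrite natrM -[_ *+ (i - k)]mulr_natl; ring.
Qed.

(** [shear] is exp(-x L) for the nilpotent L = [lowermx]. *)
Lemma deriv_shear : map_mx deriv shear = - (shear *m lowermx).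
Proof.
apply/matrixP => i k; rewrite [RHS]mxE shear_lower !mxE.
rewrite derivM -polyC_natr derivC mul0r add0r deriv_exp derivN derivX.
by rewrite mulN1r mulNrn mulrN.
Qed.

(** J = [indexmx] satisfies J L - L J = L, so conjugation by exp(-x L) turns J into J + x L. *)
Lemma shear_index : shear *m indexmx = indexmx *m shear + 'X *: (shear *m lowermx).
Proof.
apply/matrixP => i k; rewrite [RHS]mxE [X in _ + X]mxE shear_lower.
rewrite mul_mx_diag mul_diag_mx !mxE.
have [ki|ik] := ltnP k i; last first.
  rewrite (eqP (_ : (i - k == 0)%N)) ?subn_eq0// mulr0n !mulr0 addr0.
  move: ik; rewrite leq_eqVlt => /orP[/eqP ->|ik]; first by rewrite mulrC.
  by rewrite bin_small// !mul0r mulr0.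
rewrite -[_ *+ (i - k)]mulr_natl natrB ?(ltnW ki)//.
have -> : (- 'X : {poly R}) ^+ (i - k) = - 'X * (- 'X) ^+ (i - k).-1.
  by rewrite -exprS prednK// subn_gt0.
by ring.
Qed.

Lemma deriv_mulmx m n p (A : 'M[{poly R}]_(m, n)) (B : 'M[{poly R}]_(n, p)) :
  map_mx deriv (A *m B) = map_mx deriv A *m B + A *m map_mx deriv B.
Proof.
apply/matrixP => i j; rewrite !mxE raddf_sum -big_split /=; apply: eq_bigr => k _.
by rewrite !mxE derivM.
Qed.

Definition wmx nu : 'M[{poly R}]_N.+1 := \matrix_(i, j) wpol N nu i j.

Lemma deriv_wmx nu : 0 < nu -> (1 - 'X ^+ 2) *: map_mx deriv (wmx nu) =
  lowermx *m wmx nu + wmx nu *m lowermx^T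
  - 'X *: (indexmx *m wmx nu + wmx nu *m indexmx).
Proof.
move=> nu0; apply/matrixP => i j.
have low (f : nat -> {poly R}) k : \sum_l lowermx k l * f l = k%:R * f k.-1.
  case: k => [[|k] kN] /=.
    by rewrite mul0r big1// => l _; rewrite mxE mul0rn mul0r.
  rewrite (bigD1 (Ordinal (ltnW kN)))//= mxE eqxx big1 ?addr0// => l lk.
  rewrite mxE eqSS (_ : (l == k :> nat) = false) ?mulr0n ?mul0r//.
  by apply: contraNF lk => /eqP lk; apply/eqP/val_inj.
have low1 : (lowermx *m wmx nu) i j = i%:R * wpol N nu i.-1 j.
  by rewrite mxE -(low (fun l => wpol N nu l j)); apply: eq_bigr => l _; rewrite [wmx _ _ _]mxE.
have low2 : (wmx nu *m lowermx^T) i j = j%:R * wpol N nu i j.-1.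
  rewrite mxE -(low (fun l => wpol N nu i l)); apply: eq_bigr => l _.
  by rewrite !mxE mulrC.
rewrite mxE [X in _ * X]mxE [wmx _ _ _]mxE wpol_deriv//; [|by rewrite -ltnS..].
rewrite [RHS]mxE [X in _ = X + _]mxE low1 low2 mul_diag_mx mul_mx_diag !mxE.
by ring.
Qed.

Definition unshear nu : 'M[{poly R}]_N.+1 := shear *m wmx nu *m shear^T.

(** With T = [shear], the term T L w T^T has coefficient -(1 - x^2) from the derivative of T, 1 from
    [deriv_wmx] and -x^2 from moving [indexmx] past T: the sum is 0. The transposed term cancels
    likewise, and each entry is left with its own scalar equation. *)
Lemma deriv_unshear nu : 0 < nu ->
  (1 - 'X ^+ 2) *: map_mx deriv (unshear nu) =
  - 'X *: (indexmx *m unshear nu + unshear nu *m indexmx).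
Proof.
move=> nu0; rewrite /unshear; set w := wmx nu; set T := shear.
have Tt : T^T^T = T by rewrite trmxK.
have It : indexmx^T = indexmx by rewrite tr_diag_mx.
have TtD : map_mx deriv T^T = - (lowermx^T *m T^T) by rewrite -map_trmx deriv_shear -trmx_mul linearN.
have TtI : indexmx *m T^T = T^T *m indexmx + 'X *: (lowermx^T *m T^T).
  by rewrite -[LHS]trmxK trmx_mul Tt It shear_index linearD linearZ /= !trmx_mul It.
have E1 : T *m indexmx *m w *m T^T = indexmx *m (T *m w *m T^T) + 'X *: (T *m lowermx *m w *m T^T).
  by rewrite shear_index !mulmxDl -!scalemxAl !mulmxA.
have E2 : T *m w *m indexmx *m T^T = T *m w *m T^T *m indexmx + 'X *: (T *m w *m lowermx^T *m T^T).
  by rewrite -mulmxA TtI mulmxDr -scalemxAr !mulmxA.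
have E3 : (1 - 'X ^+ 2) *: (T *m map_mx deriv w *m T^T) =
    T *m lowermx *m w *m T^T + T *m w *m lowermx^T *m T^T -
    'X *: (T *m indexmx *m w *m T^T + T *m w *m indexmx *m T^T).
  rewrite scalemxAl scalemxAr deriv_wmx// mulmxBr mulmxBl -scalemxAr -scalemxAl.
  by rewrite !mulmxDr !mulmxDl !mulmxA.
rewrite !deriv_mulmx deriv_shear TtD !mulmxDl !mulNmx mulmxN !scalerDr !mulmxA -/T.
rewrite E3 E1 E2 !mulmxA.
move: (T *m lowermx *m w *m T^T) (T *m w *m lowermx^T *m T^T) => U V.
move: (indexmx *m T *m w *m T^T) (T *m w *m T^T *m indexmx) => A B.
by apply/matrixP => i j; rewrite !mxE; ring.
Qed.

Lemma unshear_horner nu (i j : 'I_N.+1) (x : R) : 0 < nu -> -1 < x < 1 ->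
  (unshear nu i j).[x] = (1 - x ^+ 2) `^ (i%:R / 2) * ((unshear nu i j).[0] *
    (1 - x ^+ 2) `^ (j%:R / 2)).
Proof.
move=> nu0 x1; have := deriv_unshear nu0.
move: (unshear nu) => z /= /matrixP/(_ i j).
rewrite mul_diag_mx mul_mx_diag !mxE => E.
have /euler_horner/(_ x x1) -> : (1 - 'X ^+ 2) * (z i j)^`() +
    (i + j)%:R *: ('X * z i j) = 0.
  by rewrite E -mul_polyC polyC_natr natrD; ring.
have x0 : 0 < 1 - x ^+ 2 by rewrite subr_gt0 -itv_sqr_lt1.
rewrite natrD mulrDl powRD ?(gt_eqF x0) ?implybT//.
by ring.
Qed.

Lemma det_wmx_horner nu (x : R) : 0 < nu -> -1 < x < 1 ->
  (\det (wmx nu)).[x] = (\prod_(i < N.+1) (1 - x ^+ 2) `^ (i%:R / 2)) ^+ 2 * (\det (wmx nu)).[0].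
Proof.
move=> nu0 x1.
have -> : \det (wmx nu) = \det (unshear nu).
  by rewrite /unshear !det_mulmx det_tr det_shear mul1r mulr1.
have dE (y : R) : (\det (unshear nu)).[y] = \det (map_mx (horner_eval y) (unshear nu)).
  by rewrite det_map_mx.
pose c := \row_(i < N.+1) (1 - x ^+ 2) `^ (i%:R / 2).
rewrite !dE (_ : map_mx (horner_eval x) _ =
  diag_mx c *m map_mx (horner_eval 0) (unshear nu) *m diag_mx c).
  rewrite !det_mulmx det_diag mulrAC -expr2; congr (_ ^+ 2 * _).
  by apply: eq_bigr => i _; rewrite mxE.
apply/matrixP => i j; have := unshear_horner i j nu0 x1.
move: (unshear nu) => z zE; rewrite mul_mx_diag mxE mul_diag_mx !mxE /horner_eval.
by rewrite zE mulrA.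
Qed.

Local Notation st := (fun A : 'M[C]_N.+1 => A ^t* ).

Lemma starD : {morph st : A B / A + B}.
Proof. by move=> A B; apply/matrixP => i j; rewrite !mxE rmorphD. Qed.

Lemma starM (A B : 'M[C]_N.+1) : st (A * B) = st B * st A.
Proof.
apply/matrixP => i j; rewrite -!mulmxE !mxE rmorph_sum.
by apply: eq_bigr => k _; rewrite !mxE rmorphM mulrC.
Qed.

Lemma starK : involutive st.
Proof. by move=> A; apply/matrixP => i j; rewrite !mxE conjCK. Qed.

Lemma star_momentmx nu k : st (cmx (momentmx N nu k)) = cmx (momentmx N nu k).
Proof.
apply/matrixP => i j; rewrite [LHS]mxE [_^T i j]mxE !cmxE conjC_real_complex.
by have /matrixP/(_ i j) := momentmx_tr N nu k; rewrite [LHS]mxE => ->.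
Qed.

Lemma posdefmx_unit (A : 'M[C]_N.+1) : posdefmx A -> A \is a GRing.unit.
Proof.
move=> [_ posA]; suff: A \in unitmx by []; rewrite unitmxE unitfE.
apply/det0P => -[v v0 vA]; have := posA v v0.
by rewrite vA mul0mx mxE ltxx.
Qed.

Section Orthogonality.
Variables (nu : R) (P : nat -> {poly 'M[C]_N.+1}) (H : nat -> 'M[C]_N.+1).
Hypotheses (nu0 : 0 < nu) (PH : monic_mvop (weight N nu) P H).

Let fin := mvop_betaf_fin nu0 PH.

Lemma mvop_size n : size (P n) = n.+1.
Proof. by have [/(_ n) []] := PH. Qed.

Lemma mvop_monic n : P n \is monic.
Proof. by have [/(_ n) []] := PH. Qed.

Lemma mvop_unit n : H n \is a GRing.unit.
Proof. by apply: posdefmx_unit; have [_ /(_ n)] := PH. Qed.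

Lemma mvop_orth n m :
  pairing st (fun k => cmx (momentmx N nu k)) (P n) (P m) = if n == m then H n else 0.
Proof. by rewrite -mxintegral_pairing//; have [_ _ ->] := PH. Qed.

(* A polynomial row in the left kernel of the weight would be orthogonal to
   every polynomial. *)
Lemma det_wmx_neq0 : \det (wmx nu) != 0.
Proof.
apply/det0P => -[q q0 qw].
pose m := \max_(v < N.+1) size (q 0%R v).
(* Every row of Q is q, since the orthogonality lemmas speak of square matrices. *)
pose Qc i : 'M[C]_N.+1 := \matrix_(u, v) ((q 0 v)`_i)%:C.
pose Q : {poly 'M[C]_N.+1} := \poly_(i < m) Qc i.
have mq v : (size (q 0%R v) <= m)%N by exact: (leq_bigmax v).
suff Q0 : Q = 0.
  move/negP: q0; apply; apply/eqP/rowP => v; rewrite mxE; apply/polyP => i; rewrite coef0.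
  have [mi|im] := leqP m i; first by rewrite nth_default// (leq_trans (mq v)).
  have := congr1 (fun p : {poly 'M[C]_N.+1} => p`_i 0 v) Q0.
  by rewrite coef_poly im coef0 !mxE => -[].
apply: (orth_eq0 starD starM starK (star_momentmx nu) mvop_size mvop_monic mvop_unit
  mvop_orth (leqnn _)) => b _.
have -> : momval (fun k => cmx (momentmx N nu k)) (Q * 'X^b) =
    \sum_(i < m) Qc i * cmx (momentmx N nu (i + b)).
  rewrite /Q poly_def mulr_suml momval_sum; apply: eq_bigr => i _.
  by rewrite -mul_polyC -mulrA -exprD momval_monomial.
apply/matrixP => u j; rewrite summxE [RHS]mxE.
transitivity ((\sum_(i < m) \sum_k (q 0 k)`_i * wint (nu - 2^-1) ('X^(i + b) * wpol N nu k j))%:C).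
  rewrite rmorph_sum; apply: eq_bigr => i _.
  rewrite -mulmxE mxE rmorph_sum; apply: eq_bigr => k _.
  by rewrite cmxE !mxE rmorphM.
suff -> : \sum_(i < m) \sum_k (q 0 k)`_i * wint (nu - 2^-1) ('X^(i + b) * wpol N nu k j) =
  wint (nu - 2^-1) ('X^b * (q *m wmx nu) 0 j) by rewrite qw mxE mulr0 wint0.
rewrite mxE mulr_sumr (wint_sum fin) exchange_big; apply: eq_bigr => k _ /=.
rewrite [wmx _ _ _]mxE.
have qE : q 0 k = \sum_(i < m) (q 0 k)`_i *: 'X^i.
  rewrite -[LHS]coefK poly_def -(big_mkord predT (fun i => (q 0 k)`_i *: 'X^i)).
  rewrite -[RHS](big_mkord predT (fun i => (q 0 k)`_i *: 'X^i))
    [RHS](@big_cat_nat _ _ _ (size (q 0 k)))//=.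
  rewrite [X in _ = _ + X](_ : _ = 0) ?addr0// big_nat.
  by apply: big1 => i /andP[qi _]; rewrite nth_default// scale0r.
rewrite [in RHS]qE mulr_suml mulr_sumr (wint_sum fin); apply: eq_bigr => i _.
rewrite -(wintZ fin); congr wint; rewrite exprD -!mul_polyC.
by ring.
Qed.

Lemma weight_unitmx (x : R) : -1 < x < 1 -> weight N nu x \in unitmx.
Proof.
move=> x1; have x0 : 0 < 1 - x ^+ 2 by rewrite subr_gt0 -itv_sqr_lt1.
have -> : weight N nu x = (1 - x ^+ 2) `^ (nu - 2^-1) *: map_mx (horner_eval x) (wmx nu).
  by apply/matrixP => i j; rewrite weightE// !mxE.
rewrite unitmxE unitfE detZ; apply: mulf_neq0; first by rewrite expf_neq0// gt_eqF// powR_gt0.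
rewrite det_map_mx /= /horner_eval det_wmx_horner//; apply: mulf_neq0.
  by rewrite expf_neq0//; apply/prodf_neq0 => i _; rewrite gt_eqF// powR_gt0.
apply: contra det_wmx_neq0 => /eqP d0; apply/eqP.
set d := \det _ in d0 *.
(* A zero at 0 propagates to all of (-1, 1); the points 1 / (k + 2) are distinct roots there, one
   more than the degree allows. *)
pose rs := [seq k.+2%:R^-1 : R | k <- iota 0 (size d)].
apply: (@roots_geq_poly_eq0 _ _ rs); last by rewrite size_map size_iota.
- apply/allP => _ /mapP[k _ ->]; rewrite /root det_wmx_horner ?d0 ?mulr0//.
  have k0 : 0 < k.+2%:R^-1 :> R by rewrite invr_gt0.
  by rewrite (lt_trans _ k0) ?ltrN10// invf_lt1// ltr1n.
- rewrite map_inj_uniq ?iota_uniq// => k l /invr_inj/eqP.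
  by rewrite eqr_nat => /eqP [].
Qed.

End Orthogonality.
End Invertibility.

(** * Ladder relations, squared norms and the Rodrigues formula *)

Section LadderRelations.
Variables (R : realType) (N : nat).
Local Notation C := R[i].
Implicit Types (nu : R) (n k : nat).
Local Notation st := (fun A : 'M[C]_N.+1 => A ^t* ).

(** Diagonal entry of K = G1 + n F2, factored so that it is visibly nonzero and divides out of
    [rodrigues_entry]. *)
Definition ladder_entry nu n k : R :=
  - (nu + 2^-1) * (nu + k%:R) * (N%:R + nu + 1) * (N%:R + 2 * nu + n%:R + 1) *
    (N%:R + nu - k%:R) / (nu * (N%:R / 2 + nu + 2^-1) * (N%:R / 2 + nu) * (N%:R + nu)).

Lemma ladder_entry_neq0 nu n k : 0 < nu -> (k <= N)%N -> ladder_entry nu n k != 0.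
Proof.
move=> nu0 kN; have kN0 : k%:R <= N%:R :> R by rewrite ler_nat.
have := ler0n R N; have := ler0n R n; have := ler0n R k => k0 n0 N0.
have ? : 0 < N%:R / 2 + nu by rewrite ltr_wpDl// divr_ge0.
rewrite /ladder_entry !mulf_neq0 ?invr_eq0 ?oppr_eq0//; try (by apply: lt0r_neq0; lra).
by rewrite !mulf_neq0//; apply: lt0r_neq0; lra.
Qed.

Definition laddermx nu n : 'M[R]_N.+1 := diag_mx (\row_k ladder_entry nu n k).

Lemma pearson_ladder nu n : 0 < nu ->
  pearsonG1 N nu + pearsonF2 N nu *+ n = laddermx nu n.
Proof.
move=> nu0; apply/matrixP => i j; rewrite mxE mulmxnE !mxE eq_sym -(val_eqE i j) /=.
case: eqP => _; last by rewrite !mulr0n ?mul0rn addr0.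
rewrite !mulr1n -mulr_natr /ladder_entry /pearson_scale /raise_scale.
have := ler0n R N; have := ler0n R n => n0 N0.
have ? : 0 < N%:R / 2 + nu by rewrite ltr_wpDl// divr_ge0.
field; nonzero.
Qed.

Lemma rodrigues_entry0 nu k : rodrigues_entry N nu 0 k = 1.
Proof. by rewrite /rodrigues_entry !poch0 expr0 !mulr1 invr1 mulr1. Qed.

Lemma rodrigues_entryS nu n k : 0 < nu -> (k <= N)%N ->
  rodrigues_entry N nu n.+1 k * ladder_entry nu n k = rodrigues_entry N (nu + 1) n k.
Proof.
move=> nu0 kN; have kN0 : k%:R <= N%:R :> R by rewrite ler_nat.
have := ler0n R N; have := ler0n R n; have := ler0n R k => k0 n0 N0.
have ? : 0 < N%:R / 2 + nu by rewrite ltr_wpDl// divr_ge0.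
rewrite /rodrigues_entry /ladder_entry !pochSl exprS -!(natr1 n).
rewrite (_ : N%:R + 2 * nu + (n%:R + 1) + 1 = N%:R + 2 * (nu + 1) + n%:R); last by ring.
rewrite (_ : N%:R / 2 + nu + 2^-1 + 1 = N%:R / 2 + (nu + 1) + 2^-1); last by ring.
rewrite (_ : N%:R / 2 + nu + 1 = N%:R / 2 + (nu + 1)); last by ring.
rewrite (_ : nu + 2^-1 + 1 = nu + 1 + 2^-1); last by ring.
rewrite (_ : nu + k%:R + 1 = nu + 1 + k%:R); last by ring.
rewrite (_ : N%:R + nu - k%:R + 1 = N%:R + (nu + 1) - k%:R); last by ring.
rewrite !(addrA _ nu 1).
have p (a : R) m : 0 < a -> poch a m != 0 by exact: poch_neq0.
have p1 := p (nu + 1 + 2^-1) n ltac:(lra).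
have p2 := p (nu + 1 + k%:R) n ltac:(lra).
have p3 := p (N%:R + nu + 1 + 1) n ltac:(lra).
have p4 := p (N%:R + 2 * (nu + 1) + n%:R) n ltac:(lra).
have p5 := p (N%:R + nu + 1 - k%:R) n ltac:(lra).
move: p1 p2 p3 p4 p5.
move: (poch (nu + 1 + 2^-1) n) (poch (nu + 1 + k%:R) n) (poch (N%:R + nu + 1 + 1) n)
 (poch (N%:R + 2 * (nu + 1) + n%:R) n) (poch (N%:R + nu + 1 - k%:R) n) => q1 q2 q3 q4 q5 ? ? ? ? ?.
move: ((-1) ^+ n) (poch (nu + 1) n) (poch (N%:R + nu + 1) n) (poch (N%:R / 2 + nu + 1) n) => s q6 q7 q8.
move: (poch (N%:R / 2 + nu + 1 + 2^-1) n) => q9.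
field; nonzero.
Qed.

(** The Gamma relation is a premise because it will come from comparing two beta integrals in
    [wint1_up], not from the functional equation of Gamma. *)
Lemma sqnorm_entryS nu n k : 0 < nu -> (k <= N)%N ->
  Num.sqrt pi * (Gamma (nu + 1 + 2^-1) / Gamma (nu + 1 + 1)) =
    (nu + 2^-1) / (nu + 1) * (Num.sqrt pi * (Gamma (nu + 2^-1) / Gamma (nu + 1))) ->
  sqnorm_entry N (nu + 1) n k *+ n.+1 = - (sqnorm_entry N nu n.+1 k * ladder_entry nu n k).
Proof.
move=> nu0 kN GE; have kN0 : k%:R <= N%:R :> R by rewrite ler_nat.
have := ler0n R N; have := ler0n R n; have := ler0n R k => k0 n0 N0.
have ? : 0 < N%:R / 2 + nu by rewrite ltr_wpDl// divr_ge0.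
rewrite /sqnorm_entry GE {GE} /ladder_entry -[LHS]mulr_natr !pochSl factS natrM -!(natr1 n).
rewrite (_ : n%:R + 1 + nu = n%:R + (nu + 1)); last by ring.
rewrite (_ : N%:R + 2 * nu + (n%:R + 1) + 1 = N%:R + 2 * (nu + 1) + n%:R); last by ring.
rewrite (_ : N%:R / 2 + nu + 1 = N%:R / 2 + (nu + 1)); last by ring.
rewrite (_ : N%:R / 2 + 2^-1 + nu + 1 = N%:R / 2 + 2^-1 + (nu + 1)); last by ring.
rewrite (_ : nu + k%:R + 1 = nu + 1 + k%:R); last by ring.
rewrite (_ : N%:R + nu - k%:R + 1 = N%:R + (nu + 1) - k%:R); last by ring.
rewrite !(addrA _ nu 1).
have p (a : R) m : 0 < a -> poch a m != 0 by exact: poch_neq0.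
have p2 := p (nu + 1 + k%:R) n ltac:(lra).
have p3 := p (N%:R + nu + 1 + 1) n ltac:(lra).
have p4 := p (N%:R + 2 * (nu + 1) + n%:R) n ltac:(lra).
have p5 := p (N%:R + nu + 1 - k%:R) n ltac:(lra).
have p6 := p (n%:R + nu + 1 + 1) k ltac:(lra).
have p7 := p (n%:R + nu + 1 + 1) (N - k)%N ltac:(lra).
move: p2 p3 p4 p5 p6 p7 (fact_neq0 R N).
move: (poch (nu + 1 + k%:R) n) (poch (N%:R + nu + 1 + 1) n)
 (poch (N%:R + 2 * (nu + 1) + n%:R) n) (poch (N%:R + nu + 1 - k%:R) n)
 (poch (n%:R + nu + 1 + 1) k) (poch (n%:R + nu + 1 + 1) (N - k)%N)
 (N`!%:R : R) => q2 q3 q4 q5 q6 q7 q8 ? ? ? ? ? ? ?.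
move: (poch (N%:R / 2 + 2^-1 + nu + 1) n) (poch (N%:R + nu + 1) n) (poch (N%:R / 2 + nu + 1) n)
  (poch (n%:R + nu + 1 + 1) N) => r1 r2 r3 r4.
move: (Num.sqrt pi * _) (n`!%:R : R) (k`!%:R : R) ((N - k)`!%:R : R) => s f1 f2 f3.
field; nonzero.
Qed.

Section Families.
Variables (P : R -> nat -> {poly 'M[C]_N.+1}) (H : R -> nat -> 'M[C]_N.+1).
Hypothesis PH : forall nu : R, 0 < nu -> monic_mvop (weight N nu) (P nu) (H nu).
Variable nu : R.
Hypothesis nu0 : 0 < nu.

Let nu1 : 0 < nu + 1. Proof. by rewrite ltr_wpDr. Qed.
Let fin := mvop_betaf_fin nu0 (PH nu0).
Local Notation mom nu := (fun k => cmx (momentmx N nu k)).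

Let momF k : mom (nu + 1) k = cmx (pearsonF0 N nu) * mom nu k +
  cmx (pearsonF1 N nu) * mom nu k.+1 + cmx (pearsonF2 N nu) * mom nu k.+2.
Proof. by rewrite /= momentmxF// /cmx !map_mxD !map_mxM. Qed.

Let momG k : mom (nu + 1) k.-1 *+ k =
  - (cmx (pearsonG0 N nu) * mom nu k + cmx (pearsonG1 N nu) * mom nu k.+1).
Proof.
by rewrite /cmx -raddfMn /= momentmxG// map_mxN !map_mxD !map_mxM.
Qed.

Lemma mvop_deriv n : (P nu n.+1)^`() = P (nu + 1) n *+ n.+1.
Proof.
exact: (ladder_deriv (@starD R N) (@starM R N) (@starK R N) (star_momentmx N nu) (mvop_size (PH nu0))
  (mvop_monic (PH nu0)) (mvop_orth nu0 (PH nu0))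
  (star_momentmx N (nu + 1)) (mvop_size (PH nu1))
  (mvop_monic (PH nu1)) (mvop_unit (PH nu1)) (mvop_orth nu1 (PH nu1)) momF momG).
Qed.

Lemma mvop_norm n : H (nu + 1) n *+ n.+1 = - (H nu n.+1 * cmx (laddermx nu n)).
Proof.
have -> : cmx (laddermx nu n) = (cmx (pearsonG1 N nu)) ^t* + (cmx (pearsonF2 N nu)) ^t* *+ n.
  have F2 : (pearsonF2 N nu)^T = pearsonF2 N nu.
    by apply/matrixP => i j; rewrite !mxE; case: eqVneq => [->|]; rewrite ?eqxx// eq_sym => /negPf ->.
  have G1 : (pearsonG1 N nu)^T = pearsonG1 N nu.
    by apply/matrixP => i j; rewrite !mxE; case: eqVneq => [->|]; rewrite ?eqxx// eq_sym => /negPf ->.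
  have real (A : 'M[R]_N.+1) : (cmx A) ^t* = cmx A^T.
    by apply/matrixP => i j; rewrite !mxE conjC_real_complex.
  by rewrite !real F2 G1 -pearson_ladder// /cmx map_mxD raddfMn.
exact: (ladder_norm (@starD R N) (@starM R N) (@starK R N) (star_momentmx N nu) (mvop_size (PH nu0))
  (mvop_monic (PH nu0)) (mvop_orth nu0 (PH nu0))
  (star_momentmx N (nu + 1)) (mvop_size (PH nu1))
  (mvop_monic (PH nu1)) (mvop_unit (PH nu1)) (mvop_orth nu1 (PH nu1)) momF momG).
Qed.

Lemma mvop_rodrigues n :
  (P (nu + 1) n)^`() *
    (pearsonF (cmx (pearsonF0 N nu)) (cmx (pearsonF1 N nu)) (cmx (pearsonF2 N nu))) +
  P (nu + 1) n * pearsonG (cmx (pearsonG0 N nu)) (cmx (pearsonG1 N nu)) =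
  (cmx (laddermx nu n))%:P * P nu n.+1.
Proof.
rewrite -pearson_ladder// /cmx map_mxD raddfMn /= -/cmx.
exact: (ladder_rodrigues (@starD R N) (@starM R N) (@starK R N) (star_momentmx N nu) (mvop_size (PH nu0))
  (mvop_monic (PH nu0)) (mvop_unit (PH nu0)) (mvop_orth nu0 (PH nu0))
  (mvop_size (PH nu1))
  (mvop_monic (PH nu1)) (mvop_orth nu1 (PH nu1)) momF momG).
Qed.

End Families.
End LadderRelations.

(** * The zeroth moment and the squared norms *)

Section SquaredNorms.
Variables (R : realType) (N : nat).
Local Notation C := R[i].
Local Notation mu := (@lebesgue_measure R).
Implicit Types (nu : R) (n k : nat).
Local Notation st := (fun A : 'M[C]_N.+1 => A ^t* ).

Lemma lfact_poch (a : R) t : lfact (a + t%:R) t = poch (a + 1) t.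
Proof.
elim: t => [|t IH]; first by rewrite lfact0 poch0.
by rewrite -natr1 addrA lfactSl IH pochSr mulrC; congr (_ * _); ring.
Qed.

Section Fixed.
Variable nu : R.
Hypothesis nu0 : 0 < nu.
Hypothesis fin : (\int[mu]_x (betaf (nu - 2^-1) x)%:E < +oo)%E.

Let a1 : -1 < nu - 2^-1.
Proof. by rewrite ltrBrDr (lt_trans _ nu0)// addrC subr_lt0 invf_lt1 ?ltr0n// ltr1n. Qed.

(** By [gegp_raise], the weighted integrand is a multiple of a derivative that vanishes at the
    endpoints. *)
Lemma wint_gegp n : wint (nu - 2^-1) (gegp nu n.+1) = 0.
Proof.
have := wint_deriv fin (gegp (nu + 1) n) a1.
rewrite (_ : 2 * (nu - 2^-1 + 1) = 2 * nu + 1); last by field.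
have n0 := ler0n R n.
have c0 : (n%:R + 1) * (n%:R + 2 * nu + 1) / (2 * nu) != 0.
  by rewrite !mulf_neq0 ?invr_eq0 ?mulf_neq0//; apply: lt0r_neq0;
    move: (n%:R) n0 (nu) nu0 => m m0 v v0; lra.
by rewrite gegp_raise// (wintZ fin) => /eqP; rewrite mulf_eq0 oppr_eq0 (negPf c0) => /eqP.
Qed.

(** Integrate the derivative of x (1 - x^2)^(nu + 1/2) to 0. *)
Lemma wint1_up : wint (nu + 1 - 2^-1) 1 = (nu + 2^-1) / (nu + 1) * wint (nu - 2^-1) 1.
Proof.
rewrite (_ : nu + 1 - 2^-1 = nu - 2^-1 + 1); last by ring.
rewrite wint_up mulr1; have := wint_deriv fin 'X a1.
rewrite (_ : 2 * (nu - 2^-1 + 1) = 2 * nu + 1); last by field.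
rewrite derivX mulr1 -expr2 (wintB fin) (wintZ fin).
have -> : wint (nu - 2^-1) ('X ^+ 2) = wint (nu - 2^-1) 1 - wint (nu - 2^-1) (1 - 'X ^+ 2).
  by rewrite -(wintB fin); congr wint; ring.
move: (wint _ (1 - _)) (wint _ 1) => u v E.
have n1 : nu + 1 != 0 by rewrite gt_eqF// addr_gt0.
apply/eqP; rewrite -subr_eq0; apply/eqP.
transitivity ((u - (2 * nu + 1) * (v - u)) / (2 * (nu + 1))); first by field.
by rewrite E mul0r.
Qed.

(** By [wint_gegp] only the constant Gegenbauer polynomial contributes, that is 2t = i + j; together
    with t <= i and t <= j this forces t = i = j. *)
Lemma momentmx0 : momentmx N nu 0 = diag_mx (\row_k sqnorm_entry N nu 0 k).
Proof.
apply/matrixP => i j; rewrite !mxE mul1r /wpol (wint_sum fin).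
have z t : wint (nu - 2^-1) (alphas N nu t i j *: gegp nu (i + j - 2 * t)) =
    (alphas N nu t i j * wint (nu - 2^-1) 1) *+ ((i == j) && (t == i)).
  rewrite (wintZ fin); have [ti|it] := leqP t i; last first.
    by rewrite alphas_gt ?it// !mul0r mul0rn.
  have [tj|jt] := leqP t j; last by rewrite alphas_gt ?jt ?orbT// !mul0r mul0rn.
  case e : (i + j - 2 * t)%N => [|m].
    have ti' : t = i :> nat by lia.
    have ij : i = j by apply/val_inj => /=; lia.
    by rewrite gegp0 -ij ti' !eqxx mulr1n.
  rewrite wint_gegp mulr0; case: eqP => [ij|]; last by rewrite mulr0n.
  by rewrite (_ : (t == i) = false) ?mulr0n//; apply/eqP => ti'; move: e; rewrite -ij ti'; lia.
under eq_bigr do rewrite z.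
rewrite (bigD1 i)//= big1 ?addr0 => [|t ti]; last by rewrite (negPf (_ : (t != i :> nat))) ?andbF.
rewrite eqxx andbT; case: eqP => [<-|_]; last by rewrite !mulr0n.
rewrite !mulr1n wint1// /alphas leqnn subnn /alphaD /sqnorm_entry !add0n !add0r !ffactn0 !poch0.
have kN : (i <= N)%N by rewrite -ltnS.
rewrite pochSl !fact0 mulr1n.
have -> : poch (nu + 1) N = poch (nu + 1) (N - i) * lfact (N%:R + nu) i.
  rewrite -{1}(subnK kN) pochD; congr (_ * _).
  rewrite (_ : N%:R + nu = nu + (N - i)%:R + i%:R); last by rewrite natrB//; ring.
  by rewrite lfact_poch; congr poch; ring.
have p1 := poch_neq0 i (addr_gt0 nu0 ltr01); have p2 := poch_neq0 (N - i) (addr_gt0 nu0 ltr01).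
move: p1 p2 (fact_neq0 R N) (fact_neq0 R i).
move: (poch (nu + 1) i) (poch (nu + 1) (N - i)) (N`!%:R : R) (i`!%:R : R).
move: (lfact _ _) ((N - i)`!%:R : R) => ? ? ? ? ? ?; rewrite /= addr0 => ? ? ? ?.
move: (Num.sqrt pi * _) => S.
by field; do ?[apply/andP; split]; rewrite ?(gt_eqF nu0).
Qed.

End Fixed.

Section Families.
Variables (P : R -> nat -> {poly 'M[C]_N.+1}) (H : R -> nat -> 'M[C]_N.+1).
Hypothesis PH : forall nu : R, 0 < nu -> monic_mvop (weight N nu) (P nu) (H nu).

Lemma mvop0 nu : 0 < nu -> P nu 0%N = 1.
Proof.
move=> nu0; have sP := mvop_size (PH nu0) 0; have /monicP := mvop_monic (PH nu0) 0.
by rewrite /lead_coef sP [P nu 0%N]size1_polyC ?sP// coefC eqxx => ->.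
Qed.

Lemma mvop_norm0 nu : 0 < nu -> H nu 0%N = cmx (momentmx N nu 0).
Proof.
move=> nu0; have := mvop_orth nu0 (PH nu0) 0 0; rewrite eqxx => <-.
rewrite mvop0// /pairing size_poly1 !big_ord1 coef1 /=.
have -> : (1 : 'M[C]_N.+1) ^t* = 1 by rewrite trmx1 map_mx1.
by rewrite mul1r mulr1.
Qed.

Lemma mvop_normE nu n : 0 < nu -> H nu n = cmx (diag_mx (\row_k sqnorm_entry N nu n k)).
Proof.
elim: n nu => [|n IH] nu nu0.
  by rewrite mvop_norm0// momentmx0//; exact: mvop_betaf_fin (PH nu0).
have nu1 : 0 < nu + 1 by rewrite ltr_wpDr.
have fin := mvop_betaf_fin nu0 (PH nu0); have fin1 := mvop_betaf_fin nu1 (PH nu1).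
have Lu : cmx (laddermx N nu n) \is a GRing.unit.
  suff : cmx (laddermx N nu n) \in unitmx by [].
  rewrite unitmxE det_map_mx det_diag unitfE fmorph_eq0.
  by apply/prodf_neq0 => k _; rewrite mxE ladder_entry_neq0// -ltnS.
have := mvop_norm PH nu0 n; rewrite IH// => /(congr1 -%R); rewrite opprK => E.
apply: (mulIr Lu); rewrite -E.
rewrite /cmx -raddfMn -raddfN -rmorphM; congr map_mx; rewrite -mulmxE.
apply/matrixP => i j; rewrite [LHS]mxE mulmxnE mul_diag_mx !mxE.
have [_|_] := eqVneq i j; last by rewrite !mulr0n mul0rn mulr0 oppr0.
rewrite !mulr1n sqnorm_entryS ?opprK//; first by rewrite -ltnS.
by rewrite -(wint1 nu0 fin) -(wint1 nu1 fin1) wint1_up.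
Qed.

End Families.
End SquaredNorms.

(** * The Rodrigues formula *)

Section RodriguesFormula.
Variables (R : realType) (N : nat).
Local Notation C := R[i].
Implicit Types (nu : R) (n k : nat).

Lemma rodrigues_entry_neq0 nu n k : 0 < nu -> (k <= N)%N -> rodrigues_entry N nu n k != 0.
Proof.
move=> nu0 kN; have kN0 : k%:R <= N%:R :> R by rewrite ler_nat.
have := ler0n R N; have := ler0n R n; have := ler0n R k => k0 n0 N0.
have ? : 0 < N%:R / 2 + nu by rewrite ltr_wpDl// divr_ge0.
have p (a : R) : 0 < a -> poch a n != 0 by exact: poch_neq0.
have s : (-1) ^+ n != 0 :> R by rewrite signr_eq0.
rewrite /rodrigues_entry mulf_neq0 ?invr_eq0//.
  by do !apply: mulf_neq0 => //; apply: p; lra.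
by do !apply: mulf_neq0 => //; apply: p; lra.
Qed.

(** The weight is a matrix of real polynomials, whereas P has complex matrix coefficients; psi
    embeds the first setting into the second. *)
Lemma polymx_cmx : exists psi : {rmorphism 'M[{poly R}]_N.+1 -> {poly 'M[C]_N.+1}},
  forall p k i j, (psi p)`_k i j = ((p i j)`_k)%:C.
Proof.
have [phi [_ _ _ phiE]] := mx_poly_ring_isom C N.
exists (phi \o map_mx (map_poly (real_complex R))) => p k i j.
by rewrite /= phiE mxE coef_map.
Qed.

(** The n-th derivative is known only on (-1, 1); openness permits one more differentiation. *)
Lemma derive1n_local (f g dg : R -> R) n :
  (forall x, -1 < x < 1 -> derive1n n f x = g x) ->
  (forall x : R, -1 < x < 1 -> is_derive x 1 g (dg x)) ->
  forall x, -1 < x < 1 -> derive1n n.+1 f x = dg x.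
Proof.
move=> fg gd x x1; rewrite derive1nS derive1E.
have [_ <-] := gd x x1; apply: near_eq_derive.
near=> y; apply: fg; suff : y \in `]-1, 1[ by rewrite in_itv.
by near: y; apply: near_in_itvoo; rewrite in_itv.
Unshelve. all: end_near. Qed.

Definition pearsonmxF nu : 'M[{poly R}]_N.+1 := map_mx polyC (pearsonF0 N nu) +
  'X *: map_mx polyC (pearsonF1 N nu) + 'X ^+ 2 *: map_mx polyC (pearsonF2 N nu).

Definition pearsonmxG nu : 'M[{poly R}]_N.+1 := map_mx polyC (pearsonG0 N nu) +
  'X *: map_mx polyC (pearsonG1 N nu).

Lemma pearsonmxF_wmx nu : 0 < nu ->
  pearsonmxF nu *m wmx N nu = (1 - 'X ^+ 2) *: wmx N (nu + 1).
Proof.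
move=> nu0; apply/matrixP => i j; rewrite [RHS]mxE [wmx N (nu + 1) i j]mxE.
rewrite wpol_mul//; [|by rewrite -ltnS..].
apply/polyP => k.
have -> : ((pearsonmxF nu *m wmx N nu) i j)`_k =
   \sum_l pearsonF0 N nu i l * (wpol N nu l j)`_k +
   \sum_l pearsonF1 N nu i l * ('X * wpol N nu l j)`_k +
   \sum_l pearsonF2 N nu i l * ('X * ('X * wpol N nu l j))`_k.
  rewrite mxE coef_sum -!big_split; apply: eq_bigr => l _ /=.
  have -> : pearsonmxF nu i l = (pearsonF0 N nu i l)%:P + 'X * (pearsonF1 N nu i l)%:P +
      'X ^+ 2 * (pearsonF2 N nu i l)%:P.
    by rewrite !mxE.
  move: (pearsonF0 N nu i l) (pearsonF1 N nu i l) (pearsonF2 N nu i l) => c0 c1 c2.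
  rewrite [wmx _ _ _ _]mxE; move: (wpol _ _ _ _) => w.
  by rewrite -!coefCM -!coefD; apply: (congr1 (fun p : {poly R} => p`_k)); ring.
rewrite (pearsonF0_sum nu i (fun l => (wpol N nu l j)`_k)).
rewrite (pearsonF1_sum nu i (fun l => ('X * wpol N nu l j)`_k)).
rewrite (pearsonF2_sum nu i (fun l => ('X * ('X * wpol N nu l j))`_k)).
rewrite coefZ pearson_rowE !coefD !coefZ.
move: (pearson_scale N nu) => s.
by ring.
Qed.

Lemma pearsonmxG_wmx nu : 0 < nu -> pearsonmxG nu *m wmx N nu =
  (1 - 'X ^+ 2) *: map_mx deriv (wmx N (nu + 1)) - ((2 * nu + 1) *: 'X) *: wmx N (nu + 1).
Proof.
move=> nu0; apply/matrixP => i j; rewrite [RHS]mxE ![in RHS]mxE.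
rewrite -scalerAl wpol_raise//; [|by rewrite -ltnS..].
apply/polyP => k.
have -> : ((pearsonmxG nu *m wmx N nu) i j)`_k =
   \sum_l pearsonG0 N nu i l * (wpol N nu l j)`_k +
   \sum_l pearsonG1 N nu i l * ('X * wpol N nu l j)`_k.
  rewrite mxE coef_sum -!big_split; apply: eq_bigr => l _ /=.
  have -> : pearsonmxG nu i l = (pearsonG0 N nu i l)%:P + 'X * (pearsonG1 N nu i l)%:P.
    by rewrite !mxE.
  move: (pearsonG0 N nu i l) (pearsonG1 N nu i l) => c0 c1.
  rewrite [wmx _ _ _ _]mxE; move: (wpol _ _ _ _) => w.
  by rewrite -!coefCM -!coefD; apply: (congr1 (fun p : {poly R} => p`_k)); ring.
rewrite (pearsonG0_sum nu i (fun l => (wpol N nu l j)`_k)).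
rewrite (pearsonG1_sum nu i (fun l => ('X * wpol N nu l j)`_k)).
rewrite coefZ !coefD !coefZ.
move: (raise_scale N nu) => s.
by ring.
Qed.

Section Families.
Variables (P : R -> nat -> {poly 'M[C]_N.+1}) (H : R -> nat -> 'M[C]_N.+1).
Hypothesis PH : forall nu : R, 0 < nu -> monic_mvop (weight N nu) (P nu) (H nu).

(** The induction also shows that P has real coefficients, so that every derivative is taken over R.
    The weight stays on the left side; its inverse enters only at the end. *)
Lemma mvop_rodrigues_real (psi : {rmorphism 'M[{poly R}]_N.+1 -> {poly 'M[C]_N.+1}}) :
  (forall p k i j, (psi p)`_k i j = ((p i j)`_k)%:C) ->
  forall n nu, 0 < nu -> exists p : 'M[{poly R}]_N.+1, P nu n = psi p /\
    forall (i j : 'I_N.+1) (x : R), -1 < x < 1 ->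
      (1 - x ^+ 2) `^ (nu - 2^-1) * ((p *m wmx N nu) i j).[x] =
      rodrigues_entry N nu n i * derive1n n (fun y => weight N (nu + n%:R) y i j) x.
Proof.
move=> psiE; have psiC (A : 'M[R]_N.+1) : psi (map_mx polyC A) = (cmx A)%:P.
  apply/polyP => k; apply/matrixP => i j; rewrite psiE mxE !coefC.
  by case: k => [|k] /=; rewrite mxE.
have psiX (A : 'M[{poly R}]_N.+1) m : psi ('X^m *: A) = psi A * 'X^m.
  apply/polyP => k; apply/matrixP => i j; rewrite psiE mxE coefMXn coefXnM.
  by case: ltnP => _; rewrite ?psiE// mxE.
have psi_deriv A : psi (map_mx deriv A) = (psi A)^`().
  apply/polyP => k; apply/matrixP => i j.
  by rewrite psiE mxE !coef_deriv mulmxnE psiE rmorphMn.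
elim=> [|n IH] nu nu0.
  exists 1; rewrite rmorph1 (mvop0 PH nu0); split=> // i j x x1.
  rewrite rodrigues_entry0 mul1r addr0 /= mulmxE mul1r mxE.
  by rewrite weightE.
have nu1 : 0 < nu + 1 by rewrite ltr_wpDr.
have [q [qP qR]] := IH _ nu1.
pose r := map_mx deriv q *m pearsonmxF nu + q *m pearsonmxG nu.
pose Linv : 'M[R]_N.+1 := diag_mx (\row_k (ladder_entry N nu n k)^-1).
exists (map_mx polyC Linv *m r); split.
  have := mvop_rodrigues PH nu0 n; rewrite qP => E.
  rewrite mulmxE rmorphM psiC.
  have -> : psi r = (cmx (laddermx N nu n))%:P * P nu n.+1.
    rewrite -E /r !mulmxE rmorphD !rmorphM psi_deriv; congr (_ * _ + _ * _).
    - rewrite /pearsonmxF /pearsonF -['X](expr1) !rmorphD !psiX !psiC.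
      by rewrite expr0 mulr1.
    - rewrite /pearsonmxG /pearsonG -['X](expr1) !rmorphD !psiX !psiC.
      by rewrite expr0 mulr1.
  rewrite mulrA -polyCM; have -> : cmx Linv * cmx (laddermx N nu n) = 1.
    rewrite -mulmxE -cmxM mulmx_diag; apply/matrixP => i j; rewrite !mxE.
    by case: eqP => [->|]; rewrite ?mulVf ?ladder_entry_neq0// -ltnS.
  by rewrite mul1r.
move=> i j x x1.
have iN : (i <= N)%N by rewrite -ltnS.
have L0 := ladder_entry_neq0 n nu0 iN.
have rodS := rodrigues_entryS n nu0 iN.
have rod0 := rodrigues_entry_neq0 n nu1 iN.
(* Both Pearson relations combined: (1 - x^2)^(nu - 1/2) times r w^(nu) is the derivative of (1 -
   x^2)^(nu + 1/2) times q w^(nu+1). *)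
have rw : r *m wmx N nu = (1 - 'X ^+ 2) *: map_mx deriv (q *m wmx N (nu + 1)) -
    ((2 * nu + 1) *: 'X) *: (q *m wmx N (nu + 1)).
  rewrite /r mulmxDl -!mulmxA pearsonmxF_wmx// pearsonmxG_wmx// deriv_mulmx.
  by rewrite scalerDr mulmxBr -!scalemxAr addrA.
set rod := rodrigues_entry N (nu + 1) n i in qR rodS rod0 *.
pose g (y : R) := rod^-1 * ((1 - y ^+ 2) `^ (nu + 1 - 2^-1) * ((q *m wmx N (nu + 1)) i j).[y]).
pose dg (y : R) := rod^-1 * ((1 - y ^+ 2) `^ (nu - 2^-1) * ((r *m wmx N nu) i j).[y]).
(* By induction g is an entry of the n-th derivative of W with parameter nu + 1 + n, the same
   parameter as nu + n.+1, and dg is its derivative. *)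
have -> : derive1n n.+1 (fun y => weight N (nu + n.+1%:R) y i j) x = dg x.
  apply: (@derive1n_local _ g) => // y y1.
    rewrite /g qR// mulKf// -natr1.
    by rewrite [n%:R + 1]addrC addrA.
  have D := is_derive_weight_poly (nu + 1 - 2^-1) ((q *m wmx N (nu + 1)) i j) y1.
  apply: (is_derive_eq (is_deriveZ rod^-1 D)); rewrite /dg -[_ *: _]/(_ * _).
  congr (_ * (_ `^ _ * _.[_])); first by ring.
  rewrite rw; move: (q *m _) => z; rewrite !mxE -scalerAl.
  by congr (_ - _ *: _); field.
have rod1 := rodrigues_entry_neq0 n.+1 nu0 iN.
rewrite /dg -rodS -mulmxA map_diag_mx; move: (r *m _) => z.
rewrite mul_diag_mx !mxE hornerM hornerC; move: (_ `^ _) (_.[x]) => a b.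
by field; rewrite rod1 L0.
Qed.

Lemma mxeval_cmx (psi : 'M[{poly R}]_N.+1 -> {poly 'M[C]_N.+1}) p x :
  (forall k i j, (psi p)`_k i j = ((p i j)`_k)%:C) ->
  mxeval (psi p) x = cmx (map_mx (horner_eval x) p).
Proof.
move=> psiE; rewrite mxevalE; apply/matrixP => i j.
rewrite summxE cmxE mxE /horner_eval (@horner_coef_wide _ (size (psi p))).
  by rewrite rmorph_sum; apply: eq_bigr => k _; rewrite mxE psiE mulrC rmorphM.
apply/leq_sizeP => k sk; have := psiE k i j.
by rewrite nth_default// mxE => /esym [].
Qed.

Lemma mvop_rodrigues_formula nu n (x : R) : 0 < nu -> -1 < x < 1 ->
  mxeval (P nu n) x = cmx (diag_mx (\row_k rodrigues_entry N nu n k)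
    *m mxderiv n (weight N (nu + n%:R)) x *m invmx (weight N nu x)).
Proof.
move=> nu0 x1; have [psi psiE] := polymx_cmx.
have [p [-> pR]] := mvop_rodrigues_real psiE n nu0.
rewrite (mxeval_cmx x (psiE p)); congr cmx.
have Wu := weight_unitmx nu0 (PH nu0) x1.
apply: (can_inj (mulmxK Wu)); rewrite mulmxKV//.
apply/matrixP => i j; rewrite mul_diag_mx [RHS]mxE [X in X * _]mxE [X in _ * X]mxE -pR//.
rewrite [LHS]mxE [(p *m _) i j]mxE horner_sum mulr_sumr.
by apply: eq_bigr => k _; rewrite weightE// hornerM [wmx _ _ _ _]mxE mxE mulrCA.
Qed.

End Families.
End RodriguesFormula.

Theorem theorem3p1 (R : realType) (N : nat)
    (P : R -> nat -> {poly 'M[R[i]]_N.+1})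
    (H : R -> nat -> 'M[R[i]]_N.+1)
    (PH : forall nu : R, 0 < nu -> monic_mvop (weight N nu) (P nu) (H nu))
    (nu : R) (nu_gt0 : 0 < nu) (n : nat) :
  [/\ H nu n = cmx (diag_mx (\row_(k < N.+1) sqnorm_entry N nu n k)),
      deriv (P nu n) = (if n is m.+1 then P (nu + 1) m else 0) *+ n &
      forall x : R, -1 < x < 1 ->
        mxeval (P nu n) x =
        cmx (diag_mx (\row_(k < N.+1) rodrigues_entry N nu n k)
             *m mxderiv n (weight N (nu + n%:R)) x
             *m invmx (weight N nu x))].
Proof.
split.
- exact: mvop_normE PH _ _ nu_gt0.
- case: n => [|n]; last exact: mvop_deriv PH _ nu_gt0 n.
  by rewrite (mvop0 PH nu_gt0) mulr0n -polyC1 derivC.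
- by move=> x x1; exact: mvop_rodrigues_formula PH _ _ _ nu_gt0 x1.
Qed.
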